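(* Let $(\Gamma\backslash G,J)$ be the complex solvmanifold presenting an Oeljeklaus-Toma manifold $X(K,U)$, and define the complex vector spaces of line-bundle-valued forms $$W_1=\left\langle \alpha_1\otimes v_{e^{x_1}},\dots,\alpha_s\otimes v_{e^{x_s}},\ \beta_1\otimes v_{e^{\psi_1(x)}},\dots,\beta_t\otimes v_{e^{\psi_t(x)}}\right\rangle,$$ $$W_2=\left\langle \bar\alpha_1,\dots,\bar\alpha_s,\ \bar\beta_1\otimes v_{e^{\bar\psi_1(x)}},\dots,\bar\beta_t\otimes v_{e^{\bar\psi_t(x)}}\right\rangle .$$ Then, for any integers $p,q$, an isomorphism $$\bigwedge^{p}W_1\otimes\bigwedge^{q}W_2\;\cong\;\bigoplus_{E_\alpha\in\mathcal{A}_{(G,N)}(\Gamma)}H^{p,q}(\Gamma\backslash G,E_\alpha)$$ holds. Hence $$\dim\Big(\bigwedge^{p}\mathbb{C}^{s+t}\otimes\bigwedge^{q}\mathbb{C}^{s+t}\Big)=\sum_{E_\alpha\in\mathcal{A}_{(G,N)}(\Gamma)}\dim H^{p,q}(\Gamma\backslash G,E_\alpha).$$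
   Context: Number field data. Let $s,t$ be positive integers and $K$ an extension field of $\mathbb{Q}$ of degree $s+2t$ with embeddings $\sigma_1,\dots,\sigma_{s+2t}$ into $\mathbb{C}$, where $\sigma_1,\dots,\sigma_s$ are real and $\sigma_{s+1},\dots,\sigma_{s+2t}$ are non-real with $\sigma_{s+i}=\overline{\sigma_{s+t+i}}$ for $1\le i\le t$. Let $\mathcal{O}_K$ be the ring of integers, $\mathcal{O}_K^{*,+}$ the group of units $a$ with $\sigma_i(a)>0$ for $1\le i\le s$, and $\sigma:\mathcal{O}_K\to\mathbb{R}^{s}\times\mathbb{C}^{t}$, $\sigma(a)=(\sigma_1(a),\dots,\sigma_{s+t}(a))$. Let $U\subset\mathcal{O}_K^{*,+}$ be a free abelian subgroup of rank $s$ such that $\Lambda=\{(\log\sigma_1(u),\dots,\log\sigma_s(u)):u\in U\}$ is a lattice in $\mathbb{R}^{s}$. The OT-manifold $X(K,U)$ is the quotient of $H^{s}\times\mathbb{C}^{t}$ ($H$ the upper half plane) by the group $U\ltimes\mathcal{O}_K$, where $(a,b)$ acts on the $i$-th coordinate by multiplication by $\sigma_i(a)$ followed by translation by $\sigma_i(b)$, $1\le i\le s+t$. Solvmanifold presentation. Fix real-linear functions $\psi_1,\dots,\psi_t:\mathbb{R}^{s}\to\mathbb{C}$ such that $e^{\psi_k(x)}=\sigma_{s+k}(u)$ whenever $u\in U$ and $x=(\log\sigma_1(u),\dots,\log\sigma_s(u))$ (these exist). Let $G=\mathbb{R}^{s}\ltimes_\phi(\mathbb{R}^{s}\oplus\mathbb{C}^{t})$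 with coordinates $(x,y,z)$ and $\phi(x)(y,z)=(e^{x_1}y_1,\dots,e^{x_s}y_s,e^{\psi_1(x)}z_1,\dots,e^{\psi_t(x)}z_t)$. Let $\Delta=\sigma(\mathcal{O}_K)$, a lattice in $\mathbb{R}^s\oplus\mathbb{C}^t$ preserved by $\phi(\Lambda)$, and $\Gamma=\Lambda\ltimes_\phi\Delta$, a cocompact discrete subgroup of $G$. Forms on $\Gamma\backslash G$ are identified with left-$\Gamma$-invariant forms on $G$. The left-invariant complex structure $J$ on $\Gamma\backslash G$ is the one whose $(1,0)$-forms are spanned by $$\alpha_i=dx_i+\sqrt{-1}\,e^{-x_i}dy_i\ (1\le i\le s),\qquad \beta_k=e^{-\psi_k(x)}dz_k\ (1\le k\le t);$$ it is integrable and $X(K,U)$ is identified with the complex manifold $(\Gamma\backslash G,J)$. Line bundles. Let $N=\mathbb{R}^{s}\oplus\mathbb{C}^{t}$ be the nilradical of $G$ and $\mathcal{A}_{(G,N)}$ the set of Lie group homomorphisms $\alpha:G\to\mathbb{C}^{*}$ trivial on $N$, i.e. the functions $e^{\Psi(x)}$ with $\Psi:\mathbb{R}^{s}\to\mathbb{C}$ real-linear. For $\alpha\in\mathcal{A}_{(G,N)}$ let $E_\alpha=\Gamma\backslash(G\times\mathbb{C})$ for the action $\gamma\cdot(g,c)=(\gamma g,\alpha(\gamma)c)$; it is a flat, hence holomorphic, line bundle over $\Gamma\backslash G$, and $v_\alpha$ denotes the nowhere-vanishing smooth global section induced by $g\mapsto(g,\alpha(g))$. $\mathcal{A}_{(G,N)}(\Gamma)$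 denotes the set of isomorphism classes of flat bundles $E_\alpha$, $\alpha\in\mathcal{A}_{(G,N)}$; it is identified with $\{\alpha|_\Gamma:\alpha\in\mathcal{A}_{(G,N)}\}\cong\mathrm{Hom}(\Lambda,\mathbb{C}^{*})$. $A^{p,q}(\Gamma\backslash G,E_\alpha)$ denotes smooth $E_\alpha$-valued $(p,q)$-forms and $H^{p,q}(\Gamma\backslash G,E_\alpha)$ Dolbeault cohomology. Using $E_\alpha\otimes E_\beta\cong E_{\alpha\beta}$, the direct sum $\bigoplus_{E_\alpha\in\mathcal{A}_{(G,N)}(\Gamma)}A^{*,*}(\Gamma\backslash G,E_\alpha)$ is an algebra under the wedge product, and $\bigwedge^{p}W_1\otimes\bigwedge^{q}W_2$ is regarded as a subspace of $\bigoplus_{E_\alpha\in\mathcal{A}_{(G,N)}(\Gamma)}A^{p,q}(\Gamma\backslash G,E_\alpha)$; $\bar\alpha_1,\dots,\bar\alpha_s$ are regarded as forms with values in the trivial line bundle. *)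

(* Defs.v *)
From HB Require Import structures.
From mathcomp Require Import all_boot all_order all_algebra all_field.
From mathcomp Require Import complex.
From mathcomp Require Import all_classical all_reals all_analysis.
Set Implicit Arguments.
Unset Strict Implicit.
Unset Printing Implicit Defensive.
Import Order.TTheory GRing.Theory Num.Theory.
Import numFieldNormedType.Exports.
Local Open Scope classical_set_scope.
Local Open Scope ring_scope.
Local Open Scope quotient_scope.

Section LinearAlgebra.
Context {F : fieldType}.

Section Subspace.
Context {V : lmodType F} (S : submodClosed V).
Record subspace := Subspace { subspace_val :> V; _ : subspace_val \in S }.
HB.instance Definition _ := [isSub for subspace_val].
HB.instance Definition _ := [Choice of subspace by <:].
HB.instance Definition _ := [SubChoice_isSubLmodule of subspace by <:].
End Subspace.

Section QuotientSpace.
Context {V : lmodType F} (B : submodClosed V).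

(* [submodClosed] does not record closure under opposite, which the library's
   quotient group needs. *)
Definition divisor : {pred V} := [pred x in B].
Lemma divisor_zmod_closed : zmod_closed divisor.
Proof. exact: GRing.submod_closedB (submodClosedP B). Qed.
HB.instance Definition _ := GRing.isZmodClosed.Build V divisor
  divisor_zmod_closed.

Definition quotient := Quotient.quot divisor.
HB.instance Definition _ := EqQuotient.on quotient.
HB.instance Definition _ := GRing.Zmodule.on quotient.

Definition quot_class (x : V) : quotient := \pi_(Quotient.quot divisor) x.
Definition quot_scale (c : F) (x : quotient) : quotient :=
  quot_class (c *: repr x).

Let quot_classK (x : quotient) : quot_class (repr x) = x.
Proof. exact: reprK. Qed.
Let quot_classD x y : quot_class (x + y) = quot_class x + quot_class y.
Proof. by rewrite /quot_class raddfD. Qed.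

Lemma quot_classZ c x : quot_class (c *: x) = quot_scale c (quot_class x).
Proof.
apply/eqP; rewrite -Quotient.idealrBE -scalerBr.
have: x - repr (quot_class x) \in divisor by rewrite Quotient.idealrBE reprK.
by rewrite !inE => /rpredZ ->.
Qed.

Let scaleqA a b x : quot_scale a (quot_scale b x) = quot_scale (a * b) x.
Proof. by rewrite -[x]quot_classK -!quot_classZ scalerA. Qed.
Let scale1q : left_id 1 quot_scale.
Proof. by move=> x; rewrite -[x]quot_classK -!quot_classZ scale1r. Qed.
Let scaleqDr : right_distributive quot_scale +%R.
Proof.
move=> a x y; rewrite -[x]quot_classK -[y]quot_classK.
by rewrite -quot_classD -!quot_classZ -quot_classD scalerDr.
Qed.
Let scaleqDl x : {morph quot_scale^~ x : a b / a + b}.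
Proof.
by move=> a b; rewrite -[x]quot_classK -!quot_classZ scalerDl quot_classD.
Qed.

HB.instance Definition _ := GRing.Zmodule_isLmodule.Build F quotient
  scaleqA scale1q scaleqDr scaleqDl.
End QuotientSpace.

Section DirectSum.
Context {I : choiceType} (V : I -> lmodType F).

Definition dprod := forall i, V i.
HB.instance Definition _ := gen_eqMixin dprod.
HB.instance Definition _ := gen_choiceMixin dprod.

Let add (f g : dprod) : dprod := fun i => f i + g i.
Let opp (f : dprod) : dprod := fun i => - f i.
Let scale c (f : dprod) : dprod := fun i => c *: f i.
Let addA : associative add.
Proof. by move=> f g h; apply: functional_extensionality_dep => i; apply: addrA. Qed.
Let addC : commutative add.
Proof. by move=> f g; apply: functional_extensionality_dep => i; apply: addrC. Qed.
Let add0 : left_id ((fun=> 0) : dprod) add.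
Proof. by move=> f; apply: functional_extensionality_dep => i; apply: add0r. Qed.
Let addN : left_inverse ((fun=> 0) : dprod) opp add.
Proof. by move=> f; apply: functional_extensionality_dep => i; apply: addNr. Qed.
HB.instance Definition _ := GRing.isZmodule.Build dprod addA addC add0 addN.

Let scaleA a b (f : dprod) : scale a (scale b f) = scale (a * b) f.
Proof. by apply: functional_extensionality_dep => i; apply: scalerA. Qed.
Let scale1 : left_id 1 scale.
Proof. by move=> f; apply: functional_extensionality_dep => i; apply: scale1r. Qed.
Let scaleDr : right_distributive scale +%R.
Proof. by move=> a f g; apply: functional_extensionality_dep => i; apply: scalerDr. Qed.
Let scaleDl (f : dprod) : {morph scale^~ f : a b / a + b}.
Proof. by move=> a b; apply: functional_extensionality_dep => i; apply: scalerDl. Qed.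
HB.instance Definition _ := GRing.Zmodule_isLmodule.Build F dprod
  scaleA scale1 scaleDr scaleDl.

Definition finsupp : {pred dprod} :=
  [pred f : dprod | `[< finite_set [set i | f i != 0] >]].

Lemma finsupp_submod_closed : submod_closed finsupp.
Proof.
split=> [|a f g].
  rewrite unfold_in /=; apply/asboolP.
  have -> : [set i | (0 : dprod) i != 0] = set0; last exact: finite_set0.
  by apply/seteqP; split=> i //=; rewrite eqxx.
rewrite !unfold_in /= => /asboolP Ff /asboolP Fg; apply/asboolP.
apply: (@sub_finite_set _ _ ([set i | f i != 0] `|` [set i | g i != 0])).
  move=> i /=; apply: contra_neqP => /not_orP[/negP/negPn/eqP fi0 /negP/negPn/eqP gi0].
  rewrite [LHS](_ : _ = a *: f i + g i) // fi0 gi0.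
  by rewrite scaler0 addr0.
by rewrite finite_setU.
Qed.
HB.instance Definition _ := GRing.isSubmodClosed.Build F dprod finsupp
  finsupp_submod_closed.

Definition dsum := subspace finsupp.
HB.instance Definition _ := GRing.Lmodule.on dsum.
End DirectSum.

(* The dimension, in [0, +oo]. *)
Definition lin_indep {V : lmodType F} n (v : 'I_n -> V) : Prop :=
  forall c : 'I_n -> F, \sum_i c i *: v i = 0 -> forall i, c i = 0.

Definition edim (R : realType) (V : lmodType F) : \bar R :=
  ereal_sup [set (n%:R)%:E | n in [set n | exists v : 'I_n -> V, lin_indep v]].

End LinearAlgebra.

Section Smooth.
Context {R : realType} {V : normedModType R}.

(* For finite-dimensional [V] this is the usual notion: [f] is C^n.+1 iff all
   its directional derivatives exist and are C^n. *)
Fixpoint Ck (n : nat) (f : V -> R) : Prop :=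
  if n is n'.+1 then
    (forall x v, derivable f x v) /\ (forall v, Ck n' (fun x => 'D_v f x))
  else continuous f.

Definition smooth (f : V -> R[i]) : Prop :=
  forall n, Ck n (fun x => complex.Re (f x)) /\ Ck n (fun x => complex.Im (f x)).

Definition deriveC (f : V -> R[i]) (x v : V) : R[i] :=
  ('D_v (fun x => complex.Re (f x)) x +i* 'D_v (fun x => complex.Im (f x)) x)%C.

Lemma Ck_lin n a (f g : V -> R) : Ck n f -> Ck n g -> Ck n (a *: f + g).
Proof.
elim: n f g => [|n IH] f g /=.
  move=> cf cg x; apply: continuousD; last exact: cg.
  by by apply: continuousZl_tmp; exact: cf.
move=> [df Df] [dg Dg]; split=> [x v|v].
  by apply: derivableD => //; apply: derivableZ.
rewrite (_ : (fun x => _) = a *: (fun x => 'D_v f x) + (fun x => 'D_v g x)).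
  exact: IH.
apply/funext => x; rewrite deriveD // ?deriveZ //.
exact: derivableZ.
Qed.

Lemma ReD_scale (c z w : R[i]) : complex.Re (c * z + w) =
  complex.Re c * complex.Re z + (- complex.Im c * complex.Im z + complex.Re w).
Proof. by case: c z w => [a b] [x y] [u v] /=; rewrite addrA mulNr. Qed.

Lemma ImD_scale (c z w : R[i]) : complex.Im (c * z + w) =
  complex.Re c * complex.Im z + (complex.Im c * complex.Re z + complex.Im w).
Proof. by case: c z w => [a b] [x y] [u v] /=; rewrite addrA. Qed.

Lemma smooth_lin (c : R[i]) (f h : V -> R[i]) :
  smooth f -> smooth h -> smooth (fun x => c * f x + h x).
Proof.
move=> sf sh n; have [fr fi] := sf n; have [hr hi] := sh n; split.
- rewrite (_ : (fun x => _) = complex.Re c *: (fun x => complex.Re (f x)) +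
    (- complex.Im c *: (fun x => complex.Im (f x)) + (fun x => complex.Re (h x)))).
    by do 2 apply: Ck_lin => //.
  by apply/funext => x; rewrite ReD_scale.
- rewrite (_ : (fun x => _) = complex.Re c *: (fun x => complex.Im (f x)) +
    (complex.Im c *: (fun x => complex.Re (f x)) + (fun x => complex.Im (h x)))).
    by do 2 apply: Ck_lin => //.
  by apply/funext => x; rewrite ImD_scale.
Qed.

Lemma derive_lin2 (a b : R) (f g h : V -> R) x v :
  derivable f x v -> derivable g x v -> derivable h x v ->
  'D_v (fun x => a * f x + (b * g x + h x)) x =
  a * 'D_v f x + (b * 'D_v g x + 'D_v h x).
Proof.
move=> df dg dh.
have daf : derivable (a *: f) x v by exact: derivableZ.
have dbg : derivable (b *: g) x v by exact: derivableZ.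
have dbgh : derivable (b *: g + h) x v by exact: derivableD.
rewrite [LHS](_ : _ = 'D_v (a *: f + (b *: g + h)) x) //.
by rewrite (deriveD daf dbgh) (deriveD dbg dh) (deriveZ _ df) (deriveZ _ dg).
Qed.

Lemma deriveC_lin (c : R[i]) (f h : V -> R[i]) x v :
  smooth f -> smooth h ->
  deriveC (fun x => c * f x + h x) x v = c * deriveC f x v + deriveC h x v.
Proof.
move=> sf sh; have [[fr _] [fi _]] := sf 1; have [[hr _] [hi _]] := sh 1.
rewrite /deriveC.
under [X in 'D_v X x]eq_fun do rewrite ReD_scale.
under [X in (_ +i* 'D_v X x)%C]eq_fun do rewrite ImD_scale.
rewrite !derive_lin2 //; apply/eqP; rewrite eq_complex ReD_scale ImD_scale /=.
by rewrite !eqxx.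
Qed.

Lemma smooth0 : smooth (fun=> 0 : R[i]).
Proof.
have C0 n : Ck n ((fun=> 0) : V -> R).
  elim: n => [|n IH] /=; first exact: cst_continuous.
  split=> [x v|v]; first exact: derivable_cst.
  by rewrite (_ : (fun x => _) = fun=> 0) //; apply/funext => x; rewrite derive_cst.
by move=> n; split; exact: C0.
Qed.

End Smooth.

Definition cexp {R : realType} (z : R[i]) : R[i] :=
  ((expR (complex.Re z) * cos (complex.Im z)) +i*
   (expR (complex.Re z) * sin (complex.Im z)))%C.

Section NumberField.
Context {R : realType} {K : fieldExtType rat} (s t : nat).

(* The embeddings are listed as [s] real ones, then [t] non-real ones, then
   the complex conjugates of the latter. *)
Variable sigma : 'I_(s + (t + t)) -> {rmorphism K -> R[i]}.

Definition sigma_real (i : 'I_s) (a : K) : R :=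
  complex.Re (sigma (lshift (t + t) i) a).
Definition sigma_cplx (k : 'I_t) : {rmorphism K -> R[i]} :=
  sigma (rshift s (lshift t k)).
Definition sigma_conj (k : 'I_t) : {rmorphism K -> R[i]} :=
  sigma (rshift s (rshift t k)).

Definition is_embedding_list : Prop :=
  [/\ forall i j, sigma i =1 sigma j -> i = j,
      forall i a, complex.Im (sigma (lshift (t + t) i) a) = 0,
      forall k, exists a, complex.Im (sigma_cplx k a) != 0
    & forall k a, sigma_cplx k a = (sigma_conj k a)^*].

Definition ring_of_integers : set K :=
  [set a | integralOver (intr : int -> K) a].

Definition positive_units : set K :=
  [set a | [/\ a != 0, ring_of_integers a, ring_of_integers a^-1
             & forall i, 0 < sigma_real i a]].

Definition free_abelian_of_rank (n : nat) (U : set K) : Prop :=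
  exists u : 'I_n -> K,
    let mon := fun m : {ffun 'I_n -> int} => \prod_i u i ^ m i in
    [/\ forall i, u i != 0, injective mon & U = range mon].

Definition log_vec (u : K) : 'rV[R]_s := \row_i ln (sigma_real i u).

Definition lattice {n} (L : set 'rV[R]_n) : Prop :=
  exists2 B : 'M[R]_n, B \in unitmx
    & L = range (fun m : 'rV[int]_n => map_mx intr m *m B).

Definition admissible (U : set K) : Prop :=
  [/\ U `<=` positive_units, free_abelian_of_rank s U
    & lattice (log_vec @` U)].

End NumberField.

(* Strictly increasing multi-indices, which index the standard basis of the
   exterior power; cf. [card_ltn_sorted_tuples]. *)
Definition incr (p n : nat) : finType :=
  {a : p.-tuple 'I_n | sorted ltn (map val a)}.

(* Lambda^p C^n (x) Lambda^q C^n, with C = R[i], in the basis e_a (x) e_b. *)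
Definition ext_tensor (R : realType) (p q n : nat) := {ffun incr p n * incr q n -> R[i]}.
HB.instance Definition _ R p q n := GRing.Lmodule.on (ext_tensor R p q n).
Definition ext_basis (R : realType) p q n (a : incr p n) (b : incr q n) :
    ext_tensor R p q n :=
  [ffun x => (x == (a, b))%:R].

Section OTSolvmanifold.
Context {R : realType} {s t : nat}.
Variable psi : 'I_t -> {linear 'rV[R]_s -> Rcomplex R}.

(* Points ((x, y), (Re z, Im z)) of R^s x R^s x C^t; the same space serves as
   the tangent space at each point. *)
Definition OTgroup : normedModType R :=
  ('rV[R]_s * 'rV[R]_s * ('rV[R]_t * 'rV[R]_t))%type.

Definition xc (g : OTgroup) : 'rV[R]_s := g.1.1.
Definition yc (g : OTgroup) : 'rV[R]_s := g.1.2.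
Definition zc (g : OTgroup) (k : 'I_t) : R[i] := (g.2.1 0 k +i* g.2.2 0 k)%C.
Definition OTpoint (x y : 'rV[R]_s) (z : 'I_t -> R[i]) : OTgroup :=
  (x, y, (\row_k complex.Re (z k), \row_k complex.Im (z k))).

Definition OTmul (g h : OTgroup) : OTgroup :=
  OTpoint (xc g + xc h)
          (\row_i (yc g 0 i + expR (xc g 0 i) * yc h 0 i))
          (fun k => zc g k + cexp (psi k (xc g)) * zc h k).

Definition OTlattice {K : fieldExtType rat}
    (sigma : 'I_(s + (t + t)) -> {rmorphism K -> R[i]}) (U : set K) :
    set OTgroup :=
  [set g | exists2 u, U u & exists2 a, ring_of_integers a &
     g = OTpoint (log_vec sigma u) (\row_i sigma_real sigma i a)
                 (fun k => sigma_cplx sigma k a)].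

(* Complex-valued 1-forms and k-forms on G, evaluated on tangent vectors. *)
Definition oneform := OTgroup -> OTgroup -> R[i].
Definition form (k : nat) := OTgroup -> ('I_k -> OTgroup) -> R[i].
HB.instance Definition _ k := GRing.Lmodule.on (form k).

Definition wedge {k} (th : 'I_k -> oneform) : form k :=
  fun g v => \det (\matrix_(i, j) th i g (v j)).

Definition smooth_form {k} (om : form k) : Prop :=
  forall v, smooth (om ^~ v).

(* The exterior derivative, computed with constant vector fields. *)
Definition ext_d {k} (om : form k) : form k.+1 :=
  fun g v => \sum_(i < k.+1)
    (-1) ^+ i * deriveC (om ^~ (fun j => v (lift i j))) g (v i).

Definition pull {k} (gam : OTgroup) (om : form k) : form k :=
  fun g v => om (OTmul gam g) (fun i => 'D_(v i) (OTmul gam) g).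

(* The left-invariant frame alpha_1, ..., alpha_s, beta_1, ..., beta_t. *)
Definition theta (i : 'I_(s + t)) : oneform := fun g v =>
  match fintype.split i with
  | inl i => (xc v 0 i +i* (expR (- xc g 0 i) * yc v 0 i))%C
  | inr k => cexp (- psi k (xc g)) * zc v k
  end.
Definition theta_bar (i : 'I_(s + t)) : oneform := fun g v => (theta i g v)^*.

(* For [p <= k]: the forms of type (p, k - p) for J. *)
Definition bidegree (p : nat) {k} (om : form k) : Prop :=
  exists f : {ffun 'I_k -> 'I_(s + t)} -> OTgroup -> R[i],
    forall g v, om g v = \sum_a f a g *
      wedge (fun i : 'I_k => if (i < p)%N then theta (a i) else theta_bar (a i))
        g v.

(* On (p, k - p)-forms: [dbar om = eta].  J being integrable, this says that
   d om is the sum of a (p + 1, k - p)-form and of the (p, k - p + 1)-form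
   eta. *)
Definition is_dbar (p : nat) {k} (om : form k) (eta : form k.+1) : Prop :=
  bidegree p eta /\ bidegree p.+1 (ext_d om - eta).

(* The set A_(G,N); N is the locus x = 0, and smooth homomorphisms to C^* are
   the Lie group homomorphisms. *)
Definition char_of_G (al : OTgroup -> R[i]) : Prop :=
  [/\ smooth al, forall g, al g != 0,
      forall g h, al (OTmul g h) = al g * al h
    & forall g, xc g = 0 -> al g = 1].

Lemma bidegree_lin p k c (om om' : form k) :
  bidegree p om -> bidegree p om' -> bidegree p (c *: om + om').
Proof.
move=> [f hf] [f' hf']; exists (fun a g => c * f a g + f' a g) => g v.
rewrite [LHS](_ : _ = c * om g v + om' g v) // hf hf' mulr_sumr -big_split /=.
by apply: eq_bigr => a _; rewrite mulrDl mulrA.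
Qed.

Lemma bidegree0 p k : bidegree p (0 : form k).
Proof.
by exists (fun _ _ => 0) => g v; rewrite big1 // => a _; rewrite mul0r.
Qed.

Lemma ext_d_lin k c (om om' : form k) : smooth_form om -> smooth_form om' ->
  ext_d (c *: om + om') = c *: ext_d om + ext_d om'.
Proof.
move=> som som'; apply/funext => g; apply/funext => v.
rewrite [RHS](_ : _ = c * ext_d om g v + ext_d om' g v) //.
rewrite /ext_d mulr_sumr -big_split /=; apply: eq_bigr => i _.
rewrite mulrCA -mulrDr; congr (_ * _).
exact: deriveC_lin.
Qed.

Lemma ext_d0 k : ext_d (0 : form k) = 0.
Proof.
apply/funext => g; apply/funext => v; rewrite /ext_d big1 // => i _.
rewrite [X in _ * X](_ : _ = 0) ?mulr0 //.
by rewrite /deriveC !derive_cst.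
Qed.

Lemma smooth_form_lin k c (om om' : form k) :
  smooth_form om -> smooth_form om' -> smooth_form (c *: om + om').
Proof. by move=> som som' v; apply: smooth_lin. Qed.

Lemma is_dbar_lin p k c (om om' : form k) eta eta' :
  smooth_form om -> smooth_form om' -> is_dbar p om eta -> is_dbar p om' eta' ->
  is_dbar p (c *: om + om') (c *: eta + eta').
Proof.
move=> som som' [be de] [be' de']; split; first exact: bidegree_lin.
by rewrite ext_d_lin // opprD addrACA -scalerBr; apply: bidegree_lin.
Qed.

Lemma is_dbar0 p k : is_dbar p (0 : form k) 0.
Proof. by split; rewrite ?ext_d0 ?subr0; apply: bidegree0. Qed.

Section LineBundles.
Variable Gam : set OTgroup.

(* E_alpha is determined by the restriction of alpha to Gamma. *)
Definition line_bundles : set (Gam -> R[i]) :=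
  [set chi | exists2 al, char_of_G al & forall gam : Gam, chi gam = al (val gam)].

(* Sections of E_alpha over Gamma \ G are the functions f on G with
   f (gamma g) = alpha (gamma) f (g); in particular v_alpha is alpha.  The total
   degree is written [q + p] so that [dbar] raises [q] definitionally. *)
Definition E_form (p q : nat) (chi : Gam -> R[i]) (om : form (q + p)) : Prop :=
  [/\ bidegree p om, smooth_form om
    & forall gam : Gam, pull (val gam) om = chi gam *: om].

Lemma E_form_lin p q chi c (om om' : form (q + p)) :
  @E_form p q chi om -> @E_form p q chi om' -> @E_form p q chi (c *: om + om').
Proof.
move=> [b1 s1 e1] [b2 s2 e2]; split; first exact: bidegree_lin.
  exact: smooth_form_lin.
move=> gam; rewrite scalerDr scalerA mulrC -scalerA -e1 -e2.
by apply/funext => g; apply/funext.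
Qed.

Lemma E_form0 p q chi : @E_form p q chi 0.
Proof.
split; [exact: bidegree0 | by move=> v; exact: smooth0 |].
by move=> gam; rewrite scaler0; apply/funext => g; apply/funext.
Qed.

Definition dbar_closed p q chi : {pred form (q + p)} :=
  [pred om | `[< @E_form p q chi om /\ is_dbar p om 0 >]].

Definition dbar_exact p q chi : {pred form (q + p)} :=
  match q return {pred form (q + p)} with
  | 0 => [pred om | om == 0]
  | q'.+1 => [pred om | `[< exists2 eta, @E_form p q' chi eta & is_dbar p eta om >]]
  end.

Lemma dbar_closed_submod_closed p q chi : submod_closed (@dbar_closed p q chi).
Proof.
split=> [|c om om']; first rewrite unfold_in /=; last rewrite !unfold_in /=.
  by apply/asboolP; split; [exact: E_form0 | exact: is_dbar0].
move=> /asboolP[E d] /asboolP[E' d']; apply/asboolP; split.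
  exact: E_form_lin.
rewrite -[0]addr0 -{1}(scaler0 _ c); apply: is_dbar_lin => //.
  by case: E. by case: E'.
Qed.
HB.instance Definition _ p q chi := GRing.isSubmodClosed.Build R[i]
  (form (q + p)) (@dbar_closed p q chi) (@dbar_closed_submod_closed p q chi).

Lemma dbar_exact_submod_closed p q chi : submod_closed (@dbar_exact p q chi).
Proof.
case: q => [|q]; split=> [|c om om']; rewrite ?unfold_in /=.
- exact: eqxx.
- by move=> /(elimT eqP)-> /(elimT eqP)->; apply/eqP; rewrite scaler0 addr0.
- by apply/asboolP; exists 0; [exact: E_form0 | exact: is_dbar0].
- move=> /asboolP[eta E d] /asboolP[eta' E' d'].
  apply/asboolP; exists (c *: eta + eta'); first exact: E_form_lin.
  by apply: is_dbar_lin => //; [case: E | case: E'].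
Qed.

(* The Dolbeault cohomology H^{p,q}(Gamma \ G, E_chi). *)
Definition cocycles p q chi := subspace (@dbar_closed p q chi).
HB.instance Definition _ p q chi := GRing.Lmodule.on (@cocycles p q chi).

Definition coboundaries p q chi : {pred cocycles p q chi} :=
  [pred om | subspace_val om \in @dbar_exact p q chi].
Lemma coboundaries_submod_closed p q chi : submod_closed (@coboundaries p q chi).
Proof.
have [h0 hL] := @dbar_exact_submod_closed p q chi.
by split=> [|c om om']; rewrite !unfold_in //=; exact: hL.
Qed.
HB.instance Definition _ p q chi := GRing.isSubmodClosed.Build R[i]
  (cocycles p q chi) (@coboundaries p q chi) (@coboundaries_submod_closed p q chi).

Definition dolbeault p q chi := quotient (@coboundaries p q chi).
HB.instance Definition _ p q chi := GRing.Lmodule.on (@dolbeault p q chi).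

Definition dolbeault_of p q (chi : line_bundles) : lmodType R[i] :=
  dolbeault p q (val chi).

End LineBundles.

(* alpha_i (x) v_{e^{x_i}} and beta_k (x) v_{e^{psi_k}}, resp. bar alpha_i and
   bar beta_k (x) v_{e^{bar psi_k}}: the line bundle is given by the character,
   and tensoring with v_alpha multiplies the form on G by alpha. *)
Definition char1 (i : 'I_(s + t)) (g : OTgroup) : R[i] :=
  match fintype.split i with
  | inl i => (expR (xc g 0 i))%:C%C
  | inr k => cexp (psi k (xc g))
  end.
Definition char2 (i : 'I_(s + t)) (g : OTgroup) : R[i] :=
  match fintype.split i with
  | inl i => 1
  | inr k => cexp ((psi k (xc g) : R[i])^*)
  end.
Definition W1_gen (i : 'I_(s + t)) : oneform := fun g v => char1 i g * theta i g v.
Definition W2_gen (i : 'I_(s + t)) : oneform :=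
  fun g v => char2 i g * theta_bar i g v.

(* The line bundle and the form on G of
   (w_{a_1} ^ ... ^ w_{a_p}) ^ (w'_{b_1} ^ ... ^ w'_{b_q}), for w = W1_gen and
   w' = W2_gen. *)
Definition wedge_char p q (a : incr p (s + t)) (b : incr q (s + t))
    (g : OTgroup) : R[i] :=
  (\prod_(i < p) char1 (tnth (val a) i) g) *
  (\prod_(j < q) char2 (tnth (val b) j) g).
Definition wedge_form p q (a : incr p (s + t)) (b : incr q (s + t)) :
    form (q + p) :=
  wedge (fun i => match fintype.split (cast_ord (addnC q p) i) with
                  | inl i => W1_gen (tnth (val a) i)
                  | inr j => W2_gen (tnth (val b) j)
                  end).

End OTSolvmanifold.

Arguments line_bundles {R s t} psi Gam _.
Arguments dolbeault_of {R s t} psi Gam p q chi.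

(* Main.v *)
(* In the global coframe [W1_gen], [W2_gen] of line-bundle-valued forms, an E_chi-valued
   (p, q)-form is an alternating family of functions F_c, each multiplied by a character
   kappa_c when translated by an element of Gamma, and dbar becomes a Koszul-type sum of
   the dual (0, 1)-derivatives Z.  Two homotopies, both contractions with frame vectors,
   make a closed family constant up to exact ones.

   Along N, the mean M over the torus N / Delta satisfies f = M f + Z (A f) for a single
   Z = d/d\bar z_k, where A divides the Fourier coefficients by the eigenvalues of Z.  These
   are values of one complex embedding on the dual lattice, hence bounded below by the
   reciprocal of a polynomial through the norm of the number field, and A f is smooth.

   Functions invariant under N depend on x alone.  For each generator l of Lambda, such an
   f with f (x + l) = kappa f (x) is its mean along l (when kappa = 1) or zero (otherwise)
   plus the derivative along l of a primitive with the same factor of automorphy.  What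
   remains of F_c is a constant, which vanishes unless kappa_c is trivial on Gamma.  So the
   cohomology has as a basis the wedge products of [W1_gen] and [W2_gen], each in the line
   bundle of its own character. *)
Require Import Defs.
From HB Require Import structures.
From mathcomp Require Import all_boot all_order all_algebra all_field.
From mathcomp Require Import complex.
From mathcomp Require Import all_classical all_reals all_analysis.
From mathcomp Require Import fingroup perm ring lra zify.
Set Implicit Arguments.
Unset Strict Implicit.
Unset Printing Implicit Defensive.
Import Order.TTheory GRing.Theory Num.Theory.
Import numFieldNormedType.Exports.
Local Open Scope classical_set_scope.
Local Open Scope ring_scope.

(** * Calculus of complex-valued functions *)

(** The twist by characters is what makes dbar simple. The only non-closed members of the frame are
    the bar alpha_i, and d (bar alpha_i) is proportional to alpha_i wedge bar alpha_i. Being of type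
    (1, 1), it does not reach dbar, so dbar only differentiates coefficients.

    Both homotopies rest on Cartan's formula: contracting a closed form with a frame vector z, then
    applying an operator that commutes with the derivations, gives a form whose dbar is the
    z-derivative of the original. Contraction multiplies the factor of automorphy by the inverse
    character of z, and the primitive A has to restore it. This is the obstacle: an element of Gamma
    over Lambda does not act mode by mode on the Fourier series, so the equivariance of A cannot be
    read off the series. It follows from uniqueness: no divisor vanishes at a nonzero frequency, so
    a function whose second Z-derivative is constant along N is constant along N. The same
    nonvanishing lets a single d/d\bar z_k handle the whole torus, which is where a complex place
    enters.

    On the base, the derivative along a generator of Lambda is a real combination of the (0,
    1)-derivatives, hence also accessible to contraction. *)

Section UnitInterval.
Context {R : realType}.
Implicit Types u v : R -> R.

Definition int01 u : R := Rintegral (@lebesgue_measure R) `[0, 1] u.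

Lemma int01_integrable u : continuous u ->
  (@lebesgue_measure R).-integrable `[0, 1] (EFin \o u).
Proof.
move=> cu; apply: continuous_compact_integrable; first exact: segment_compact.
exact: continuous_subspaceT.
Qed.

Lemma int01D u v : continuous u -> continuous v ->
  int01 (fun t => u t + v t) = int01 u + int01 v.
Proof. by move=> cu cv; apply: RintegralD => //; apply: int01_integrable. Qed.

Lemma int01B u v : continuous u -> continuous v ->
  int01 (fun t => u t - v t) = int01 u - int01 v.
Proof. by move=> cu cv; apply: RintegralB => //; apply: int01_integrable. Qed.

Lemma int01Zl a u : continuous u -> int01 (fun t => a * u t) = a * int01 u.
Proof. by move=> cu; apply: RintegralZl => //; apply: int01_integrable. Qed.

Lemma int01_cst a : int01 (fun=> a) = a.
Proof.
rewrite /int01 Rintegral_cst //= lebesgue_measure_itv /= lte_fin ltr01.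
by rewrite oppr0 adde0 /= mulr1.
Qed.

Lemma ler_int01 u v : continuous u -> continuous v ->
  (forall t, 0 <= t <= 1 -> u t <= v t) -> int01 u <= int01 v.
Proof.
move=> cu cv uv; apply: le_Rintegral => //; try exact: int01_integrable.

Qed.

Lemma eq_int01 u v : (forall t, 0 <= t <= 1 -> u t = v t) -> int01 u = int01 v.
Proof.
by move=> uv; apply: eq_Rintegral => t /set_mem; rewrite /= in_itv; exact: uv.
Qed.

Lemma normr_int01_le u c : continuous u ->
  (forall t, 0 <= t <= 1 -> `|u t| <= c) -> `|int01 u| <= c.
Proof.
move=> cu uc; apply: le_trans (le_normr_Rintegral _ (int01_integrable cu)) _ => //.
rewrite -[leRHS]int01_cst; apply: ler_int01 => //.
- by move=> t; apply: continuous_comp; [exact: cu | exact: norm_continuous].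
- by move=> t; exact: cst_continuous.
Qed.

Lemma normr_int01 u : continuous u -> `|int01 u| <= int01 (fun t => `|u t|).
Proof. by move=> cu; exact: le_normr_Rintegral (int01_integrable cu). Qed.

Lemma is_derive_continuous (U u : R -> R) :
  (forall t : R, is_derive t 1 U (u t)) -> continuous U.
Proof.
move=> dU t; apply: differentiable_continuous; apply/derivable1_diffP.
by have := dU t => -[].
Qed.

Lemma int01_derive (U u : R -> R) : continuous u ->
  (forall t : R, is_derive t 1 U (u t)) -> int01 u = U 1 - U 0.
Proof.
move=> cu dU; have cU := is_derive_continuous dU.
rewrite /int01 /Rintegral (@continuous_FTC2 _ u U) //.
- exact: continuous_subspaceT.
- split.
  + by move=> t _; have := dU t => -[].
  + by apply: cvg_at_right_filter; exact: cU.
  + by apply: cvg_at_left_filter; exact: cU.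
- by move=> t _; rewrite derive1E; have := dU t => -[].
Qed.

End UnitInterval.

Section DerivativeUnderIntegral.
Context {R : realType} {V : normedModType R}.
Implicit Types (g h : V -> R -> R) (x v : V).

Lemma is_derive_line (f : V -> R) x v (k : R) : derivable f (x + k *: v) v ->
  is_derive k 1 (fun k => f (x + k *: v)) ('D_v f (x + k *: v)).
Proof.
move=> df.
have E : (fun h : R => h^-1 *: (((fun k => f (x + k *: v)) \o shift k) (h *: 1)
    - f (x + k *: v))) =
  (fun h : R => h^-1 *: ((f \o shift (x + k *: v)) (h *: v) - f (x + k *: v))).
  apply/funext => h /=; congr (_ *: (f _ - _)).
  by rewrite [h *: 1]mulr1 scalerDl addrCA.
by split; rewrite /derivable /derive /= E.
Qed.

(** Tube lemma: boxes on which [g] stays within [e / 2] of its value at the centre cover the compact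
    segment, and finitely many of them cut out one neighbourhood of [x]. *)
Lemma uniform_continuity01 g x (e : R) :
  continuous (fun p : V * R => g p.1 p.2) -> 0 < e ->
  \forall y \near x, forall t, 0 <= t <= 1 -> `|g y t - g x t| <= e.
Proof.
move=> cg e0.
have /compact_near_coveringP/(_ V (nbhs x)
  (fun y t => `|g y t - g x t| <= e)) := @segment_compact R 0 1.
move=> /(_ (nbhs_filter x)) H.
have {H} : \forall y \near x, `[0, 1] `<=` (fun t => `|g y t - g x t| <= e).
  apply: H => t _.
  have e20 : 0 < e / 2 by rewrite divr_gt0.
  have := cg (x, t) => /cvgrPdist_lt /(_ _ e20) [[A B] /= [nA nB] AB].
  exists (B, A); first by split => //=.
  move=> [t' y] /= [Bt' Ay].
  have h1 := AB (y, t') (conj Ay Bt').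
  have h2 := AB (x, t') (conj (nbhs_singleton nA) Bt').
  rewrite /= in h1 h2.
  rewrite -(subrKA (g x t)) [e]splitr -opprB.
  by rewrite (le_trans (ler_normD _ _)) // lerD ?normrN // ltW.
by apply: filterS => y H t t01; apply: H; rewrite /= in_itv.
Qed.

Lemma section_continuous g x : continuous (fun p : V * R => g p.1 p.2) ->
  continuous (g x).
Proof.
move=> cg t; apply: (@continuous_comp _ _ _ (fun t => (x, t)) (fun p => g p.1 p.2)).
  exact: (cvg_pair (cvg_cst _) cvg_id).
exact: cg.
Qed.

Lemma continuous_int01 g : continuous (fun p : V * R => g p.1 p.2) ->
  continuous (fun x => int01 (g x)).
Proof.
move=> cg x; apply/cvgrPdist_le => e e0.
have H := uniform_continuity01 x cg e0.
near=> y.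
rewrite distrC -int01B; try exact: section_continuous.
apply: normr_int01_le.
  by move=> t; apply: continuousB; exact: section_continuous.
by near: y.
Unshelve. all: end_near. Qed.

Lemma is_derive_int01 g h x v :
  continuous (fun p : V * R => g p.1 p.2) ->
  continuous (fun p : V * R => h p.1 p.2) ->
  (forall x t, is_derive x v (g ^~ t) (h x t)) ->
  is_derive x v (fun x => int01 (g x)) (int01 (h x)).
Proof.
move=> cg ch dg.
have cgx y : continuous (g y) by exact: section_continuous.
have chx y : continuous (h y) by exact: section_continuous.
have lim : (fun k : R => k^-1 *: ((fun x => int01 (g x)) (k *: v + x) - int01 (g x)))
    @ 0^' --> int01 (h x).
  apply/cvgrPdist_le => e e0.
  have H := uniform_continuity01 x ch e0.
  have cl : (fun k : R => x + k *: v) @ (0 : R) --> x.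
    rewrite -[X in _ --> X]addr0 -[X in _ --> _ + X](scale0r v).
    by apply: cvgD; [exact: cvg_cst | apply: cvgZr_tmp].
  have /nbhs_ballP[d /= d0 Hd] := cl _ H.
  near=> k.
  have k0 : k != 0 by near: k; exact: nbhs_dnbhs_neq.
  have kd : `|k| < d.
    by near: k; apply: dnbhs0_lt.
  rewrite /= -int01B // [_ *: _](_ : _ = int01 (fun t => k^-1 * (g (k *: v + x) t - g x t))); last first.
    by rewrite int01Zl // => t; apply: continuousB; [exact: cgx | exact: cgx].
  have cd : continuous (fun t => k^-1 * (g (k *: v + x) t - g x t)).
    move=> t; apply: cvgM; first exact: cvg_cst.
    by apply: cvgB; exact: cgx.
  rewrite -int01B //; apply: normr_int01_le.
    by move=> t; apply: cvgB; [exact: chx | exact: cd].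
  (* By the mean value theorem the difference quotient of [g] at time [t] is a value of [h] at some
     [x + j *: v] with [|j| <= |k|], and such values are close to [h x t] uniformly in [t]. *)
  move=> t t01.
  have dl (j : R) : is_derive j 1 (fun j => g (x + j *: v) t) (h (x + j *: v) t).
    by have [? <-] := dg (x + j *: v) t; exact: is_derive_line.
  have cj := is_derive_continuous dl.
  have [j jk E] : exists2 j, `|j| <= `|k| & g (x + k *: v) t - g x t = h (x + j *: v) t * k.
    have [k1|k1] := leP 0 k.
      have [j] := @MVT_segment _ _ _ 0 k k1 (fun j _ => dl j) (continuous_subspaceT cj).
      rewrite in_itv /= scale0r addr0 subr0 => /andP[j0 jk] E.
      by exists j => //; rewrite !ger0_norm.
    have [j] := @MVT_segment _ _ _ k 0 (ltW k1) (fun j _ => dl j) (continuous_subspaceT cj).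
    rewrite in_itv /= scale0r addr0 sub0r mulrN => /andP[j0 jk] E.
    exists j; first by rewrite !ler0_norm ?lerN2 // ltW.
    by rewrite -opprB E opprK.
  rewrite [k *: v + x]addrC E mulrC mulfK // distrC.
  apply: (Hd j) => //; rewrite /ball /= sub0r normrN.
  exact: le_lt_trans kd.
by split; [apply/cvg_ex; eexists; exact: lim | exact: cvg_lim lim].
Unshelve. all: end_near. Qed.

End DerivativeUnderIntegral.

(** * Componentwise calculus on complex-valued functions *)

Section ComplexNorm.
Context {R : realType}.
Implicit Types z w : R[i].

Lemma Re_mul z w : complex.Re (z * w) =
  complex.Re z * complex.Re w - complex.Im z * complex.Im w.
Proof. by case: z w => [a b] [c d]. Qed.

Lemma Im_mul z w : complex.Im (z * w) =
  complex.Re z * complex.Im w + complex.Im z * complex.Re w.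
Proof. by case: z w => [a b] [c d]. Qed.

Lemma Re_add z w : complex.Re (z + w) = complex.Re z + complex.Re w.
Proof. by case: z w => [a b] [c d]. Qed.

Lemma Im_add z w : complex.Im (z + w) = complex.Im z + complex.Im w.
Proof. by case: z w => [a b] [c d]. Qed.

Lemma Re_opp z : complex.Re (- z) = - complex.Re z.
Proof. by case: z. Qed.

Lemma Im_opp z : complex.Im (- z) = - complex.Im z.
Proof. by case: z. Qed.

Lemma Re_conj z : complex.Re z^* = complex.Re z.
Proof. by case: z. Qed.

Lemma Im_conj z : complex.Im z^* = - complex.Im z.
Proof. by case: z. Qed.

Definition reimE := (Re_mul, Im_mul, Re_add, Im_add, Re_opp, Im_opp, Re_conj, Im_conj).

Lemma complex_ext z w : complex.Re z = complex.Re w ->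
  complex.Im z = complex.Im w -> z = w.
Proof. by case: z w => [a b] [c d] /= -> ->. Qed.

(** The [l^1] norm, equivalent to the modulus. It is [R]-valued and controls the two parts
    separately, which suits integrals and limits formed componentwise. *)
Definition cnorm z : R := `|complex.Re z| + `|complex.Im z|.

Lemma cnorm_ge0 z : 0 <= cnorm z.
Proof. exact: addr_ge0. Qed.

Lemma cnorm0 : cnorm 0 = 0.
Proof. by rewrite /cnorm /= normr0 addr0. Qed.

Lemma cnorm_le0 z : cnorm z <= 0 -> z = 0.
Proof.
move=> z0; have : cnorm z == 0 by rewrite eq_le z0 cnorm_ge0.
rewrite /cnorm paddr_eq0 // !normr_eq0 => /andP[/eqP a /eqP b].
exact: complex_ext.
Qed.

Lemma cnormN z : cnorm (- z) = cnorm z.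
Proof. by rewrite /cnorm !reimE !normrN. Qed.

Lemma cnormD z w : cnorm (z + w) <= cnorm z + cnorm w.
Proof. by rewrite /cnorm !reimE addrACA lerD ?ler_normD. Qed.

Lemma cnormM z w : cnorm (z * w) <= cnorm z * cnorm w.
Proof.
rewrite /cnorm !reimE mulrDl !mulrDr -!normrM.
have := ler_normB (complex.Re z * complex.Re w) (complex.Im z * complex.Im w).
have := ler_normD (complex.Re z * complex.Im w) (complex.Im z * complex.Re w).
by move=> h1 h2; apply: le_trans (lerD h2 h1) _; lra.
Qed.

Lemma cnorm_real (a : R) : cnorm a%:C%C = `|a|.
Proof. by rewrite /cnorm /= normr0 addr0. Qed.

Lemma cnorm_sum (I : Type) (r : seq I) (P : pred I) (F : I -> R[i]) :
  cnorm (\sum_(i <- r | P i) F i) <= \sum_(i <- r | P i) cnorm (F i).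
Proof.
elim/big_rec2: _ => [|i y z _ h]; first by rewrite cnorm0.
by apply: le_trans (cnormD _ _) _; rewrite lerD2l.
Qed.

Lemma cnorm_prod (I : Type) (r : seq I) (P : pred I) (F : I -> R[i]) :
  cnorm (\prod_(i <- r | P i) F i) <= \prod_(i <- r | P i) cnorm (F i).
Proof.
elim/big_rec2: _ => [|i y z _ h]; first by rewrite cnorm_real normr1.
apply: le_trans (cnormM _ _) _; apply: ler_wpM2l => //; exact: cnorm_ge0.
Qed.

Lemma Re_le_cnorm z : `|complex.Re z| <= cnorm z.
Proof. by rewrite lerDl. Qed.

Lemma Im_le_cnorm z : `|complex.Im z| <= cnorm z.
Proof. by rewrite lerDr. Qed.

End ComplexNorm.

Section ComplexCalculus.
Context {R : realType}.

Definition ccontinuous {T : topologicalType} (f : T -> R[i]) :=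
  continuous (fun x => complex.Re (f x)) /\ continuous (fun x => complex.Im (f x)).

Definition is_deriveC {V : normedModType R} (x v : V) (f : V -> R[i]) (d : R[i]) :=
  is_derive x v (fun x => complex.Re (f x)) (complex.Re d) /\
  is_derive x v (fun x => complex.Im (f x)) (complex.Im d).

Section Top.
Context {T : topologicalType}.
Implicit Types f g : T -> R[i].

Lemma ccontinuousD f g : ccontinuous f -> ccontinuous g ->
  ccontinuous (fun x => f x + g x).
Proof.
move=> [a b] [c d]; split=> x; under eq_fun do rewrite reimE;
  by apply: cvgD; [exact: a || exact: b | exact: c || exact: d].
Qed.

Lemma ccontinuousM f g : ccontinuous f -> ccontinuous g ->
  ccontinuous (fun x => f x * g x).
Proof.
move=> [a b] [c d]; split=> x; under eq_fun do rewrite reimE.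
  by apply: cvgB; apply: cvgM; [exact: a | exact: c | exact: b | exact: d].
by apply: cvgD; apply: cvgM; [exact: a | exact: d | exact: b | exact: c].
Qed.

Lemma ccontinuous_cst c : ccontinuous (fun _ : T => c).
Proof. by split=> x; exact: cvg_cst. Qed.

Lemma ccontinuous_norm f : ccontinuous f -> continuous (fun x => cnorm (f x)).
Proof.
move=> [a b] x; apply: cvgD; apply: (@cvg_norm _ R).
  exact: a.
exact: b.
Qed.

End Top.

Lemma ccontinuous_comp {S T : topologicalType} (h : S -> T) (f : T -> R[i]) :
  continuous h -> ccontinuous f -> ccontinuous (fun x => f (h x)).
Proof.
move=> ch [a b]; split=> x.
  apply: (@continuous_comp _ _ _ h (fun y => complex.Re (f y))); [exact: ch | exact: a].
apply: (@continuous_comp _ _ _ h (fun y => complex.Im (f y))); [exact: ch | exact: b].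
Qed.

Section Derive.
Context {V : normedModType R}.
Implicit Types (f g : V -> R[i]) (x v : V).

Lemma is_deriveC_cst c x v : is_deriveC x v (fun=> c) 0.
Proof. by split; exact: is_derive_cst. Qed.

Lemma is_deriveCD f g x v d e : is_deriveC x v f d -> is_deriveC x v g e ->
  is_deriveC x v (fun x => f x + g x) (d + e).
Proof.
move=> [a b] [a' b']; split; under eq_fun do rewrite reimE; rewrite reimE;
  exact: is_deriveD.
Qed.

Lemma is_deriveCM f g x v d e : is_deriveC x v f d -> is_deriveC x v g e ->
  is_deriveC x v (fun x => f x * g x) (d * g x + f x * e).
Proof.
move=> [a b] [a' b']; split; under eq_fun do rewrite reimE; rewrite !reimE.
  apply: (is_derive_eq (is_deriveB (is_deriveM a a') (is_deriveM b b'))).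
  by rewrite /GRing.scale /=; ring.
apply: (is_derive_eq (is_deriveD (is_deriveM a b') (is_deriveM b a'))).
by rewrite /GRing.scale /=; ring.
Qed.

Lemma is_deriveCZ c f x v d : is_deriveC x v f d ->
  is_deriveC x v (fun x => c * f x) (c * d).
Proof.
move=> df; have := is_deriveCM (is_deriveC_cst c x v) df.
by rewrite mul0r add0r.
Qed.

Lemma is_deriveC_eq f x v d e : is_deriveC x v f d -> d = e -> is_deriveC x v f e.
Proof. by move=> ? <-. Qed.

Lemma is_deriveC_val f x v d : is_deriveC x v f d -> deriveC f x v = d.
Proof.
by move=> [a b]; rewrite /deriveC !derive_val; apply: complex_ext.
Qed.

Lemma is_deriveC_line f x v (t : R) d : is_deriveC (x + t *: v) v f d ->
  is_deriveC t (1 : R) (fun t => f (x + t *: v)) d.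
Proof.
move=> [[a a'] [b b']]; split.
  by rewrite -a'; exact: (@is_derive_line _ _ (fun y => complex.Re (f y))).
by rewrite -b'; exact: (@is_derive_line _ _ (fun y => complex.Im (f y))).
Qed.

Lemma smooth_ccontinuous f : smooth f -> ccontinuous f.
Proof. by move=> sf; have := sf 0%N. Qed.

Lemma smooth_is_deriveC f x v : smooth f -> is_deriveC x v f (deriveC f x v).
Proof.
move=> sf; have [[a _] [b _]] := sf 1%N.
by split; exact: derivableP.
Qed.

Lemma smooth_deriveC f v : smooth f -> smooth (fun x => deriveC f x v).
Proof.
move=> sf n; have [[_ a] [_ b]] := sf n.+1.
by split; [exact: a | exact: b].
Qed.

(** Coinduction: a class of continuous functions stable under directional derivatives consists of
    smooth functions. Averages, Fourier multipliers and affine pullbacks form such classes. *)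
Lemma smooth_coind (P : (V -> R[i]) -> Prop) :
  (forall f, P f -> ccontinuous f /\
     forall v, exists2 f', P f' & forall x, is_deriveC x v f (f' x)) ->
  forall f, P f -> smooth f.
Proof.
move=> H f Pf n; elim: n f Pf => [|n IH] f Pf; first by have [] := H f Pf.
have [_ D] := H f Pf.
have DR v : exists2 f', P f' &
    (fun x => 'D_v (fun y => complex.Re (f y)) x) = (fun x => complex.Re (f' x)) /\
    (fun x => 'D_v (fun y => complex.Im (f y)) x) = (fun x => complex.Im (f' x)).
  have [f' Pf' df] := D v; exists f' => //.
  by split; apply/funext => x; have [[_ a] [_ b]] := df x.
split; split=> [x v|v].
- by have [f' _ df] := D v; have [[]] := df x.
- by have [f' Pf' [-> _]] := DR v; have [] := IH f' Pf'.
- by have [f' _ df] := D v; have [_ []] := df x.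
- by have [f' Pf' [_ ->]] := DR v; have [] := IH f' Pf'.
Qed.

(** Derivatives of products are sums of products, so stability under differentiation needs the whole
    algebra. [SmoothExp] admits exponentials of linear functions through their differential
    equation. *)
Inductive smooth_algebra : (V -> R[i]) -> Prop :=
| SmoothBase f : smooth f -> smooth_algebra f
| SmoothAdd f g : smooth_algebra f -> smooth_algebra g ->
    smooth_algebra (fun x => f x + g x)
| SmoothMul f g : smooth_algebra f -> smooth_algebra g ->
    smooth_algebra (fun x => f x * g x)
| SmoothExp f (l : V -> R[i]) : ccontinuous f ->
    (forall x v, is_deriveC x v f (l v * f x)) -> smooth_algebra f.

Lemma smooth_cst (c : R[i]) : smooth (fun _ : V => c).
Proof.
apply: (@smooth_coind (fun f => exists c, f = fun=> c)); last by exists c.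
move=> _ [d ->]; split=> [|v]; first exact: ccontinuous_cst.
by exists (fun=> 0) => [|x]; [exists 0 | exact: is_deriveC_cst].
Qed.

Lemma smooth_algebra_smooth f : smooth_algebra f -> smooth f.
Proof.
apply: smooth_coind => {}f; elim=> {f} [f sf|f g _ [cf df] _ [cg dg]|
  f g Pf [cf df] Pg [cg dg]|f l cf df].
- split=> [|v]; first exact: smooth_ccontinuous.
  exists (fun x => deriveC f x v) => [|x]; last exact: smooth_is_deriveC.
  by apply: SmoothBase; exact: smooth_deriveC.
- split=> [|v]; first exact: ccontinuousD.
  have [f' Pf' df'] := df v; have [g' Pg' dg'] := dg v.
  exists (fun x => f' x + g' x) => [|x]; first exact: SmoothAdd.
  exact: is_deriveCD.
- split=> [|v]; first exact: ccontinuousM.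
  have [f' Pf' df'] := df v; have [g' Pg' dg'] := dg v.
  exists (fun x => f' x * g x + f x * g' x) => [|x]; last exact: is_deriveCM.
  by apply: SmoothAdd; apply: SmoothMul.
- split=> // v; exists (fun x => l v * f x) => //.
  apply: SmoothMul; last exact: SmoothExp cf df.
  by apply: SmoothBase; exact: smooth_cst.
Qed.

Lemma smoothD f g : smooth f -> smooth g -> smooth (fun x => f x + g x).
Proof.
by move=> sf sg; apply/smooth_algebra_smooth/SmoothAdd; exact: SmoothBase.
Qed.

Lemma smoothM f g : smooth f -> smooth g -> smooth (fun x => f x * g x).
Proof.
by move=> sf sg; apply/smooth_algebra_smooth/SmoothMul; exact: SmoothBase.
Qed.

Lemma smoothZ c f : smooth f -> smooth (fun x => c * f x).
Proof. by apply: smoothM; exact: smooth_cst. Qed.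

Lemma smooth_sum (I : Type) (r : seq I) (P : pred I) (F : I -> V -> R[i]) :
  (forall i, P i -> smooth (F i)) -> smooth (fun x => \sum_(i <- r | P i) F i x).
Proof.
move=> sF; elim: r => [|i r IH].
  by under eq_fun do rewrite big_nil; exact: smooth_cst.
under eq_fun do rewrite big_cons; case: (boolP (P i)) => // Pi.
by apply: smoothD => //; exact: sF.
Qed.

Lemma smooth_prod (I : Type) (r : seq I) (P : pred I) (F : I -> V -> R[i]) :
  (forall i, P i -> smooth (F i)) -> smooth (fun x => \prod_(i <- r | P i) F i x).
Proof.
move=> sF; elim: r => [|i r IH].
  by under eq_fun do rewrite big_nil; exact: smooth_cst.
under eq_fun do rewrite big_cons; case: (boolP (P i)) => // Pi.
by apply: smoothM => //; exact: sF.
Qed.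

Lemma deriveCD f g x v : smooth f -> smooth g ->
  deriveC (fun x => f x + g x) x v = deriveC f x v + deriveC g x v.
Proof.
by move=> sf sg; apply/is_deriveC_val/is_deriveCD; exact: smooth_is_deriveC.
Qed.

Lemma deriveCM f g x v : smooth f -> smooth g ->
  deriveC (fun x => f x * g x) x v = deriveC f x v * g x + f x * deriveC g x v.
Proof.
by move=> sf sg; apply/is_deriveC_val/is_deriveCM; exact: smooth_is_deriveC.
Qed.

Lemma deriveCZ c f x v : smooth f ->
  deriveC (fun x => c * f x) x v = c * deriveC f x v.
Proof. by move=> sf; apply/is_deriveC_val/is_deriveCZ/smooth_is_deriveC. Qed.

Lemma deriveC_cst c x v : deriveC (fun=> c : R[i]) x v = 0.
Proof. exact/is_deriveC_val/is_deriveC_cst. Qed.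

Lemma deriveC_sum (I : Type) (r : seq I) (P : pred I) (F : I -> V -> R[i]) x v :
  (forall i, P i -> smooth (F i)) ->
  deriveC (fun x => \sum_(i <- r | P i) F i x) x v =
  \sum_(i <- r | P i) deriveC (F i) x v.
Proof.
move=> sF; elim: r => [|i r IH].
  by rewrite big_nil; under eq_fun do rewrite big_nil; rewrite deriveC_cst.
rewrite big_cons -IH; under eq_fun do rewrite big_cons; case: (boolP (P i)) => // Pi.
by rewrite deriveCD //; [exact: sF | exact: smooth_sum].
Qed.

End Derive.

Lemma deriveC_line_cst {V : normedModType R} (f : V -> R[i]) (x v : V) :
  (forall t : R, is_deriveC (x + t *: v) v f 0) -> f (x + v) = f x.
Proof.
move=> df; have dl t := is_deriveC_line (df t).
have a : forall t : R, is_derive t 1 (fun t => complex.Re (f (x + t *: v))) 0.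
  by move=> t; have [] := dl t.
have b : forall t : R, is_derive t 1 (fun t => complex.Im (f (x + t *: v))) 0.
  by move=> t; have [] := dl t.
have := is_derive_0_is_cst 1 0 a; have := is_derive_0_is_cst 1 0 b.
by rewrite !scale1r !scale0r !addr0 => h1 h2; apply: complex_ext.
Qed.

End ComplexCalculus.

(** * Averages and Fourier series along a lattice *)

Section ComplexIntegral.
Context {R : realType}.
Implicit Types u v : R -> R[i].

Definition cint01 u : R[i] :=
  (int01 (fun t => complex.Re (u t)) +i* int01 (fun t => complex.Im (u t)))%C.

Lemma eq_cint01 u v : (forall t, 0 <= t <= 1 -> u t = v t) -> cint01 u = cint01 v.
Proof.
by move=> uv; apply: complex_ext => /=; apply: eq_int01 => t t01; rewrite uv.
Qed.

Lemma cint01D u v : ccontinuous u -> ccontinuous v ->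
  cint01 (fun t => u t + v t) = cint01 u + cint01 v.
Proof.
move=> [a b] [c d]; apply: complex_ext; rewrite reimE /= -int01D //;
  by apply: eq_int01 => t _; rewrite reimE.
Qed.

Lemma cint01Zl c u : ccontinuous u -> cint01 (fun t => c * u t) = c * cint01 u.
Proof.
move=> [a b]; have aZ k : continuous (fun t => k * complex.Re (u t)).
  by move=> t; apply: cvgM; [exact: cvg_cst | exact: a].
have bZ k : continuous (fun t => k * complex.Im (u t)).
  by move=> t; apply: cvgM; [exact: cvg_cst | exact: b].
apply: complex_ext; rewrite reimE /= -!int01Zl // -?int01B -?int01D //;
  by apply: eq_int01 => t _; rewrite reimE.
Qed.

Lemma cint01_cst c : cint01 (fun=> c) = c.
Proof. by apply: complex_ext; rewrite /= int01_cst. Qed.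

Lemma cint01_derive (U u : R -> R[i]) : ccontinuous u ->
  (forall t : R, is_deriveC t (1 : R) U (u t)) -> cint01 u = U 1 - U 0.
Proof.
move=> [a b] dU; apply: complex_ext; rewrite !reimE /=.
  apply: (@int01_derive _ (fun t => complex.Re (U t))) => // t.
  by have [] := dU t.
apply: (@int01_derive _ (fun t => complex.Im (U t))) => // t.
by have [] := dU t.
Qed.

(** The factor 2 comes from bounding each of the two parts by [int01 g]. *)
Lemma cnorm_cint01 u (g : R -> R) : ccontinuous u -> continuous g ->
  (forall t, cnorm (u t) <= g t) -> cnorm (cint01 u) <= 2 * int01 g.
Proof.
move=> [a b] cg ug; rewrite /cnorm /= mulr_natl mulr2n.
apply: lerD; apply: le_trans (normr_int01 _) _ => //; apply: ler_int01 => //.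
- by move=> t; apply: (@cvg_norm _ R); exact: a.
- by move=> t _; apply: le_trans (ug t); exact: Re_le_cnorm.
- by move=> t; apply: (@cvg_norm _ R); exact: b.
- by move=> t _; apply: le_trans (ug t); exact: Im_le_cnorm.
Qed.

Lemma is_deriveC0_cst u : (forall t : R, is_deriveC t (1 : R) u 0) ->
  forall t s, u t = u s.
Proof.
move=> du t s.
have a : forall t : R, is_derive t 1 (fun t => complex.Re (u t)) 0.
  by move=> r; have [] := du r.
have b : forall t : R, is_derive t 1 (fun t => complex.Im (u t)) 0.
  by move=> r; have [] := du r.
by apply: complex_ext; [exact: is_derive_0_is_cst a | exact: is_derive_0_is_cst b].
Qed.

End ComplexIntegral.

Section Average.
Context {R : realType} {V : normedModType R}.
Implicit Types (w : R -> R[i]) (f g : V -> R[i]) (x b v : V).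

(** One construction for three purposes: Fourier projections ([w = fweight m]), means along a vector
    ([w = 1]) and primitives along it ([w t = t]). *)
Definition avg w b f x : R[i] := cint01 (fun t => w t * f (x + t *: b)).

Lemma continuous_shift_scale b : continuous (fun p : V * R => p.1 + p.2 *: b).
Proof.
move=> p; apply: cvgD; first exact: cvg_fst.
by apply: cvgZr_tmp; exact: cvg_snd.
Qed.

Lemma continuous_line x b : continuous (fun t : R => x + t *: b).
Proof.
move=> t; apply: cvgD; first exact: cvg_cst.
by apply: cvgZr_tmp; exact: cvg_id.
Qed.

Lemma ccontinuous_avg_param w b f : ccontinuous w -> ccontinuous f ->
  ccontinuous (fun p : V * R => w p.2 * f (p.1 + p.2 *: b)).
Proof.
move=> cw cf; apply: ccontinuousM.
  by apply: (ccontinuous_comp (h := snd)) => // p; exact: cvg_snd.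
exact: (ccontinuous_comp (@continuous_shift_scale b)).
Qed.

Lemma ccontinuous_avg_integrand w b f x : ccontinuous w -> ccontinuous f ->
  ccontinuous (fun t => w t * f (x + t *: b)).
Proof.
move=> cw cf; apply: ccontinuousM => //.
exact: (ccontinuous_comp (@continuous_line x b)).
Qed.

Lemma ccontinuous_avg w b f : ccontinuous w -> ccontinuous f ->
  ccontinuous (avg w b f).
Proof.
move=> cw cf; have [c d] := ccontinuous_avg_param b cw cf.
split; rewrite /avg /cint01 /=.
  exact: (@continuous_int01 _ _ (fun x t => complex.Re (w t * f (x + t *: b)))).
exact: (@continuous_int01 _ _ (fun x t => complex.Im (w t * f (x + t *: b)))).
Qed.

Lemma is_derive_shift (h : V -> R) x c v d : is_derive (x + c) v h d ->
  is_derive x v (fun x => h (x + c)) d.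
Proof.
have E : (fun k : R => k^-1 *:
   (((fun x => h (x + c)) \o shift x) (k *: v) - h (x + c))) =
  (fun k : R => k^-1 *: ((h \o shift (x + c)) (k *: v) - h (x + c))).
  by apply/funext => k /=; rewrite addrA.
by move=> [a1 a2]; split; rewrite /derivable /derive /= E.
Qed.

Lemma is_deriveC_shift f x c v d : is_deriveC (x + c) v f d ->
  is_deriveC x v (fun x => f (x + c)) d.
Proof.
by move=> [a b]; split; [apply: (is_derive_shift a) | apply: (is_derive_shift b)].
Qed.

Lemma is_deriveC_avg w b f f' x v : ccontinuous w -> ccontinuous f ->
  ccontinuous f' -> (forall x, is_deriveC x v f (f' x)) ->
  is_deriveC x v (avg w b f) (avg w b f' x).
Proof.
move=> cw cf cf' df; have [c d] := ccontinuous_avg_param b cw cf.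
have [c' d'] := ccontinuous_avg_param b cw cf'.
have D y t : is_deriveC y v (fun x => w t * f (x + t *: b)) (w t * f' (y + t *: b)).
  exact/is_deriveCZ/is_deriveC_shift.
split; rewrite /avg /cint01 /=.
  apply: (@is_derive_int01 _ _ (fun x t => complex.Re (w t * f (x + t *: b)))
    (fun x t => complex.Re (w t * f' (x + t *: b)))) => // y t.
  by have [] := D y t.
apply: (@is_derive_int01 _ _ (fun x t => complex.Im (w t * f (x + t *: b)))
  (fun x t => complex.Im (w t * f' (x + t *: b)))) => // y t.
by have [] := D y t.
Qed.

Lemma smooth_avg w b f : ccontinuous w -> smooth f -> smooth (avg w b f).
Proof.
move=> cw sf; apply: (@smooth_coind _ _ (fun g => exists2 f, smooth f & g = avg w b f)).
  move=> _ [g sg ->]; split; first exact/ccontinuous_avg/smooth_ccontinuous.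
  move=> v; have sg' := smooth_deriveC v sg.
  exists (avg w b (fun x => deriveC g x v)) => [|x]; first by eexists; [exact: sg' |].
  by apply: is_deriveC_avg => // [||y]; [exact: smooth_ccontinuous..|exact: smooth_is_deriveC].
by exists f.
Qed.

Lemma deriveC_avg w b f x v : ccontinuous w -> smooth f ->
  deriveC (avg w b f) x v = avg w b (fun x => deriveC f x v) x.
Proof.
move=> cw sf; apply/is_deriveC_val/is_deriveC_avg => // [||y].
- exact: smooth_ccontinuous.
- exact/smooth_ccontinuous/smooth_deriveC.
- exact: smooth_is_deriveC.
Qed.

(** Integration by parts on the segment from [x] to [x + b]. The boundary terms compare [f (x + b)]
    with [f x], which is where periodicity or a factor of automorphy enters. *)
Lemma avg_parts w w' b f x : ccontinuous w -> ccontinuous w' ->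
  (forall t : R, is_deriveC t (1 : R) w (w' t)) -> smooth f ->
  deriveC (avg w b f) x b = w 1 * f (x + b) - w 0 * f x - avg w' b f x.
Proof.
move=> cw cw' dw sf; rewrite deriveC_avg //; apply/eqP; rewrite eq_sym subr_eq addrC.
have cf := smooth_ccontinuous sf.
have cf' := smooth_ccontinuous (smooth_deriveC b sf).
have I1 : ccontinuous (fun t : R => w t * deriveC f (x + t *: b) b).
  exact: (ccontinuous_avg_integrand b x cw cf').
rewrite /avg -cint01D //; last exact: ccontinuous_avg_integrand.
rewrite (@cint01_derive _ (fun t => w t * f (x + t *: b))).
- by rewrite scale1r scale0r addr0 addrC.
- by apply: ccontinuousD => //; exact: ccontinuous_avg_integrand.
- move=> t; rewrite addrC; apply: is_deriveCM; first exact: dw.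
  by apply: is_deriveC_line; exact: smooth_is_deriveC.
Qed.

Lemma avgD w b f g x : ccontinuous w -> ccontinuous f -> ccontinuous g ->
  avg w b (fun x => f x + g x) x = avg w b f x + avg w b g x.
Proof.
move=> cw cf cg; rewrite /avg -cint01D; try exact: ccontinuous_avg_integrand.
by apply: eq_cint01 => t _; rewrite mulrDr.
Qed.

Lemma avgZ w b c f x : ccontinuous w -> ccontinuous f ->
  avg w b (fun x => c * f x) x = c * avg w b f x.
Proof.
move=> cw cf; rewrite /avg -cint01Zl; last exact: ccontinuous_avg_integrand.
by apply: eq_cint01 => t _; rewrite mulrCA.
Qed.

Lemma avgM w b c f x : ccontinuous w -> ccontinuous f ->
  (forall x (t : R), c (x + t *: b) = c x) ->
  avg w b (fun x => c x * f x) x = c x * avg w b f x.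
Proof.
move=> cw cf cb; rewrite /avg -cint01Zl; last exact: ccontinuous_avg_integrand.
by apply: eq_cint01 => t _; rewrite cb mulrCA.
Qed.

Lemma avg0 w b x : avg w b (fun=> 0) x = 0.
Proof.
by rewrite /avg -[RHS]cint01_cst; apply: eq_cint01 => t _; rewrite mulr0.
Qed.

Lemma avg_shift w b f x c k : ccontinuous w -> ccontinuous f ->
  (forall x, f (x + c) = k * f x) -> avg w b f (x + c) = k * avg w b f x.
Proof.
move=> cw cf fc; rewrite /avg -cint01Zl; last exact: ccontinuous_avg_integrand.
by apply: eq_cint01 => t _; rewrite addrAC fc mulrCA.
Qed.

Lemma cnorm_avg w b f (g : V -> R) x : ccontinuous w -> ccontinuous f ->
  continuous g -> (forall t, cnorm (w t) <= 2) -> (forall x, cnorm (f x) <= g x) ->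
  cnorm (avg w b f x) <= 4 * int01 (fun t => g (x + t *: b)).
Proof.
move=> cw cf cg w2 fg; have cl : continuous (fun t : R => g (x + t *: b)).
  by move=> t; apply: (@continuous_comp _ _ _ (fun t : R => x + t *: b) g);
    [exact: continuous_line | exact: cg].
(* One 2 bounds the weight, the other is the constant of [cnorm_cint01]. *)
rewrite (_ : 4 = 2 * 2); last by ring.
rewrite -mulrA -int01Zl //; apply: cnorm_cint01.
- exact: ccontinuous_avg_integrand.
- by move=> t; apply: cvgM; [exact: cvg_cst | exact: cl].
move=> t; apply: le_trans (cnormM _ _) _.
by apply: ler_pM => //; exact: cnorm_ge0.
Qed.

Lemma continuous_abs_avg b (g : V -> R) : continuous g ->
  continuous (fun x => 4 * int01 (fun t => g (x + t *: b))).
Proof.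
move=> cg x; apply: cvgM; first exact: cvg_cst.
apply: (@continuous_int01 _ _ (fun x t => g (x + t *: b))) => p.
by apply: (@continuous_comp _ _ _ (fun p : V * R => p.1 + p.2 *: b) g);
  [exact: continuous_shift_scale | exact: cg].
Qed.

End Average.

(** * Fourier projections in one direction *)

Section FourierWeight.
Context {R : realType}.

Definition freq (m : int) : R[i] := (0 +i* (2 * pi * m%:~R))%C.

(** The character e^(-2 pi i m t); accordingly [freq m] is 2 pi i m. *)
Definition fweight (m : int) (t : R) : R[i] :=
  (cos (2 * pi * m%:~R * t) +i* (- sin (2 * pi * m%:~R * t)))%C.

Lemma is_deriveC_fweight m (t : R) :
  is_deriveC t (1 : R) (fweight m) (- freq m * fweight m t).
Proof.
have dl : is_derive t (1 : R) (fun t : R => 2 * pi * m%:~R * t) (2 * pi * m%:~R).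
  by apply: is_derive_eq; rewrite /GRing.scale /=; ring.
split; rewrite !reimE /=.
  apply: (is_derive_eq (is_derive1_comp (is_derive_cos _) dl)).
  by rewrite /GRing.scale /=; ring.
apply: (is_derive_eq (is_deriveN (is_derive1_comp (is_derive_sin _) dl))).
by rewrite /GRing.scale /=; ring.
Qed.

Lemma is_deriveC_ccontinuous (f f' : R -> R[i]) :
  (forall t : R, is_deriveC t (1 : R) f (f' t)) -> ccontinuous f.
Proof.
move=> df; split.
  by apply: (@is_derive_continuous _ _ (fun t => complex.Re (f' t))) => t;
    have [] := df t.
by apply: (@is_derive_continuous _ _ (fun t => complex.Im (f' t))) => t;
  have [] := df t.
Qed.

Lemma ccontinuous_fweight m : ccontinuous (fweight m).
Proof. exact/is_deriveC_ccontinuous/is_deriveC_fweight. Qed.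

Lemma fweight0 m : fweight m 0 = 1.
Proof. by rewrite /fweight mulr0 cos0 sin0 oppr0. Qed.

Lemma cos_sin_2pi_int (m : int) :
  cos (2 * pi * m%:~R) = 1 :> R /\ sin (2 * pi * m%:~R) = 0 :> R.
Proof.
have H n : cos (2 * pi * n%:R) = 1 :> R /\ sin (2 * pi * n%:R) = 0 :> R.
  elim: n => [|n [c s]]; first by rewrite mulr0 cos0 sin0.
  have -> : 2 * pi * n.+1%:R = 2 * pi * n%:R + pi *+ 2 :> R.
    by rewrite -[n.+1%:R]natr1 mulr2n; ring.
  by rewrite cosD (sinD (2 * pi * n%:R)) cos2pi sin2pi c s !(mulr0, mul0r, mulr1, subr0, addr0).
case: m => n; first exact: H.
rewrite NegzE mulrNz mulrN cosN sinN; have [-> ->] := H n.+1.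
by rewrite oppr0.
Qed.

Lemma fweight1 m : fweight m 1 = 1.
Proof.
by rewrite /fweight mulr1; have [-> ->] := cos_sin_2pi_int m; rewrite oppr0.
Qed.

Lemma cnorm_fweight m t : cnorm (fweight m t) <= 2.
Proof.
rewrite /cnorm /= normrN; set a := _ * t.
by have := cos_max a; have := sin_max a; lra.
Qed.

Lemma freq_inj : injective freq.
Proof.
move=> m m' [] /(mulfI _) H; have {}H := H _; apply/eqP.
rewrite -(eqr_int R) H //.
by rewrite mulf_neq0 // gt_eqF // pi_gt0.
Qed.

Lemma freq0 : freq 0 = 0.
Proof. by rewrite /freq mulr0. Qed.

Context {V : normedModType R}.
Implicit Types (f : V -> R[i]) (b : V).

(** Not a number but a function of the base point: for [b]-periodic [f] it is the component of [f]
    that varies along [b] as e^(2 pi i m t). Projections of this kind need no coordinates and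
    commute with derivatives and translations. *)
Definition fcoef m b f := avg (fweight m) b f.

Lemma deriveC_fcoef m b f x : smooth f -> (forall x, f (x + b) = f x) ->
  deriveC (fcoef m b f) x b = freq m * fcoef m b f x.
Proof.
move=> sf fb; have cw := ccontinuous_fweight m.
have cw' : ccontinuous (fun t => - freq m * fweight m t).
  by apply: ccontinuousM => //; exact: ccontinuous_cst.
rewrite /fcoef (@avg_parts _ _ _ (fun t => - freq m * fweight m t)) //.
  rewrite fweight0 fweight1 fb subrr sub0r /avg.
  rewrite -(cint01Zl (freq m)); last exact/ccontinuous_avg_integrand/smooth_ccontinuous.
  rewrite -[RHS]opprK -mulN1r -cint01Zl.
    by rewrite opprK; apply: eq_cint01 => t _; rewrite mulN1r !mulNr opprK mulrA.
  exact: (ccontinuous_avg_integrand b x cw' (smooth_ccontinuous sf)).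
exact: is_deriveC_fweight.
Qed.

(** The weight cancels the oscillation of [f] along [b], so the integrand is constant. *)
Lemma fcoef_eigen m b f x : smooth f ->
  (forall x, deriveC f x b = freq m * f x) -> fcoef m b f x = f x.
Proof.
move=> sf fb; rewrite /fcoef /avg -[RHS]cint01_cst; apply: eq_cint01 => t _.
have D (s : R) : is_deriveC s (1 : R) (fun t => fweight m t * f (x + t *: b)) 0.
  apply: is_deriveC_eq.
    apply: is_deriveCM; first exact: is_deriveC_fweight.
    by apply: is_deriveC_line; exact: smooth_is_deriveC.
  by rewrite fb; ring.
by rewrite (is_deriveC0_cst D t 0) fweight0 mul1r scale0r addr0.
Qed.

End FourierWeight.

Section FourierUniqueness.
Context {R : realType}.

(* The powers of [sin2] are trigonometric polynomials concentrating at [1/2]. *)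
Definition sin2 (t : R) : R := (1 - cos (2 * pi * t)) / 2.
(** The two functions are the squares of sin (pi t) and cos (pi t), in double-angle form so that
    they are visibly of frequency at most 1. On the unit interval [cos2] vanishes only at [1 / 2]
    and measures the distance to it. *)
Definition cos2 (t : R) : R := (1 + cos (2 * pi * t)) / 2.

Lemma sin2_ge0 t : 0 <= sin2 t.
Proof. by rewrite /sin2 divr_ge0 // subr_ge0; have := cos_max (2 * pi * t); lra. Qed.

Lemma cos2_ge0 t : 0 <= cos2 t.
Proof. by rewrite /cos2 divr_ge0 //; have := cos_geN1 (2 * pi * t); lra. Qed.

Lemma cos2_eq0 t : 0 <= t <= 1 -> cos2 t = 0 -> t = 1 / 2.
Proof.
move=> /andP[t0 t1] c0; have pi0 := @pi_gt0 R.
have {c0} c1 : cos (2 * pi * t) = cos pi by rewrite cospi; rewrite /cos2 in c0; lra.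
have H (s : R) : 0 <= s <= 1 / 2 -> cos (2 * pi * s) = cos pi -> s = 1 / 2.
  move=> /andP[s0 s1] cs.
  have : 2 * pi * s = pi.
    by apply: cos_inj => //; rewrite in_itv /=; apply/andP; split; nra.
  by move=> E; apply: (mulfI (lt0r_neq0 pi0)); lra.
have [tl|tg] := leP t (1 / 2); first by apply: H => //; rewrite t0.
have : 1 - t = 1 / 2; last by lra.
apply: H; first by apply/andP; split; lra.
have -> : 2 * pi * (1 - t) = - (2 * pi * t) + pi *+ 2 by rewrite mulr2n; ring.
by rewrite (cosD (- (2 * pi * t))) cosN cos2pi sin2pi mulr0 mulr1 subr0.
Qed.

Lemma is_derive_2pi (t : R) : is_derive t (1 : R) (fun t : R => 2 * pi * t) (2 * pi).
Proof. by apply: is_derive_eq; rewrite /GRing.scale /=; ring. Qed.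

Lemma is_derive_sin2 (t : R) : is_derive t (1 : R) sin2 (pi * sin (2 * pi * t)).
Proof.
have H : is_derive t (1 : R) (fun t => 2^-1 * (1 - cos (2 * pi * t)))
    (pi * sin (2 * pi * t)).
  apply: (is_derive_eq (is_deriveZ 2^-1 (is_deriveB (is_derive_cst _ _ _)
    (is_derive1_comp (is_derive_cos _) (is_derive_2pi t))))).
  by rewrite /GRing.scale /=; field.
by rewrite (_ : sin2 = fun t => 2^-1 * (1 - cos (2 * pi * t))) //;
  apply/funext => s; rewrite /sin2 mulrC.
Qed.

Lemma continuous_sin2 : continuous sin2.
Proof. exact: is_derive_continuous is_derive_sin2. Qed.

Lemma continuous_cos2 : continuous cos2.
Proof.
rewrite (_ : cos2 = fun t => 1 - sin2 t); last first.
  by apply/funext => t; rewrite /cos2 /sin2; lra.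
by move=> t; apply: cvgB; [exact: cvg_cst | exact: continuous_sin2].
Qed.

Lemma continuous_sin2X k : continuous (fun t => sin2 t ^+ k).
Proof.
elim: k => [|k IH]; first by move=> t; under eq_fun do rewrite expr0; exact: cvg_cst.
move=> t; under eq_fun do rewrite exprS.
by apply: cvgM; [exact: continuous_sin2 | exact: IH].
Qed.

Definition sin2_mass k : R := int01 (fun t => sin2 t ^+ k).

Lemma is_derive_sin2X k (t : R) : is_derive t (1 : R) (fun t => sin2 t ^+ k)
  (k%:R * pi * sin (2 * pi * t) * sin2 t ^+ k.-1).
Proof.
elim: k => [|k IH].
  rewrite !mul0r; under eq_fun do rewrite expr0; exact: is_derive_cst.
have -> : (fun t => sin2 t ^+ k.+1) = (fun t => sin2 t * sin2 t ^+ k).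
  by apply/funext => s; rewrite exprS.
apply: (is_derive_eq (is_deriveM (is_derive_sin2 t) IH)).
rewrite /GRing.scale /= -[k.+1%:R]natr1; case: k {IH} => [|k] /=.
  by rewrite !expr0; ring.
by rewrite exprS; ring.
Qed.

(** Wallis-type recursion: sin (2 pi t) [sin2 t ^+ k] takes equal values at 0 and 1, and its
    derivative is a combination of [sin2 ^+ k * cos2] and [sin2 ^+ k.+1]. The decay in [k] is the
    concentration at [1 / 2]. *)
Lemma sin2_cos2_mass k :
  int01 (fun t => sin2 t ^+ k * cos2 t) = sin2_mass k.+1 / (2 * k%:R + 1).
Proof.
have cs := @continuous_sin2X k; have cs' := @continuous_sin2X k.+1.
have csc : continuous (fun t => sin2 t ^+ k * cos2 t).
  by move=> t; apply: cvgM; [exact: cs | exact: continuous_cos2].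
(* The coefficient of [sin2 ^+ k * cos2] in that derivative: 2 pi from the cosine, 4 pi k from the
   power, as sin (2 pi t)^2 is [4 * (sin2 t * cos2 t)]. *)
pose a : R := 2 * pi + 4 * pi * k%:R.
have ca : continuous (fun t => a * (sin2 t ^+ k * cos2 t)).
  by move=> t; apply: cvgM; [exact: cvg_cst | exact: csc].
have cb : continuous (fun t => - (2 * pi) * sin2 t ^+ k.+1).
  by move=> t; apply: cvgM; [exact: cvg_cst | exact: cs'].
have := @int01_derive _ (fun t => sin (2 * pi * t) * sin2 t ^+ k)
  (fun t => a * (sin2 t ^+ k * cos2 t) + - (2 * pi) * sin2 t ^+ k.+1).
rewrite int01D // !int01Zl // => IP.
have {IP} : a * int01 (fun t => sin2 t ^+ k * cos2 t) +
    - (2 * pi) * int01 (fun t => sin2 t ^+ k.+1) =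
    sin (2 * pi * 1) * sin2 1 ^+ k - sin (2 * pi * 0) * sin2 0 ^+ k.
  apply: IP; first by move=> t; apply: cvgD; [exact: ca | exact: cb].
  move=> t.
  apply: (is_derive_eq (is_deriveM (is_derive1_comp (is_derive_sin _)
    (is_derive_2pi t)) (is_derive_sin2X k t))).
  have E : sin (2 * pi * t) * sin (2 * pi * t) = 4 * (sin2 t * cos2 t).
    by have := cos2Dsin2 (2 * pi * t); rewrite /sin2 /cos2 !expr2; nra.
  have E1 : cos (2 * pi * t) = cos2 t - sin2 t by rewrite /sin2 /cos2; lra.
  rewrite /GRing.scale /= E1 /a exprS; case: k {cs cs' csc a ca cb} => [|k] /=.
    by rewrite expr0; ring.
  transitivity (k.+1%:R * pi * sin2 t ^+ k * (sin (2 * pi * t) * sin (2 * pi * t)) +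
    sin2 t ^+ k.+1 * (2 * pi * (cos2 t - sin2 t))); first by ring.
  by rewrite E exprS; ring.
have [_ s0] := @cos_sin_2pi_int R 1; rewrite mulr1 in s0.
rewrite mulr1 s0 mulr0 sin0 !mul0r subr0 -/(sin2_mass k.+1) => E.
have k0 : 0 <= k%:R :> R by [].
have pi0 := @pi_gt0 R.
have -> : sin2_mass k.+1 = (2 * k%:R + 1) * int01 (fun t => sin2 t ^+ k * cos2 t).
  by apply: (mulfI (lt0r_neq0 pi0)); rewrite /a in E; lra.
by rewrite mulrAC divff ?mul1r // lt0r_neq0 //; lra.
Qed.

Lemma sin2_massS k : sin2_mass k.+1 =
  sin2_mass k - int01 (fun t => sin2 t ^+ k * cos2 t).
Proof.
rewrite -int01B.
- by apply: eq_int01 => t _; rewrite exprSr -[X in X - _]mulr1 -mulrBr;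
    congr (_ * _); rewrite /sin2 /cos2; lra.
- exact: continuous_sin2X.
- by move=> t; apply: cvgM; [exact: continuous_sin2X | exact: continuous_cos2].
Qed.

(** The two recursions combine to [sin2_mass k = (1 + (2 k + 1)^-1) * sin2_mass k.+1], so positivity
    propagates from [k = 0]. *)
Lemma sin2_mass_gt0 k : 0 < sin2_mass k.
Proof.
elim: k => [|k IH]; first by rewrite /sin2_mass; under eq_fun do rewrite expr0;
  rewrite int01_cst.
have := sin2_massS k; rewrite sin2_cos2_mass => E.
have k0 : 0 <= k%:R :> R by [].
have k1 : 0 < 2 * k%:R + 1 :> R by lra.
have : 0 < (1 + (2 * k%:R + 1)^-1) * sin2_mass k.+1 by lra.
by rewrite pmulr_rgt0 // ltr_wpDr // invr_ge0 ltW.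
Qed.

(** Approximate identity: [|u (1 / 2) - u t|] is at most [e / 2 + N * cos2 t], and against the
    normalised weight [sin2 ^+ k] the second term has mean of order [N / k]. *)
Lemma sin2_unique (u : R -> R) : continuous u ->
  (forall k, int01 (fun t => sin2 t ^+ k * u t) = 0) -> u (1 / 2) = 0.
Proof.
move=> cu u0; apply/eqP; rewrite -normr_le0; apply/ler_addgt0Pr => e e0.
rewrite add0r.
have [N _ HN] : \forall N \near \oo, `[0, 1] `<=`
    (fun t => `|u (1 / 2) - u t| <= e / 2 + N%:R * cos2 t).
  have /compact_near_coveringP := @segment_compact R 0 1; apply => t.
  rewrite /= in_itv /= => t01.
  have e2 : 0 < e / 2 by rewrite divr_gt0.
  (* At the zero of [cos2] the continuity of [u] suffices; near any other point [cos2] is bounded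
     below and a large [N] wins. Compactness makes [N] uniform. *)
  have [c0|c0] := eqVneq (cos2 t) 0.
    have /cvgrPdist_le/(_ _ e2) := cu t; rewrite -(cos2_eq0 t01 c0) => nu.
    exists ([set t' | `|u t - u t'| <= e / 2], setT).
      by split; [exact: nu | exact: filterT].
    by move=> [t' N] /= [h _]; apply: ler_wpDr => //; rewrite mulr_ge0 // cos2_ge0.
  have {}c0 : 0 < cos2 t by rewrite lt_def c0 cos2_ge0.
  have c2 : 0 < cos2 t / 2 by rewrite divr_gt0.
  have /cvgrPdist_le/(_ _ c2) nc := @continuous_cos2 t.
  have /cvgrPdist_le/(_ _ ltr01) nu := cu t.
  exists ([set t' | `|cos2 t - cos2 t'| <= cos2 t / 2 /\ `|u t - u t'| <= 1],
    [set N : nat | (`|u (1 / 2) - u t| + 1) / (cos2 t / 2) <= N%:R]).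
    by split; [exact: filterI | exact: nbhs_infty_ger].
  move=> [t' N] /= [[h1 h2] h3].
  have h4 : cos2 t / 2 <= cos2 t' by move: h1; rewrite ler_norml => /andP[_]; lra.
  have h5 : `|u (1 / 2) - u t'| <= `|u (1 / 2) - u t| + 1.
    by rewrite -(subrKA (u t)) (le_trans (ler_normD _ _)) // lerD.
  apply: ler_wpDl; first exact: ltW.
  apply: le_trans h5 _; move: h3; rewrite ler_pdivrMr // => h3.
  by apply: le_trans h3 _; rewrite ler_wpM2l.
have {}HN t : 0 <= t <= 1 -> `|u (1 / 2) - u t| <= e / 2 + N%:R * cos2 t.
  by move=> t01; apply: (HN N) => //=; rewrite in_itv.
(* Only now is [k] chosen, so that the concentration beats the constant [N]. *)
have [k kN] : exists k : nat, N%:R / (2 * k%:R + 1) <= e / 2.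
  exists (Num.truncn (N%:R / (e / 2))).
  have := truncnS_gt (N%:R / (e / 2)); set k := Num.truncn _.
  rewrite ltr_pdivrMr ?divr_gt0 // => h.
  have k0 : 0 <= k%:R :> R by [].
  rewrite ler_pdivrMr; last by lra.
  have ke : 0 <= k%:R * e by rewrite mulr_ge0 // ltW.
  by move: h; rewrite -[k.+1%:R]natr1 => h; lra.
have cs := @continuous_sin2X k.
have csc : continuous (fun t => sin2 t ^+ k * cos2 t).
  by move=> t; apply: cvgM; [exact: cs | exact: continuous_cos2].
have csu : continuous (fun t => sin2 t ^+ k * u t).
  by move=> t; apply: cvgM; [exact: cs | exact: cu].
have csh : continuous (fun t => u (1 / 2) * sin2 t ^+ k).
  by move=> t; apply: cvgM; [exact: cvg_cst | exact: cs].
have m0 := sin2_mass_gt0 k.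
rewrite -(ler_pM2r m0) -{1}(gtr0_norm m0) -normrM -int01Zl //.
rewrite -[int01 _]subr0 -(u0 k) -int01B //.
have cd : continuous (fun t => u (1 / 2) * sin2 t ^+ k - sin2 t ^+ k * u t).
  by move=> t; apply: cvgB; [exact: csh | exact: csu].
have c1 : continuous (fun t => e / 2 * sin2 t ^+ k).
  by move=> t; apply: cvgM; [exact: cvg_cst | exact: cs].
have c2 : continuous (fun t => N%:R * (sin2 t ^+ k * cos2 t)).
  by move=> t; apply: cvgM; [exact: cvg_cst | exact: csc].
apply: le_trans (normr_int01 cd) _.
apply: (@le_trans _ _ (int01 (fun t => e / 2 * sin2 t ^+ k +
    N%:R * (sin2 t ^+ k * cos2 t)))).
  apply: ler_int01.
  - by move=> t; apply: (@cvg_norm _ R); exact: cd.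
  - by move=> t; apply: cvgD; [exact: c1 | exact: c2].
  move=> t t01; rewrite [u _ * _]mulrC -mulrBr normrM ger0_norm ?exprn_ge0 ?sin2_ge0 //.
  have -> : e / 2 * sin2 t ^+ k + N%:R * (sin2 t ^+ k * cos2 t) =
    sin2 t ^+ k * (e / 2 + N%:R * cos2 t) by ring.
  by apply: ler_wpM2l; [rewrite exprn_ge0 ?sin2_ge0 | exact: HN].
rewrite int01D // !int01Zl // -/(sin2_mass k) sin2_cos2_mass.
have h : sin2_mass k.+1 <= sin2_mass k.
  rewrite sin2_massS gerBl -(int01_cst 0); apply: ler_int01 => //.
    by move=> t; exact: cvg_cst.
  by move=> t _; rewrite mulr_ge0 ?exprn_ge0 ?sin2_ge0 ?cos2_ge0.
have -> : N%:R * (sin2_mass k.+1 / (2 * k%:R + 1)) =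
  N%:R / (2 * k%:R + 1) * sin2_mass k.+1 by ring.
have d0 : 0 <= N%:R / (2 * k%:R + 1) :> R by rewrite divr_ge0 // addr_ge0 // mulr_ge0.
have := ler_pM d0 (ltW (sin2_mass_gt0 k.+1)) kN h.
by move: (_ / _ * _) => y; lra.
Unshelve. all: end_near. Qed.

Lemma fweightD (m m' : int) (t : R) :
  fweight (m + m') t = fweight m t * fweight m' t.
Proof.
rewrite /fweight; apply: complex_ext; rewrite !reimE /= rmorphD /= mulrDr mulrDl.
  by rewrite cosD mulrNN.
by rewrite sinD; ring.
Qed.

Lemma sin2_fweight (t : R) : (sin2 t)%:C%C =
  2^-1%:C%C - 4^-1%:C%C * (fweight 1 t + fweight (-1) t) :> R[i].
Proof.
rewrite /sin2 /fweight; apply: complex_ext; rewrite !reimE /= ?reimE /= mulrN1z mulrN !mulNr.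
  by rewrite !cosN mulr1 mul0r subr0; field.
by rewrite sinN mulr1; ring.
Qed.

Lemma fweight_unique (u : R -> R[i]) : ccontinuous u ->
  (forall m, cint01 (fun t => fweight m t * u t) = 0) -> u (1 / 2) = 0.
Proof.
move=> cu u0.
have cw := @ccontinuous_fweight R.
have cs k : ccontinuous (fun t => (sin2 t ^+ k)%:C%C : R[i]).
  by split => t /=; [exact: continuous_sin2X | exact: cvg_cst].
have ck k m : ccontinuous (fun t => (sin2 t ^+ k)%:C%C * (fweight m t * u t)).
  by do 2 (apply: ccontinuousM => //).
(* The induction keeps all [m] at once, because multiplication by [sin2] mixes the frequencies [m],
   [m + 1] and [m - 1]. *)
have H k : forall m, cint01 (fun t => (sin2 t ^+ k)%:C%C * (fweight m t * u t)) = 0.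
  elim: k => [|k IH] m.
    by rewrite -[RHS](u0 m); apply: eq_cint01 => t _; rewrite expr0 mul1r.
  pose I m := fun t => (sin2 t ^+ k)%:C%C * (fweight m t * u t).
  have cI c m' : ccontinuous (fun t => c * I m' t).
    by apply: ccontinuousM; [exact: ccontinuous_cst | exact: ck].
  transitivity (cint01 (fun t => 2^-1%:C%C * I m t +
     ((- 4^-1)%:C%C * I (1 + m) t + (- 4^-1)%:C%C * I (-1 + m) t))).
    apply: eq_cint01 => t _; rewrite /I exprS rmorphM /= sin2_fweight !fweightD.
    by rewrite rmorphN /=; ring.
  rewrite !cint01D //; last by apply: ccontinuousD.
  by rewrite !cint01Zl ?IH ?mulr0 ?addr0 //; exact: ck.
have {}H k : cint01 (fun t => (sin2 t ^+ k)%:C%C * u t) = 0.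
  rewrite -[RHS](H k 0); apply: eq_cint01 => t _; congr (_ * _).
  by rewrite /fweight mulr0 mul0r cos0 sin0 oppr0 [X in X * _](_ : _ = 1) ?mul1r.
case: cu => cr ci; apply: complex_ext => /=.
  apply: (@sin2_unique (fun t => complex.Re (u t))) => // k.
  have /(congr1 (@complex.Re R)) /= E := H k; rewrite -[RHS]E.
  by apply: eq_int01 => t _; rewrite reimE /= mul0r subr0.
apply: (@sin2_unique (fun t => complex.Im (u t))) => // k.
have /(congr1 (@complex.Im R)) /= E := H k; rewrite -[RHS]E.
by apply: eq_int01 => t _; rewrite reimE /= mul0r addr0.
Qed.

Lemma fcoef_unique {V : normedModType R} (b : V) (f : V -> R[i]) :
  ccontinuous f -> (forall m x, fcoef m b f x = 0) -> forall x, f x = 0.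
Proof.
move=> cf f0 x.
(* The segment starts half a vector before [x], which puts [x] at the parameter [1 / 2] where
   uniqueness is known. *)
have := @fweight_unique (fun t => f (x - (1 / 2) *: b + t *: b)).
rewrite subrK; apply; last by move=> m; exact: f0.
apply: (@ccontinuous_comp _ _ _ (fun t : R => x - (1 / 2) *: b + t *: b) f) => //.
exact: continuous_line.
Qed.

End FourierUniqueness.

(** * Locally uniform convergence of series *)

Section UniformLimits.
Context {R : realType} {V : normedModType R}.

Lemma le_cvg0 (tau : nat -> R) (a c : R) : tau @ \oo --> (0 : R) ->
  (\forall N \near \oo, a <= tau N * c) -> a <= 0.
Proof.
move=> t0 H; apply/ler_addgt0Pr => e e0; rewrite add0r.
have c1 : 0 < `|c| + 1 by rewrite ltr_wpDl.
have e1 : 0 < e / (`|c| + 1) by rewrite divr_gt0.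
have /cvgrPdist_le/(_ _ e1) n0 := t0.
have [N [hN tN]] : exists N, a <= tau N * c /\ `|0 - tau N| <= e / (`|c| + 1).
  by apply/(@filter_ex _ \oo)/filterI.
rewrite sub0r normrN in tN.
apply: le_trans hN _; apply: le_trans (ler_norm _) _; rewrite normrM.
apply: (@le_trans _ _ (e / (`|c| + 1) * (`|c| + 1))); last by rewrite divfK // gt_eqF.
by apply: ler_pM => //; rewrite lerDl.
Qed.

(** Weierstrass test with an explicit tail. The factor [g] will depend on the point, while the
    summable [W] does not. *)
Lemma series_tail (a W : nat -> R) (g : R) : (forall i, `|a i| <= W i * g) ->
  cvgn (series W) ->
  cvgn (series a) /\ forall N, `|limn (series a) - series a N| <=
    (limn (series W) - series W N) * g.
Proof.
move=> aW cW.
have W0g i : 0 <= W i * g by apply: le_trans (aW i).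
have sE : series (fun i => W i * g) = (fun N => series W N * g).
  by apply/funext => N; rewrite /series /= mulr_suml.
have ca : cvgn (series a).
  apply: normed_cvg; apply: (@series_le_cvg _ _ (fun i => W i * g)) => //.
    by move=> i; exact: normr_ge0.
  by rewrite sE; apply: is_cvgMr_tmp.
have mono N M : (N <= M)%N -> series W N * g <= series W M * g.
  move=> NM; have := subnK NM; move: (M - N)%N => k <-.
  elim: k => [|k IH]; first by rewrite add0n.
  rewrite addSn; apply: le_trans IH _.
  by rewrite /series /= big_nat_recr //= mulrDl lerDl.
split=> // N.
apply/ler_addgt0Pr => e e0.
have e2 : 0 < e / 2 by rewrite divr_gt0.
have /cvgrPdist_le/(_ _ e2) na := ca.
have /cvgrPdist_le/(_ _ e2) nw : (fun M => series W M * g) @ \oo --> limn (series W) * g.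
  by apply: cvgMr_tmp; exact: cW.
have [M [NM [hM hW]]] : exists M, (N <= M)%N /\
    `|limn (series a) - series a M| <= e / 2 /\
    `|limn (series W) * g - series W M * g| <= e / 2.
  apply/(@filter_ex _ \oo)/filterI; first by exists N.
  exact: filterI.
have step : `|series a M - series a N| <= series W M * g - series W N * g.
  rewrite /series /= (big_cat_nat _ NM) //= [X in `|X|]addrAC subrr add0r.
  rewrite [X in _ <= X * _ - _](big_cat_nat _ NM) //= mulrDl [leRHS]addrAC subrr add0r.
  rewrite mulr_suml; apply: le_trans (ler_norm_sum _ _ _) _.
  by apply: ler_sum => i _; exact: aW.
move: hW; rewrite ler_norml => /andP[hW _].
rewrite -(subrKA (series a M)); apply: le_trans (ler_normD _ _) _.
by rewrite mulrBl; move: hM step hW; lra.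
Qed.

(** A bound [tau N * G x] with [G] continuous and [tau] tending to 0 plays the role of locally
    uniform convergence. *)
Lemma continuous_uniform_limit (F : V -> R) (S : nat -> V -> R) (tau : nat -> R)
    (G : V -> R) : (forall N, continuous (S N)) -> continuous G ->
  tau @ \oo --> (0 : R) -> (forall N x, `|F x - S N x| <= tau N * G x) -> continuous F.
Proof.
move=> cS cG t0 FS x; apply/cvgrPdist_le => e e0.
have e3 : 0 < e / 3 by rewrite divr_gt0.
have G1 : 0 < `|G x| + 1 by rewrite ltr_wpDl.
have e4 : 0 < e / 3 / (`|G x| + 1) by rewrite divr_gt0.
have /cvgrPdist_le/(_ _ e4) nt := t0.
have [N] := @filter_ex _ \oo _ _ nt; rewrite sub0r normrN => tN.
have /cvgrPdist_le/(_ _ e3) nS := cS N x.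
have /cvgrPdist_le/(_ _ ltr01) nG := cG x.
have B y : `|G y| <= `|G x| + 1 -> `|F y - S N y| <= e / 3.
  move=> hG; apply: le_trans (FS N y) _; apply: le_trans (ler_norm _) _.
  rewrite normrM; apply: (@le_trans _ _ (e / 3 / (`|G x| + 1) * (`|G x| + 1))).
    exact: ler_pM.
  by rewrite divfK // gt_eqF.
near=> y.
have h1 : `|S N x - S N y| <= e / 3 by near: y.
have h2 : `|G x - G y| <= 1 by near: y.
have h3 := B y; have h4 := B x.
have {}h3 : `|F y - S N y| <= e / 3.
  apply: h3; have := ler_normB (G x) (G x - G y).
  by rewrite opprB addrC subrK => /le_trans; apply; rewrite lerD2l.
have {}h4 : `|F x - S N x| <= e / 3 by apply: h4; rewrite lerDl.
have -> : F x - F y = (F x - S N x) + (S N x - S N y) - (F y - S N y) by ring.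
apply: le_trans (ler_normB _ _) _.
have := ler_normD (F x - S N x) (S N x - S N y).
by move: h1 h3 h4; lra.
Unshelve. all: end_near. Qed.

(** The integral form of the mean value formula with a continuous integrand implies
    differentiability; unlike difference quotients, this form passes to limits. *)
Lemma is_derive_mean (f d : V -> R) (x v : V) : continuous d ->
  (forall h : R, f (x + h *: v) - f x = h * int01 (fun t => d (x + (h * t) *: v))) ->
  is_derive x v f (d x).
Proof.
move=> cd H.
have cl : continuous (fun p : R * R => d (x + (p.1 * p.2) *: v)).
  move=> p; apply: (@continuous_comp _ _ _ (fun p : R * R => x + (p.1 * p.2) *: v) d).
    apply: cvgD; first exact: cvg_cst.
    by apply: cvgZr_tmp; apply: cvgM; [exact: cvg_fst | exact: cvg_snd].
  exact: cd.
have := @continuous_int01 R R^o (fun h t => d (x + (h * t) *: v)) cl 0.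
rewrite /continuous_at [X in _ --> X](_ : _ = d x); last first.
  rewrite -[RHS]int01_cst; apply: eq_int01 => t _.
  by rewrite mul0r scale0r addr0.
move=> L.
have lim : (fun k : R => k^-1 *: ((f \o shift x) (k *: v) - f x)) @ 0^' --> d x.
  apply: (@cvg_trans _ ((fun h => int01 (fun t => d (x + (h * t) *: v))) @ 0^')).
    apply: near_eq_cvg; near=> k.
    have k0 : k != 0 by near: k; exact: nbhs_dnbhs_neq.
    by rewrite /= [k *: v + x]addrC H /GRing.scale /= mulKf.
  by apply: cvg_trans L; apply: cvg_app; exact: nbhs_dnbhs.
by split; [apply/cvg_ex; eexists; exact: lim | exact: cvg_lim lim].
Unshelve. all: end_near. Qed.

Lemma is_deriveC_scale (u u' : R -> R[i]) (h t : R) :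
  (forall k : R, is_deriveC k (1 : R) u (u' k)) ->
  is_deriveC t (1 : R) (fun t => u (h * t)) (h%:C%C * u' (h * t)).
Proof.
move=> du; have [a b] := du (h * t).
have dh : is_derive t (1 : R) (fun t : R => h * t) h.
  by apply: is_derive_eq; rewrite /GRing.scale /= mulr1.
split; rewrite reimE /= mul0r ?subr0 ?addr0.
  by apply: (is_derive_eq (is_derive1_comp a dh)); rewrite /GRing.scale /= mulrC.
by apply: (is_derive_eq (is_derive1_comp b dh)); rewrite /GRing.scale /= mulrC.
Qed.

(** The mean value formula of each [S N] converges to that of [F], and [is_derive_mean] converts it
    back into a derivative. *)
Lemma is_deriveC_uniform_limit (F D : V -> R[i]) (S S' : nat -> V -> R[i])
    (tau : nat -> R) (G : V -> R) (v : V) :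
  (forall N x, is_deriveC x v (S N) (S' N x)) ->
  (forall N, ccontinuous (S' N)) -> ccontinuous D -> continuous G ->
  tau @ \oo --> (0 : R) ->
  (forall N x, cnorm (F x - S N x) <= tau N * G x) ->
  (forall N x, cnorm (D x - S' N x) <= tau N * G x) ->
  forall x, is_deriveC x v F (D x).
Proof.
move=> dS cS' cD cG t0 FS DS x.
have cl (h : R) : continuous (fun t : R => x + (h * t) *: v).
  move=> t; apply: cvgD; first exact: cvg_cst.
  by apply: cvgZr_tmp; apply: cvgM; [exact: cvg_cst | exact: cvg_id].
have K h : F (x + h *: v) - F x = h%:C%C * cint01 (fun t => D (x + (h * t) *: v)).
  have cDl : ccontinuous (fun t : R => D (x + (h * t) *: v)).
    by apply: ccontinuous_comp cD; exact: cl.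
  have cGl : continuous (fun t : R => G (x + (h * t) *: v)).
    by move=> t; apply: (@continuous_comp _ _ _ (fun t : R => x + (h * t) *: v) G);
      [exact: cl | exact: cG].
  apply/eqP; rewrite -subr_eq0; apply/eqP/cnorm_le0.
  apply: (le_cvg0 t0 (c := G (x + h *: v) + G x +
    `|h| * (2 * int01 (fun t => G (x + (h * t) *: v))))).
  near=> N.
  have cSl : ccontinuous (fun t : R => S' N (x + (h * t) *: v)).
    by apply: ccontinuous_comp (cS' N); exact: cl.
  have cSh : ccontinuous (fun t : R => h%:C%C * S' N (x + (h * t) *: v)).
    by apply: ccontinuousM => //; exact: ccontinuous_cst.
  have E : S N (x + h *: v) - S N x = h%:C%C * cint01 (fun t => S' N (x + (h * t) *: v)).
    rewrite -cint01Zl // (@cint01_derive _ (fun t => S N (x + (h * t) *: v))) //.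
      by rewrite mulr1 mulr0 scale0r addr0.
    move=> t; apply: (@is_deriveC_scale (fun k => S N (x + k *: v))
      (fun k => S' N (x + k *: v))) => k.
    exact: is_deriveC_line.
  have cNl : ccontinuous (fun t : R => -1 * S' N (x + (h * t) *: v)).
    by apply: ccontinuousM => //; exact: ccontinuous_cst.
  have -> : F (x + h *: v) - F x - h%:C%C * cint01 (fun t => D (x + (h * t) *: v)) =
     (F (x + h *: v) - S N (x + h *: v)) + - (F x - S N x) +
     - (h%:C%C * cint01 (fun t => D (x + (h * t) *: v) + -1 * S' N (x + (h * t) *: v))).
    by rewrite cint01D // cint01Zl // mulN1r mulrBr -E; ring.
  rewrite !mulrDr; apply: le_trans (cnormD _ _) _; apply: lerD.
    apply: le_trans (cnormD _ _) _; rewrite cnormN.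
    by apply: lerD; exact: FS.
  rewrite cnormN; apply: le_trans (cnormM _ _) _; rewrite cnorm_real mulrCA.
  apply: ler_wpM2l => //; rewrite mulrCA -int01Zl //.
  apply: cnorm_cint01.
  - exact: ccontinuousD.
  - by move=> t; apply: cvgM; [exact: cvg_cst | exact: cGl].
  - by move=> t; rewrite mulN1r; exact: DS.
case: (cD) => cR cI; split.
  apply: (@is_derive_mean (fun y => complex.Re (F y)) (fun y => complex.Re (D y))) => // h.
  by have /(congr1 (@complex.Re R)) := K h; rewrite !reimE /= mul0r subr0.
apply: (@is_derive_mean (fun y => complex.Im (F y)) (fun y => complex.Im (D y))) => // h.
by have /(congr1 (@complex.Im R)) := K h; rewrite !reimE /= mul0r addr0.
Unshelve. all: end_near. Qed.

Definition csum (u : nat -> V -> R[i]) (x : V) : R[i] :=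
  (limn (series (fun i => complex.Re (u i x))) +i*
   limn (series (fun i => complex.Im (u i x))))%C.

Lemma Re_sum (I : Type) (r : seq I) (P : pred I) (F : I -> R[i]) :
  complex.Re (\sum_(i <- r | P i) F i) = \sum_(i <- r | P i) complex.Re (F i).
Proof. by apply: (big_morph _ (@Re_add R)). Qed.

Lemma Im_sum (I : Type) (r : seq I) (P : pred I) (F : I -> R[i]) :
  complex.Im (\sum_(i <- r | P i) F i) = \sum_(i <- r | P i) complex.Im (F i).
Proof. by apply: (big_morph _ (@Im_add R)). Qed.

Lemma csum_tail (u : nat -> V -> R[i]) (W : nat -> R) (G : V -> R) :
  cvgn (series W) -> (forall i x, cnorm (u i x) <= W i * G x) ->
  forall N x, cnorm (csum u x - \sum_(0 <= i < N) u i x) <=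
    (2 * (limn (series W) - series W N)) * G x.
Proof.
move=> cW uW N x.
have [_ /(_ N) a] := series_tail (fun i => le_trans (Re_le_cnorm _) (uW i x)) cW.
have [_ /(_ N) b] := series_tail (fun i => le_trans (Im_le_cnorm _) (uW i x)) cW.
rewrite /cnorm !reimE Re_sum Im_sum /= -mulrA mulr_natl mulr2n.
exact: lerD.
Qed.

Lemma cvg_tail (W : nat -> R) : cvgn (series W) ->
  (fun N => 2 * (limn (series W) - series W N)) @ \oo --> (0 : R).
Proof.
move=> cW; rewrite -(mulr0 2) -(subrr (limn (series W))).
by apply: cvgM; [exact: cvg_cst | apply: cvgB; [exact: cvg_cst | exact: cW]].
Qed.

Lemma ccontinuous_sum (T : topologicalType) (I : Type) (r : seq I) (P : pred I)
    (F : I -> T -> R[i]) :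
  (forall i, P i -> ccontinuous (F i)) -> ccontinuous (fun x => \sum_(i <- r | P i) F i x).
Proof.
move=> cF; elim: r => [|i r IH].
  by under eq_fun do rewrite big_nil; exact: ccontinuous_cst.
under eq_fun do rewrite big_cons; case: (boolP (P i)) => // Pi.
by apply: ccontinuousD => //; exact: cF.
Qed.

Lemma ccontinuous_csum (u : nat -> V -> R[i]) (W : nat -> R) (G : V -> R) :
  cvgn (series W) -> (forall i x, cnorm (u i x) <= W i * G x) -> continuous G ->
  (forall i, ccontinuous (u i)) -> ccontinuous (csum u).
Proof.
move=> cW uW cG cu; have T := csum_tail cW uW.
have cS N : ccontinuous (fun x => \sum_(0 <= i < N) u i x) by exact: ccontinuous_sum.
split; apply: (continuous_uniform_limit _ cG (cvg_tail cW)).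
- by move=> N; have [a _] := cS N; exact: a.
- by move=> N x; apply: le_trans (T N x); rewrite -Re_opp -Re_add Re_le_cnorm.
- by move=> N; have [_ a] := cS N; exact: a.
- by move=> N x; apply: le_trans (T N x); rewrite -Im_opp -Im_add Im_le_cnorm.
Qed.

Lemma is_deriveC_sum (I : Type) (r : seq I) (F F' : I -> V -> R[i]) x v :
  (forall i, is_deriveC x v (F i) (F' i x)) ->
  is_deriveC x v (fun x => \sum_(i <- r) F i x) (\sum_(i <- r) F' i x).
Proof.
move=> dF; elim: r => [|i r IH].
  by rewrite big_nil; under eq_fun do rewrite big_nil; exact: is_deriveC_cst.
by rewrite big_cons; under eq_fun do rewrite big_cons; exact: is_deriveCD.
Qed.

Lemma is_deriveC_csum (u u' : nat -> V -> R[i]) (W : nat -> R) (G G' : V -> R) v :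
  cvgn (series W) -> (forall i, 0 <= W i) ->
  (forall i x, cnorm (u i x) <= W i * G x) ->
  (forall i x, cnorm (u' i x) <= W i * G' x) -> continuous G -> continuous G' ->
  (forall i, ccontinuous (u' i)) ->
  (forall i x, is_deriveC x v (u i) (u' i x)) ->
  forall x, is_deriveC x v (csum u) (csum u' x).
Proof.
move=> cW W0 uW uW' cG cG' cu' du.
(* A common majorant for the series and its derivative; absolute values, since the signs of [G] and
   [G'] are not known. *)
have cGG : continuous (fun x => `|G x| + `|G' x|).
  by move=> x; apply: cvgD; apply: (@cvg_norm _ R); [exact: cG | exact: cG'].
have uWW i x : cnorm (u i x) <= W i * (`|G x| + `|G' x|).
  apply: le_trans (uW i x) _; apply: ler_wpM2l => //.
  by apply: le_trans (ler_norm _) _; rewrite lerDl.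
have uWW' i x : cnorm (u' i x) <= W i * (`|G x| + `|G' x|).
  apply: le_trans (uW' i x) _; apply: ler_wpM2l => //.
  by apply: le_trans (ler_norm _) _; rewrite lerDr.
apply: (is_deriveC_uniform_limit _ _ _ cGG (cvg_tail cW)
  (csum_tail cW uWW) (csum_tail cW uWW')).
- by move=> N x; exact: is_deriveC_sum.
- by move=> N; exact: ccontinuous_sum.
- exact: (ccontinuous_csum cW uWW').
Qed.

End UniformLimits.

(** * Fourier projections along several directions *)

Section FourierModes.
Context {R : realType} {V : normedModType R} {n : nat} (b : 'I_n -> V).
Implicit Types (f g : V -> R[i]) (x v : V) (m : 'I_n -> int) (r : seq 'I_n).

(** The vectors [b] need not span [V]: the remaining directions are parameters. A list of
    directions, rather than all of them, allows induction. *)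
Definition mode_seq r m f : V -> R[i] :=
  foldr (fun j g => fcoef (m j) (b j) g) f r.

Definition mode m f := mode_seq (enum 'I_n) m f.

Definition periodic f := forall j x, f (x + b j) = f x.

Lemma ccontinuous_mode_seq r m f : ccontinuous f -> ccontinuous (mode_seq r m f).
Proof.
by move=> cf; elim: r => //= j r; apply: ccontinuous_avg; exact: ccontinuous_fweight.
Qed.

Lemma smooth_mode_seq r m f : smooth f -> smooth (mode_seq r m f).
Proof.
by move=> cf; elim: r => //= j r; apply: smooth_avg; exact: ccontinuous_fweight.
Qed.

Lemma deriveC_mode_seq r m f x v : smooth f ->
  deriveC (mode_seq r m f) x v = mode_seq r m (fun x => deriveC f x v) x.
Proof.
move=> sf; elim: r x => //= j r IH x.
rewrite deriveC_avg; [|exact: ccontinuous_fweight|exact: smooth_mode_seq].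
by congr (fcoef _ _ _ x); apply/funext.
Qed.

Lemma mode_seq_shift r m f (c : V) k : ccontinuous f ->
  (forall x, f (x + c) = k * f x) ->
  forall x, mode_seq r m f (x + c) = k * mode_seq r m f x.
Proof.
move=> cf fc; elim: r => //= j r IH x; apply: avg_shift => //.
  exact: ccontinuous_fweight.
exact: ccontinuous_mode_seq.
Qed.

Lemma periodic_mode_seq r m f : ccontinuous f -> periodic f -> periodic (mode_seq r m f).
Proof.
move=> cf pf j x; rewrite (@mode_seq_shift r m f (b j) 1) ?mul1r // => y.
by rewrite mul1r.
Qed.

Lemma mode_seqM r m (c : V -> R[i]) f x : ccontinuous f ->
  (forall j x (t : R), c (x + t *: b j) = c x) ->
  mode_seq r m (fun x => c x * f x) x = c x * mode_seq r m f x.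
Proof.
move=> cf cb; elim: r x => //= j r IH x.
rewrite -(avgM _ _ _ (c := c)); first by congr (fcoef _ _ _ x); apply/funext.
- exact: ccontinuous_fweight.
- exact: ccontinuous_mode_seq.
- exact: cb.
Qed.

Lemma mode_seqZ r m c f x : ccontinuous f ->
  mode_seq r m (fun x => c * f x) x = c * mode_seq r m f x.
Proof. by move=> cf; apply: (mode_seqM _ _ (c := fun=> c)). Qed.

Lemma mode_seqD r m f g x : ccontinuous f -> ccontinuous g ->
  mode_seq r m (fun x => f x + g x) x = mode_seq r m f x + mode_seq r m g x.
Proof.
move=> cf cg; elim: r x => //= j r IH x.
rewrite -avgD; first by congr (fcoef _ _ _ x); apply/funext.
- exact: ccontinuous_fweight.
- exact: ccontinuous_mode_seq.
- exact: ccontinuous_mode_seq.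
Qed.

Lemma mode_seq0 r m x : mode_seq r m (fun=> 0) x = 0.
Proof.
elim: r x => //= j r IH x; rewrite -[RHS](avg0 (fweight (m j)) (b j) x).
by congr (fcoef _ _ _ x); apply/funext.
Qed.

Lemma mode_seq_sum (I : Type) (s : seq I) r m (F : I -> V -> R[i]) x :
  (forall i, ccontinuous (F i)) ->
  mode_seq r m (fun x => \sum_(i <- s) F i x) x = \sum_(i <- s) mode_seq r m (F i) x.
Proof.
move=> cF; elim: s => [|i s IH].
  by rewrite big_nil; under eq_fun do rewrite big_nil; exact: mode_seq0.
rewrite big_cons -IH; under eq_fun do rewrite big_cons.
by rewrite mode_seqD //; exact: ccontinuous_sum.
Qed.

Lemma deriveC_mode_seq_freq r m f j x : smooth f -> periodic f -> j \in r ->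
  deriveC (mode_seq r m f) x (b j) = freq (m j) * mode_seq r m f x.
Proof.
move=> sf pf; elim: r x => //= i r IH x; rewrite inE.
have [<- _|ji /= jr] := eqVneq j i.
  apply: deriveC_fcoef; first exact: smooth_mode_seq.
  by apply: periodic_mode_seq => //; exact: smooth_ccontinuous.
rewrite deriveC_avg; [|exact: ccontinuous_fweight|exact: smooth_mode_seq].
rewrite -avgZ; first by congr (avg _ _ _ x); apply/funext => y; exact: IH.
  exact: ccontinuous_fweight.
exact/ccontinuous_mode_seq/smooth_ccontinuous.
Qed.

Lemma mode_seq_id r m f : smooth f ->
  (forall j x, j \in r -> deriveC f x (b j) = freq (m j) * f x) ->
  mode_seq r m f = f.
Proof.
move=> sf; elim: r => //= i r IH df.
rewrite IH; last by move=> j x jr; apply: df; rewrite inE jr orbT.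
by apply/funext => x; apply: fcoef_eigen => // y; apply: df; rewrite mem_head.
Qed.

Lemma eq_mode_seq r m m' f : {in r, m =1 m'} -> mode_seq r m f = mode_seq r m' f.
Proof.
elim: r => [//|i r IH] mm; rewrite /mode_seq /= -!/(mode_seq _ _ _).
have -> : m i = m' i by apply: mm; exact: mem_head.
rewrite IH; first by [].
by move=> j jr; apply: mm; rewrite inE jr orbT.
Qed.

Lemma mode_seq_unique r f : uniq r -> ccontinuous f ->
  (forall m x, mode_seq r m f x = 0) -> forall x, f x = 0.
Proof.
move=> + cf; elim: r => [|i r IH] /=; first by move=> _ H; exact: (H (fun=> 0)).
move=> /andP[ir ur] H; apply: IH => // m x.
apply: (@fcoef_unique _ _ (b i) (mode_seq r m f)); first exact: ccontinuous_mode_seq.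
(* Overwrite the entry of [m] at [i] by [c]; since [i] does not occur in [r], the remaining
   projections are unchanged. *)
move=> c y; pose m' j := if j == i then c else m j.
rewrite -[RHS](H m' y) {1}/m' eqxx; congr (fcoef _ _ _ y); apply: eq_mode_seq.
by move=> j jr; rewrite /m'; case: eqVneq jr ir => // -> ->.
Qed.

(** Iterated averages of a majorant: a continuous bound for [mode_seq r m f] independent of [m]. *)
Definition abs_mode_seq r (g : V -> R) : V -> R :=
  foldr (fun j (h : V -> R) x => 4 * int01 (fun t => h (x + t *: b j))) g r.

Lemma continuous_abs_mode_seq r (g : V -> R) : continuous g ->
  continuous (abs_mode_seq r g).
Proof. by move=> cg; elim: r => //= j r; exact: continuous_abs_avg. Qed.

Lemma cnorm_mode_seq r m f (g : V -> R) x : ccontinuous f -> continuous g ->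
  (forall x, cnorm (f x) <= g x) -> cnorm (mode_seq r m f x) <= abs_mode_seq r g x.
Proof.
move=> cf cg fg; elim: r x => //= j r IH x; apply: cnorm_avg => //.
- exact: ccontinuous_fweight.
- exact: ccontinuous_mode_seq.
- exact: continuous_abs_mode_seq.
- exact: cnorm_fweight.
Qed.

Lemma abs_mode_seqZ r c (g : V -> R) x : continuous g ->
  abs_mode_seq r (fun x => c * g x) x = c * abs_mode_seq r g x.
Proof.
move=> cg; elim: r x => //= j r IH x.
rewrite mulrCA -(int01Zl c); last first.
  move=> t; apply: (@continuous_comp _ _ _ (fun t : R => x + t *: b j) (abs_mode_seq r g)).
    exact: continuous_line.
  exact: (@continuous_abs_mode_seq r g cg).
by rewrite (@eq_int01 _ _ (fun t => c * abs_mode_seq r g (x + t *: b j))).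
Qed.

(** The composite is an eigenfunction of the derivative along [b j] for both [freq (m j)] and
    [freq (m' j)], so it vanishes when these differ. *)
Lemma mode_mode m m' f x : smooth f -> periodic f ->
  mode m (mode m' f) x = if [forall j, m j == m' j] then mode m' f x else 0.
Proof.
move=> sf pf; have sf' : smooth (mode m' f) by exact: smooth_mode_seq.
have pf' : periodic (mode m' f).
  by apply: periodic_mode_seq => //; exact: smooth_ccontinuous.
have D j y : deriveC (mode m' f) y (b j) = freq (m' j) * mode m' f y.
  by apply: deriveC_mode_seq_freq => //; rewrite mem_enum.
case: ifPn => [/forallP H|].
  rewrite /mode mode_seq_id // => j y _.
  by rewrite D (eqP (H j)).
rewrite negb_forall => /existsP[j mj].
have : deriveC (mode m (mode m' f)) x (b j) = freq (m j) * mode m (mode m' f) x.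
  by apply: deriveC_mode_seq_freq => //; rewrite mem_enum.
rewrite deriveC_mode_seq // (_ : (fun x => _) = (fun y => freq (m' j) * mode m' f y)).
  rewrite mode_seqZ; last exact: smooth_ccontinuous.
  move/eqP; rewrite -subr_eq0 -mulrBl mulf_eq0 subr_eq0 => /orP[/eqP/freq_inj E|/eqP //].
  by rewrite E eqxx in mj.
by apply/funext => y; exact: D.
Qed.

Lemma mode_inj f g : ccontinuous f -> ccontinuous g ->
  (forall m x, mode m f x = mode m g x) -> f = g.
Proof.
move=> cf cg H; apply/funext => x; apply/eqP; rewrite -subr_eq0; apply/eqP.
have cgN : ccontinuous (fun x => -1 * g x).
  by apply: ccontinuousM => //; exact: ccontinuous_cst.
transitivity (f x + -1 * g x); first by rewrite mulN1r.
apply: (@mode_seq_unique (enum 'I_n) (fun x => f x + -1 * g x)) => [||m y].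
- exact: enum_uniq.
- exact: ccontinuousD.
by rewrite mode_seqD // mode_seqZ // mulN1r -/(mode m f y) H subrr.
Qed.

Lemma smooth_mode m f : smooth f -> smooth (mode m f).
Proof. exact: smooth_mode_seq. Qed.

Lemma deriveC_mode m f x v : smooth f ->
  deriveC (mode m f) x v = mode m (fun x => deriveC f x v) x.
Proof. exact: deriveC_mode_seq. Qed.

Lemma deriveC_mode_freq m f j x : smooth f -> periodic f ->
  deriveC (mode m f) x (b j) = freq (m j) * mode m f x.
Proof. by move=> sf pf; apply: deriveC_mode_seq_freq => //; rewrite mem_enum. Qed.

Lemma periodic_deriveC f v : smooth f -> periodic f ->
  periodic (fun x => deriveC f x v).
Proof.
move=> sf pf j x; apply/esym; apply: is_deriveC_val.
have := is_deriveC_shift (smooth_is_deriveC (x + b j) v sf).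
by under eq_fun do rewrite pf.
Qed.

Lemma periodicD f g : periodic f -> periodic g -> periodic (fun x => f x + g x).
Proof. by move=> pf pg j x; rewrite pf pg. Qed.

Lemma periodicZ c f : periodic f -> periodic (fun x => c * f x).
Proof. by move=> pf j x; rewrite pf. Qed.

(** Normalised so that on the mode [m] it acts by [1 + m j ^+ 2], a real number at least 1: applying
    it to [f] trades smoothness for decay of the modes. *)
Definition laplace j f x : R[i] :=
  f x + (- ((2 * pi) ^- 2))%:C%C * deriveC (fun x => deriveC f x (b j)) x (b j).

Lemma smooth_laplace j f : smooth f -> smooth (laplace j f).
Proof. by move=> sf; apply: smoothD => //; apply: smoothZ; do 2 apply: smooth_deriveC. Qed.

Lemma periodic_laplace j f : smooth f -> periodic f -> periodic (laplace j f).
Proof.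
move=> sf pf; apply: periodicD; first exact: pf.
apply: periodicZ; apply: periodic_deriveC; first exact: smooth_deriveC.
exact: periodic_deriveC.
Qed.

Definition jap (c : int) : R := 1 + c%:~R ^+ 2.

Lemma jap_ge1 c : 1 <= jap c.
Proof. by rewrite lerDl sqr_ge0. Qed.

Lemma jap_gt0 c : 0 < jap c.
Proof. by apply: lt_le_trans (jap_ge1 c). Qed.

Lemma freq_sqr (c : int) : (- ((2 * pi) ^- 2))%:C%C * (freq c * freq c) =
  (c%:~R ^+ 2)%:C%C :> R[i].
Proof.
have pi0 := lt0r_neq0 (@pi_gt0 R).
apply: complex_ext; rewrite !reimE /= !(mul0r, mulr0, addr0, subr0, sub0r) //.
rewrite mulrNN (_ : _ * (_ * _) = (2 * pi) ^+ 2 * c%:~R ^+ 2); last by ring.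
by rewrite mulKf // expf_neq0 // mulf_neq0.
Qed.

Lemma mode_laplace m j f x : smooth f -> periodic f ->
  mode m (laplace j f) x = (jap (m j))%:C%C * mode m f x.
Proof.
move=> sf pf; have sf' := smooth_deriveC (b j) sf.
have sf'' := smooth_deriveC (b j) sf'.
have pf' := periodic_deriveC (b j) sf pf.
have cz : ccontinuous (fun x => (- ((2 * pi) ^- 2))%:C%C *
    deriveC (fun x => deriveC f x (b j)) x (b j)).
  by apply: smooth_ccontinuous; exact: smoothZ.
rewrite /laplace /mode mode_seqD //; last exact: smooth_ccontinuous.
rewrite mode_seqZ; last exact: smooth_ccontinuous.
rewrite -![mode_seq _ _ _ _]/(mode _ _ _).
rewrite -deriveC_mode //.
have -> : mode m (fun x => deriveC f x (b j)) = (fun x => freq (m j) * mode m f x).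
  by apply/funext => y; rewrite -deriveC_mode // deriveC_mode_freq.
rewrite deriveCZ; last exact: smooth_mode.
rewrite deriveC_mode_freq // [freq _ * (_ * _)]mulrA [_%:C%C * _]mulrA freq_sqr.
by rewrite /jap rmorphD /= mulrDl mul1r.
Qed.

Definition laplace_iter p r f := foldr (fun j g => iter p (laplace j) g) f r.

Lemma laplace_iterP p r f : smooth f -> periodic f ->
  [/\ smooth (laplace_iter p r f), periodic (laplace_iter p r f) &
    forall m x, mode m (laplace_iter p r f) x =
      (\prod_(j <- r) jap (m j) ^+ p)%:C%C * mode m f x].
Proof.
move=> sf pf; elim: r => [|j r [s1 p1 m1]] /=.
  by split=> // m x; rewrite big_nil mul1r.
have : [/\ smooth (iter p (laplace j) (laplace_iter p r f)),
    periodic (iter p (laplace j) (laplace_iter p r f)) &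
    forall m x, mode m (iter p (laplace j) (laplace_iter p r f)) x =
      (jap (m j) ^+ p)%:C%C * mode m (laplace_iter p r f) x].
  elim: p {s1 p1 m1}(laplace_iter p r f) s1 p1 => [|k IH] g sg pg /=.
    by split=> // m x; rewrite expr0 mul1r.
  have [s2 p2 m2] := IH g sg pg; split.
  - exact: smooth_laplace.
  - exact: periodic_laplace.
  - by move=> m x; rewrite mode_laplace // m2 exprS rmorphM /= mulrA.
by move=> [s2 p2 m2]; split=> // m x; rewrite m2 m1 big_cons rmorphM /= mulrA.
Qed.

End FourierModes.

(** * Summability over the lattice of frequencies *)

Section JapaneseSums.
Context {R : realType}.

(** The subtracted term makes the bound inductive: 1 / (1 + x^2) is at most the telescoping
    difference 4 / (x + 1) - 4 / (x + 2). *)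
Lemma sum_jap_nat_le N : \sum_(i < N) (@jap R i%:Z)^-1 <= 4 - 4 / (N.+1)%:R.
Proof.
elim: N => [|N IH]; first by rewrite big_ord0 divr1 subrr.
rewrite big_ord_recr /=; apply: le_trans (lerD IH (lexx _)) _.
have N0 : 0 <= N%:R :> R by [].
rewrite /jap -[N%:~R]/(N%:R) -[N.+2%:R]natr1 -[N.+1%:R]natr1.
move: (N%:R) N0 => x x0.
have d1 : 0 < 1 + x ^+ 2 by rewrite ltr_pwDl // sqr_ge0.
have d2 : 0 < x + 1 by rewrite ltr_wpDl.
have d3 : 0 < x + 1 + 1 by rewrite ltr_wpDl // ltW.
rewrite -subr_ge0 [X in 0 <= X](_ : _ = (3 * x ^+ 2 - 3 * x + 2) /
  ((1 + x ^+ 2) * ((x + 1) * (x + 1 + 1)))); last first.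
  by field; rewrite !gt_eqF.
by rewrite divr_ge0 ?mulr_ge0 // 1?ltW //; rewrite expr2; nra.
Qed.

Lemma sum_jap_int_le B : \sum_(i < B.*2.+1) (@jap R (i%:Z - B%:Z))^-1 <= 8.
Proof.
have H N : \sum_(0 <= i < N) (@jap R i%:Z)^-1 <= 4.
  rewrite big_mkord; apply: le_trans (sum_jap_nat_le N) _.
  by rewrite gerBl divr_ge0.
have japN c : @jap R (- c) = jap c by rewrite /jap rmorphN sqrrN.
rewrite -(big_mkord xpredT (fun i => (jap (i%:Z - B%:Z))^-1)).
(* Cut the range from [-B] to [B] just before frequency 0; each half is at most 4. *)
rewrite (@big_cat_nat _ _ _ B) //=; last by rewrite -addnn leqW // leq_addr.
rewrite (_ : 8 = 4 + 4); last by ring.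
apply: lerD.
  rewrite big_nat_rev /= add0n; apply: le_trans (H B.+1).
  rewrite [leRHS]big_nat_recl //= big_nat [X in _ <= _ + X]big_nat ler_wpDl //.
    by rewrite invr_ge0 ltW // jap_gt0.
  apply: ler_sum => i /andP[_ iB].
  rewrite -japN opprB subzn; last by lia.
  by rewrite (_ : (B - (B - i.+1))%N = i.+1) //; lia.
rewrite -{1}[B]add0n big_addn; apply: le_trans (H (B.*2.+1 - B)%N).
by apply: ler_sum => i _; rewrite PoszD addrK.
Qed.

Lemma ler_sum_subset (T : eqType) (w : T -> R) (s s' : seq T) :
  uniq s -> {subset s <= s'} -> (forall x, 0 <= w x) ->
  \sum_(x <- s) w x <= \sum_(x <- s') w x.
Proof.
move=> + + w0; elim: s s' => [|x s IH] s' /=; first by rewrite big_nil sumr_ge0.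
move=> /andP[xs us] ss'; have xs' : x \in s' by apply: ss'; rewrite mem_head.
rewrite (perm_big _ (perm_to_rem xs')) !big_cons lerD2l IH // => y ys.
have : y \in s' by apply: ss'; rewrite inE ys orbT.
by rewrite (perm_mem (perm_to_rem xs')) inE; case: eqVneq ys xs => // -> ->.
Qed.

(** A finite set of frequencies lies in a cube, over which the sum of products is a product of
    one-dimensional sums. *)
Lemma sum_prod_jap_le n (s : seq {ffun 'I_n -> int}) : uniq s ->
  \sum_(m <- s) \prod_j (@jap R (m j))^-1 <= 8 ^+ n.
Proof.
move=> us; have w0 (m : 'I_n -> int) : 0 <= \prod_j (@jap R (m j))^-1.
  by apply: prodr_ge0 => j _; rewrite invr_ge0 ltW // jap_gt0.
pose B := \max_(m <- s) \max_j `|m j|%N.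
have mB m j : m \in s -> (`|m j| <= B)%N.
  move=> ms; apply: leq_trans (leq_bigmax_seq _ ms isT).
  exact: (leq_bigmax j).
pose g (k : {ffun 'I_n -> 'I_(B.*2.+1)}) : {ffun 'I_n -> int} :=
  [ffun j => (k j)%:Z - B%:Z].
apply: (@le_trans _ _ (\sum_(m <- codom g) \prod_j (@jap R (m j))^-1)).
  apply: ler_sum_subset => // m ms; apply/codomP.
  have h j : (absz ((m j : int) + B%:Z)%R < B.*2.+1)%N by have := mB m j ms; lia.
  exists [ffun j => Ordinal (h j)]; apply/ffunP => j; rewrite !ffunE /=.
  have shiftK (c : int) : (`|c| <= B)%N -> c = (absz (c + B%:Z)%R)%:Z - B%:Z by lia.
  exact: shiftK (mB m j ms).
rewrite big_image /=.
rewrite (eq_bigr (fun k : {ffun 'I_n -> 'I_(B.*2.+1)} =>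
   \prod_j (jap ((k j)%:Z - B%:Z))^-1)); last first.
  by move=> k _; apply: eq_bigr => j _; rewrite ffunE.
rewrite -(bigA_distr_bigA (fun _ (i : 'I_(B.*2.+1)) => (jap (i%:Z - B%:Z))^-1)) /=.
apply: (@le_trans _ _ (\prod_(j < n) 8)); last by rewrite prodr_const card_ord.
apply: ler_prod => j _; rewrite sum_jap_int_le andbT.
by apply: sumr_ge0 => i _; rewrite invr_ge0 ltW // jap_gt0.
Qed.

End JapaneseSums.

(** * Fourier multipliers of polynomial growth *)

Section Multipliers.
Context {R : realType} {V : normedModType R} {n : nat} (b : 'I_n -> V).

(** Frequencies are enumerated by [pickle], with value 0 at the naturals that code none, so that
    sums over the lattice become ordinary series. *)
Definition jap_weight (i : nat) : R :=
  oapp (fun m : {ffun 'I_n -> int} => \prod_j (jap (m j))^-1) 0 (pickle_inv i).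

Lemma jap_weight_ge0 i : 0 <= jap_weight i.
Proof.
rewrite /jap_weight; case: pickle_inv => //= m.
by apply: prodr_ge0 => j _; rewrite invr_ge0 ltW // jap_gt0.
Qed.

Lemma cvgn_jap_weight : cvgn (series jap_weight).
Proof.
apply: nondecreasing_is_cvgn.
  apply/nondecreasing_seqP => N; rewrite /series /= big_nat_recr //= lerDl.
  exact: jap_weight_ge0.
exists (8 ^+ n) => _ [N _ <-]; rewrite /series /=.
have <- : \sum_(m <- pmap pickle_inv (index_iota 0 N))
    \prod_(j < n) (@jap R ((m : {ffun 'I_n -> int}) j))^-1 =
  \sum_(0 <= i < N) jap_weight i.
  elim: (index_iota 0 N) => [|i s IH] /=; first by rewrite !big_nil.
  by rewrite big_cons -IH /jap_weight; case: pickle_inv => [m|] /=;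
    rewrite ?big_cons ?add0r.
apply: sum_prod_jap_le; apply: (pmap_uniq (@pickle_invK _)).
exact: iota_uniq.
Qed.

Variable a : ('I_n -> int) -> R[i].

Definition multiplier_term (f : V -> R[i]) (i : nat) (x : V) : R[i] :=
  oapp (fun m : {ffun 'I_n -> int} => a m * mode b m f x) 0 (pickle_inv i).

Definition multiplier (f : V -> R[i]) : V -> R[i] := csum (multiplier_term f).

Variables (C : R) (p : nat).
Hypothesis aC : forall m, cnorm (a m) <= C * \prod_j jap (m j) ^+ p.

(** Write the modes of [f] through those of [laplace] iterated [p.+1] times in every direction: [p]
    iterates absorb the growth of [a], and the last one leaves the summable [jap_weight]. *)
Lemma multiplier_term_bound f : smooth f -> periodic b f ->
  exists2 G : V -> R, continuous G &
    forall i x, cnorm (multiplier_term f i x) <= jap_weight i * G x.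
Proof.
move=> sf pf; have [sL pL mL] := laplace_iterP p.+1 (enum 'I_n) sf pf.
set L := laplace_iter _ _ _ _ in sL pL mL.
have cL := ccontinuous_norm (smooth_ccontinuous sL).
exists (fun x => C * abs_mode_seq b (enum 'I_n) (fun x => cnorm (L x)) x).
  by move=> x; apply: cvgM; [exact: cvg_cst | exact: continuous_abs_mode_seq].
move=> i x; rewrite /multiplier_term /jap_weight.
case: pickle_inv => [m|] /=; last by rewrite cnorm0 mul0r.
have cm := cnorm_mode_seq b (enum 'I_n) m x (smooth_ccontinuous sL) cL
  (fun x => lexx _).
have P0 : 0 < \prod_(j < n) @jap R (m j) ^+ p.+1.
  by apply: prodr_gt0 => j _; rewrite exprn_gt0 // jap_gt0.
have E : mode b m f x = ((\prod_j jap (m j) ^+ p.+1)^-1)%:C%C * mode b m L x.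
  rewrite mL big_enum /= mulrA -rmorphM /= mulVf ?mul1r //.
  by rewrite gt_eqF.
rewrite E mulrA; apply: le_trans (cnormM _ _) _.
rewrite [leRHS]mulrA; apply: ler_pM; rewrite ?cnorm_ge0 //.
apply: le_trans (cnormM _ _) _; rewrite cnorm_real ger0_norm; last first.
  by rewrite invr_ge0; exact: ltW.
apply: (@le_trans _ _ (C * (\prod_j jap (m j) ^+ p) * (\prod_j jap (m j) ^+ p.+1)^-1)).
  by apply: ler_wpM2r; [rewrite invr_ge0; exact: ltW | exact: aC].
rewrite le_eqVlt; apply/orP; left; apply/eqP; rewrite -prodfV -mulrA mulrC.
congr (_ * _); rewrite -big_split /=; apply: eq_bigr => j _.
have j0 : jap (m j) != 0 :> R by rewrite gt_eqF // jap_gt0.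
by rewrite exprS invfM mulrCA divff ?mulr1 // expf_neq0.
Qed.

Lemma smooth_multiplier_term f i : smooth f -> smooth (multiplier_term f i).
Proof.
move=> sf; rewrite /multiplier_term; case: pickle_inv => [m|] /=.
  by apply: smoothZ; exact: smooth_mode.
exact: smooth_cst.
Qed.

Lemma deriveC_multiplier_term f i x v : smooth f ->
  deriveC (multiplier_term f i) x v = multiplier_term (fun x => deriveC f x v) i x.
Proof.
move=> sf; rewrite /multiplier_term; case: pickle_inv => [m|] /=.
  by rewrite deriveCZ ?deriveC_mode //; exact: smooth_mode.
exact: deriveC_cst.
Qed.

Lemma ccontinuous_multiplier f : smooth f -> periodic b f ->
  ccontinuous (multiplier f).
Proof.
move=> sf pf; have [G cG bG] := multiplier_term_bound sf pf.
apply: (ccontinuous_csum cvgn_jap_weight bG cG) => i.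
exact/smooth_ccontinuous/smooth_multiplier_term.
Qed.

Lemma smooth_multiplier f : smooth f -> periodic b f -> smooth (multiplier f).
Proof.
move=> sf pf; apply: (@smooth_coind _ _ (fun g =>
  exists f, [/\ smooth f, periodic b f & g = multiplier f])); last by exists f.
move=> _ [g [sg pg ->]]; split; first exact: ccontinuous_multiplier.
move=> v; have sg' := smooth_deriveC v sg; have pg' := periodic_deriveC v sg pg.
exists (multiplier (fun x => deriveC g x v)).
  by exists (fun x => deriveC g x v).
have [G cG bG] := multiplier_term_bound sg pg.
have [G' cG' bG'] := multiplier_term_bound sg' pg'.
apply: (is_deriveC_csum cvgn_jap_weight jap_weight_ge0 bG bG' cG cG').
  by move=> i; exact/smooth_ccontinuous/smooth_multiplier_term.
move=> i x; rewrite -deriveC_multiplier_term //.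
exact/smooth_is_deriveC/smooth_multiplier_term.
Qed.

Lemma periodic_multiplier f : smooth f -> periodic b f -> periodic b (multiplier f).
Proof.
move=> sf pf j x; rewrite /multiplier /csum.
suff E i : multiplier_term f i (x + b j) = multiplier_term f i x.
  by congr (limn _ +i* limn _)%C; apply/funext => N; apply: eq_bigr => i _;
    rewrite E.
rewrite /multiplier_term; case: pickle_inv => //= m; congr (_ * _).
by apply: periodic_mode_seq => //; exact: smooth_ccontinuous.
Qed.

(** Partial sums containing the index of [m] already have the right mode by orthogonality, and
    [mode] respects locally uniform bounds through [abs_mode_seq]. *)
Lemma mode_multiplier f m x : smooth f -> periodic b f ->
  mode b m (multiplier f) x = a m * mode b m f x.
Proof.
move=> sf pf; have [G cG bG] := multiplier_term_bound sf pf.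
have T := csum_tail cvgn_jap_weight bG.
have cM := ccontinuous_multiplier sf pf.
have ct i := smooth_ccontinuous (smooth_multiplier_term i sf).
have cS N : ccontinuous (fun x => \sum_(0 <= i < N) multiplier_term f i x).
  exact: ccontinuous_sum.
have cSN N : ccontinuous (fun x => -1 * \sum_(0 <= i < N) multiplier_term f i x).
  by apply: ccontinuousM => //; exact: ccontinuous_cst.
(* A finite-function copy of [m]: only these are countable and have a code. *)
pose m' : {ffun 'I_n -> int} := [ffun j => m j].
have m'E : (m' : 'I_n -> int) = m by apply/funext => j; rewrite ffunE.
have S N : (pickle m' < N)%N ->
    mode b m (fun x => \sum_(0 <= i < N) multiplier_term f i x) x = a m * mode b m f x.
  move=> mN; rewrite /mode mode_seq_sum //.
  rewrite (bigD1_seq (pickle m')) ?mem_index_iota ?iota_uniq //=.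
  rewrite [X in _ + X]big1 ?addr0 => [|i im].
    rewrite /multiplier_term pickleK_inv /= mode_seqZ; last first.
      exact/smooth_ccontinuous/smooth_mode.
    rewrite m'E -/(mode b m (mode b m f) x) mode_mode //.
    by case: ifPn => // /forallP[] j.
  rewrite /multiplier_term; case E : (pickle_inv i) => [k|] /=; last exact: mode_seq0.
  rewrite mode_seqZ; last exact/smooth_ccontinuous/smooth_mode.
  rewrite -/(mode b m (mode b k f) x) mode_mode //.
  case: ifPn => [/forallP mk|_]; last by rewrite mulr0.
  have km : k = m' by apply/ffunP => j; rewrite ffunE (eqP (mk j)).
  have := @pickle_invK {ffun 'I_n -> int} i; rewrite E /= km => Ei.
  by rewrite Ei eqxx in im.
apply/eqP; rewrite -subr_eq0; apply/eqP/cnorm_le0.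
apply: (le_cvg0 (cvg_tail cvgn_jap_weight) (c := abs_mode_seq b (enum 'I_n) G x)).
near=> N.
have mN : (pickle m' < N)%N by near: N; exists (pickle m').+1.
rewrite -(S N mN) -mulN1r -mode_seqZ // -mode_seqD // mulrC.
set t := 2 * _; rewrite mulrC -abs_mode_seqZ //; apply: cnorm_mode_seq.
- exact: ccontinuousD.
- by move=> y; apply: cvgM; [exact: cvg_cst | exact: cG].
- by move=> y; rewrite mulN1r; exact: T.
Unshelve. all: end_near. Qed.


End Multipliers.

(** * Small divisors from the norm of a number field *)

Section DirectionLinear.
Context {R : realType} {V : normedModType R}.
Implicit Types (f : V -> R[i]) (x v w : V).

Lemma is_derive_at0 (f : V -> R) x v (d : R) :
  is_derive (0 : R) (1 : R) (fun t => f (x + t *: v)) d -> is_derive x v f d.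
Proof.
have E : (fun h : R => h^-1 *: (((fun k => f (x + k *: v)) \o shift 0) (h *: 1)
    - f (x + 0 *: v))) =
  (fun h : R => h^-1 *: ((f \o shift x) (h *: v) - f x)).
  apply/funext => h /=; congr (_ *: (f _ - f _)).
    by rewrite [h *: 1]mulr1 addr0 addrC.
  by rewrite scale0r addr0.
by move=> [a1 a2]; rewrite /derivable /derive E in a1 a2; split.
Qed.

Lemma is_deriveC_at0 f x v d :
  is_deriveC (0 : R) (1 : R) (fun t => f (x + t *: v)) d -> is_deriveC x v f d.
Proof.
by move=> [a b]; split; [exact: (is_derive_at0 (f := fun y => complex.Re (f y)))
  | exact: (is_derive_at0 (f := fun y => complex.Im (f y)))].
Qed.

Lemma is_deriveC_dirZ f x v (a : R) : smooth f ->
  is_deriveC x (a *: v) f (a%:C%C * deriveC f x v).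
Proof.
move=> sf; apply: is_deriveC_at0.
have := @is_deriveC_scale R (fun k => f (x + k *: v))
  (fun k => deriveC f (x + k *: v) v) a 0.
rewrite mulr0 scale0r addr0.
rewrite (_ : (fun t : R => f (x + t *: (a *: v))) = fun t => f (x + (a * t) *: v)).
  by apply=> k; apply: is_deriveC_line; exact: smooth_is_deriveC.
by apply/funext => t; rewrite scalerA mulrC.
Qed.

(** [smooth] speaks only of single directions, so additivity in the direction needs an argument:
    move by [h w], then by [h v]. The second increment is [h] times an integral of [dv], which
    converges to [dv x] by continuity. *)
Lemma is_derive_dirD (f dv dw : V -> R) x v w : continuous dv ->
  (forall y, is_derive y v f (dv y)) -> is_derive x w f (dw x) ->
  is_derive x (v + w) f (dv x + dw x).
Proof.
move=> cv hv [hw1 hw2].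
have cl : continuous (fun p : R * R => dv (x + p.1 *: w + (p.1 * p.2) *: v)).
  move=> p; apply: (@continuous_comp _ _ _
    (fun p : R * R => x + p.1 *: w + (p.1 * p.2) *: v) dv); last exact: cv.
  apply: cvgD; last by apply: cvgZr_tmp; apply: cvgM; [exact: cvg_fst | exact: cvg_snd].
  by apply: cvgD; [exact: cvg_cst | apply: cvgZr_tmp; exact: cvg_fst].
have := @continuous_int01 R R^o (fun h t => dv (x + h *: w + (h * t) *: v)) cl 0.
rewrite /continuous_at [X in _ --> X](_ : _ = dv x); last first.
  rewrite -[RHS]int01_cst; apply: eq_int01 => t _.
  by rewrite mul0r !scale0r !addr0.
move=> L.
have L' := cvg_trans (cvg_app _ (@nbhs_dnbhs _ (0 : R))) L.
have lim : (fun k : R => k^-1 *: ((f \o shift x) (k *: (v + w)) - f x)) @ 0^' -->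
    dv x + dw x.
  apply: (@cvg_trans _ ((fun h => int01 (fun t => dv (x + h *: w + (h * t) *: v)) +
      h^-1 *: ((f \o shift x) (h *: w) - f x)) @ 0^')); last first.
    by apply: cvgD L' _; rewrite -hw2; exact: hw1.
  apply: near_eq_cvg; near=> k.
  have k0 : k != 0 by near: k; exact: nbhs_dnbhs_neq.
  have dl (t : R) : is_derive t (1 : R) (fun t => f (x + k *: w + (k * t) *: v))
      (k * dv (x + k *: w + (k * t) *: v)).
    have dh : is_derive t (1 : R) (fun t : R => k * t) k.
      by apply: is_derive_eq; rewrite /GRing.scale /= mulr1.
    have h : is_derive (k * t) (1 : R) (fun t => f (x + k *: w + t *: v))
        (dv (x + k *: w + (k * t) *: v)).
      by have [h1 <-] := hv (x + k *: w + (k * t) *: v); exact: is_derive_line.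
    by apply: (is_derive_eq (is_derive1_comp h dh)); rewrite /GRing.scale /= mulrC.
  have cs : continuous (fun t => dv (x + k *: w + (k * t) *: v)).
    exact: (@section_continuous R R^o (fun h t => dv (x + h *: w + (h * t) *: v)) k cl).
  have := @int01_derive R _ (fun t => k * dv (x + k *: w + (k * t) *: v)) _ dl.
  rewrite int01Zl // mulr1 mulr0 scale0r addr0 => H.
  have -> : int01 (fun t => dv (x + k *: w + (k * t) *: v)) =
      k^-1 * (f (x + k *: w + k *: v) - f (x + k *: w)).
    rewrite -H ?mulKf // => t; apply: cvgM; [exact: cvg_cst | exact: cs].
  rewrite /= /GRing.scale /= -mulrDr; congr (_ * _).
  rewrite [k *: w + x]addrC (_ : k *: (v + w) + x = x + k *: w + k *: v).
    by rewrite addrA subrK.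
  by rewrite scalerDr addrC addrAC addrA.
by split; [apply/cvg_ex; eexists; exact: lim | exact: cvg_lim lim].
Unshelve. all: end_near. Qed.

Lemma is_deriveC_dirD f x v w : smooth f ->
  is_deriveC x (v + w) f (deriveC f x v + deriveC f x w).
Proof.
move=> sf; have [cr ci] := smooth_ccontinuous (smooth_deriveC v sf).
split; rewrite reimE.
  apply: (@is_derive_dirD (fun y => complex.Re (f y)) (fun y => complex.Re (deriveC f y v))
    (fun y => complex.Re (deriveC f y w))) => // [y|].
    by have [] := smooth_is_deriveC y v sf.
  by have [] := smooth_is_deriveC x w sf.
apply: (@is_derive_dirD (fun y => complex.Im (f y)) (fun y => complex.Im (deriveC f y v))
  (fun y => complex.Im (deriveC f y w))) => // [y|].
  by have [] := smooth_is_deriveC y v sf.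
by have [] := smooth_is_deriveC x w sf.
Qed.

Lemma deriveC_dirD f x v w : smooth f ->
  deriveC f x (v + w) = deriveC f x v + deriveC f x w.
Proof. by move=> sf; exact/is_deriveC_val/is_deriveC_dirD. Qed.

Lemma deriveC_dirZ f x (a : R) v : smooth f ->
  deriveC f x (a *: v) = a%:C%C * deriveC f x v.
Proof. by move=> sf; exact/is_deriveC_val/is_deriveC_dirZ. Qed.

Lemma deriveC_dir0 f x : smooth f -> deriveC f x 0 = 0.
Proof. by move=> sf; rewrite -(scale0r 0) deriveC_dirZ // mul0r. Qed.

Lemma deriveC_dir_sum (I : Type) (r : seq I) (a : I -> R) (v : I -> V) f x : smooth f ->
  deriveC f x (\sum_(i <- r) a i *: v i) = \sum_(i <- r) (a i)%:C%C * deriveC f x (v i).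
Proof.
move=> sf; elim: r => [|i r IH]; first by rewrite !big_nil deriveC_dir0.
by rewrite !big_cons deriveC_dirD // deriveC_dirZ // IH.
Qed.

End DirectionLinear.

(** * Norm, trace and dual lattice of a number field *)

Section NumberFieldBasis.
Context {R : realType} {K : fieldExtType rat} {N : nat}.
Variable sigma : 'I_N -> {rmorphism K -> R[i]}.
Hypothesis sigma_inj : forall i j, sigma i =1 sigma j -> i = j.

(** Dedekind's argument: for [y] separating two embeddings, the relation at [y * x] minus
    [sigma i0 y] times the relation at [x] loses the term [i0], and induction on the number of
    nonzero coefficients applies. *)
Lemma embeddings_independent (c : 'I_N -> R[i]) :
  (forall x, \sum_i c i * sigma i x = 0) -> forall i, c i = 0.
Proof.
have [n] := ubnP #|[pred i | c i != 0]|; elim: n => // n IH in c * => cn H i0.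
have [//|ci0] := eqVneq (c i0) 0.
have H1 i1 : i1 != i0 -> c i1 = 0.
  move=> i10; have [y yP] : exists y, sigma i1 y != sigma i0 y.
    apply: contrapT => nex; move: i10; apply/negP; rewrite negbK; apply/eqP.
    apply: sigma_inj => y; apply/eqP; apply: contrapT => /negP ny.
    by apply: nex; exists y.
  have : c i1 * (sigma i1 y - sigma i0 y) = 0.
    apply: (IH (fun i => c i * (sigma i y - sigma i0 y))).
      apply: (@leq_trans #|[pred i | c i != 0]|); last by rewrite -ltnS.
      apply: proper_card; apply/properP; split.
        by apply/fintype.subsetP => i; rewrite !inE mulf_eq0 negb_or => /andP[].
      by exists i0; rewrite !inE // subrr mulr0 eqxx.
    move=> x; transitivity (\sum_i c i * sigma i (y * x) -
        sigma i0 y * \sum_i c i * sigma i x); last by rewrite !H mulr0 subrr.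
    rewrite mulr_sumr -sumrB; apply: eq_bigr => i _.
    by rewrite rmorphM /=; ring.
  by move/eqP; rewrite mulf_eq0 subr_eq0 (negPf yP) orbF => /eqP.
have := H 1; rewrite (bigD1 i0) //= big1 ?addr0 => [|i /H1 ->]; last by rewrite mul0r.
by rewrite rmorph1 mulr1.
Qed.

Lemma common_denominator (I : finType) (f : I -> rat) :
  exists2 D : nat, (0 < D)%N & forall i, exists z : int, D%:R * f i = z%:~R.
Proof.
exists (\prod_i `|denq (f i)|)%N; first by apply: prodn_gt0 => i; rewrite absz_gt0 denq_neq0.
move=> i; exists ((\prod_(j | j != i) `|denq (f j)|)%N%:Z * numq (f i)).
rewrite (bigD1 i) //= natrM rmorphM /= mulrC mulrA [f i * _](_ : _ = (numq (f i))%:~R).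
  by rewrite mulrC.
rewrite -{1}[f i]divq_num_den -[_%:R]/((absz (denq (f i)))%:Z%:~R) absz_denq.
by rewrite divfK // intr_eq0 denq_neq0.
Qed.

Hypothesis dimK : \dim {:K} = N.

(** Scaling a rational basis by a common denominator [D] of its structure constants multiplies these
    constants by [D]. The span is a sublattice of the ring of integers, and periodicity under the
    latter restricts to it. *)
Lemma integral_structure_basis : exists (b : 'I_N -> K) (B : 'I_N -> 'M[int]_N),
  (forall x : K, exists c : 'I_N -> rat, x = \sum_j c j *: b j) /\
  forall i j, b i * b j = \sum_k (B i k j)%:~R * b k.
Proof.
have [e eE] : exists e : N.-tuple K, basis_of fullv e.
  by rewrite -dimK; exists (vbasis fullv); exact: vbasisP.
have es x : x = \sum_j coord e j x *: e`_j.
  by apply: coord_basis eE _; exact: memvf.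
pose f (u : 'I_N * 'I_N * 'I_N) := coord e u.2 (e`_u.1.1 * e`_u.1.2).
have [D D0 fD] := common_denominator f.
have D0' : D%:R != 0 :> rat by rewrite pnatr_eq0 -lt0n.
have /choice [z zP] : forall u, exists z : int, D%:R * f u = z%:~R by exact: fD.
exists (fun j => D%:R *: e`_j), (fun i => \matrix_(k, j) z (i, j, k)); split.
  move=> x; exists (fun j => coord e j x / D%:R); rewrite {1}(es x).
  by apply: eq_bigr => j _; rewrite scalerA divfK.
move=> i j; rewrite -scalerAl -scalerAr {1}(es (e`_i * e`_j)) !scaler_sumr.
apply: eq_bigr => k _; rewrite mxE !scalerA -mulrA -[coord e k _]/(f (i, j, k)) zP.
by rewrite [D%:R * _]mulrC -scalerA scaler_int mulrzl.
Qed.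

Variables (b : 'I_N -> K) (B : 'I_N -> 'M[int]_N).
Hypothesis b_span : forall x : K, exists c : 'I_N -> rat, x = \sum_j c j *: b j.
Hypothesis bB : forall i j, b i * b j = \sum_k (B i k j)%:~R * b k.

Lemma structure_basis_neq0 : exists j, b j != 0.
Proof.
apply: contrapT => nb; have [c] := b_span 1.
rewrite big1 => [/eqP|j _]; first by rewrite oner_eq0.
have [->|bj] := eqVneq (b j) 0; first by rewrite scaler0.
by case: nb; exists j.
Qed.

(** [b j] is an eigenvalue of the integer matrix [B j], with the row of all [b k] as eigenvector,
    hence a root of its characteristic polynomial. *)
Lemma structure_basis_integral j : ring_of_integers (b j).
Proof.
have [k bk] := structure_basis_neq0.
exists (char_poly (B j)); first exact: char_poly_monic.
rewrite map_char_poly -eigenvalue_root_char; apply/eigenvalueP.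
exists (\row_k b k).
  apply/rowP => l; rewrite !mxE bB; apply: eq_bigr => i _.
  by rewrite !mxE mulrC.
by apply/eqP => /rowP/(_ k); rewrite !mxE; exact/eqP.
Qed.

Definition embedding_mx : 'M[R[i]]_N := \matrix_(i, j) sigma i (b j).

Lemma sigma_ratZ i (q : rat) x : sigma i (q *: x) = ratr q * sigma i x.
Proof.
by rewrite -mulr_algl rmorphM /= -[sigma i q%:A]/((sigma i \o in_alg K) q) fmorph_eq_rat.
Qed.

Lemma embedding_mx_unit : embedding_mx \in unitmx.
Proof.
rewrite -row_free_unit; apply: inj_row_free => v vS.
apply/rowP => i; rewrite mxE; apply: (embeddings_independent (c := fun i => v 0 i)) => x.
have [c ->] := b_span x.
under eq_bigr do rewrite raddf_sum /= mulr_sumr.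
rewrite exchange_big /= big1 // => j _.
have /rowP/(_ j) := vS; rewrite !mxE => E.
transitivity (ratr (c j) * \sum_k v 0 k * embedding_mx k j); last by rewrite E mulr0.
rewrite mulr_sumr; apply: eq_bigr => k _.
by rewrite mxE sigma_ratZ mulrCA.
Qed.

Definition int_mx (M : 'M[int]_N) : 'M[R[i]]_N := map_mx intr M.

(** The embeddings diagonalise all multiplications simultaneously; norm and trace are read off from
    the integer side. *)
Lemma embedding_mx_mul (c : 'I_N -> int) :
  let g := \sum_l (c l)%:~R * b l in
  diag_mx (\row_i sigma i g) *m embedding_mx =
  embedding_mx *m int_mx (\sum_l c l *: B l).
Proof.
move=> g; apply/matrixP => i j; rewrite mul_diag_mx !mxE -rmorphM /=.
have -> : g * b j = \sum_k ((\sum_l c l *: B l) k j)%:~R * b k.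
  rewrite mulr_suml; under [RHS]eq_bigr do rewrite summxE raddf_sum /= mulr_suml.
  rewrite exchange_big /=; apply: eq_bigr => l _.
  rewrite -mulrA bB mulr_sumr; apply: eq_bigr => k _.
  by rewrite mxE rmorphM /= mulrA.
rewrite raddf_sum /=; apply: eq_bigr => k _.
by rewrite rmorphM /= rmorph_int !mxE mulrC.
Qed.

Lemma norm_int (c : 'I_N -> int) :
  let g := \sum_l (c l)%:~R * b l in
  \prod_i sigma i g = (\det (\sum_l c l *: B l))%:~R.
Proof.
move=> g; have := congr1 determinant (embedding_mx_mul c).
rewrite !det_mulmx det_diag mulrC.
have S0 : \det embedding_mx != 0 by have := embedding_mx_unit; rewrite unitmxE unitfE.
move/(mulfI S0); rewrite /int_mx det_map_mx => <-.
by apply: eq_bigr => i _; rewrite mxE.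
Qed.

Lemma trace_int k : \sum_i sigma i (b k) = (\tr (B k))%:~R.
Proof.
have := embedding_mx_mul (fun l => (l == k)%:Z).
have -> : \sum_l ((l == k)%:Z)%:~R * b l = b k.
  rewrite (bigD1 k) //= eqxx mul1r big1 ?addr0 // => l /negPf ->.
  by rewrite mul0r.
have -> : \sum_l (l == k)%:Z *: B l = B k.
  rewrite (bigD1 k) //= eqxx scale1r big1 ?addr0 // => l /negPf ->.
  by rewrite scale0r.
move=> E; have S1 := embedding_mx_unit.
have -> : (\tr (B k))%:~R = \tr (int_mx (B k)).
  by rewrite /mxtrace raddf_sum /=; apply: eq_bigr => i _; rewrite mxE.
have -> : int_mx (B k) = invmx embedding_mx *m (diag_mx (\row_i sigma i (b k)) *m embedding_mx).
  by rewrite E mulmxA mulVmx // mul1mx.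
rewrite mxtrace_mulC -mulmxA mulmxV // mulmx1 mxtrace_diag.
by apply: eq_bigr => i _; rewrite mxE.
Qed.

(** The Gram matrix of the trace form in the basis [b]. *)
Definition trace_mx : 'M[int]_N := \matrix_(j, l) \sum_k B j k l * \tr (B k).

Lemma trace_mxE : int_mx trace_mx = embedding_mx^T *m embedding_mx.
Proof.
apply/matrixP => j l; rewrite !mxE raddf_sum /=.
under [RHS]eq_bigr do rewrite !mxE -rmorphM /= bB raddf_sum /=.
rewrite exchange_big /=; apply: eq_bigr => k _.
rewrite rmorphM /= -trace_int mulr_sumr; apply: eq_bigr => i _.
by rewrite rmorphM /= rmorph_int.
Qed.

(* A nonzero vector of the dual lattice is the image of a nonzero algebraic number
   with bounded denominator, and the norm of the latter bounds each of its
   conjugates away from zero. *)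
Lemma dual_lattice_bound : exists C p, forall m : 'I_N -> int, m <> (fun=> 0) -> forall i,
  let r := \sum_j (m j)%:~R * invmx embedding_mx j i in
  r != 0 /\ cnorm r^-1 <= C * \prod_j (@jap R (m j)) ^+ p.
Proof.
have S1 := embedding_mx_unit.
pose Tq : 'M[rat]_N := map_mx intr trace_mx.
have TqE : map_mx ratr Tq = embedding_mx^T *m embedding_mx.
  by rewrite -trace_mxE; apply/matrixP => i j; rewrite !mxE ratr_int.
have Tu : (map_mx ratr Tq : 'M[R[i]]_N) \in unitmx by rewrite TqE unitmx_mul unitmx_tr S1.
(* [D] clears the denominators of the inverse trace form, which turns the dual basis into
   coordinates in the basis [b]. *)
have [D D0 /choice[z zP]] := common_denominator (fun u : 'I_N * 'I_N => invmx Tq u.1 u.2).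
pose Z : 'M[int]_N := \matrix_(i, j) z (i, j).
have ZE : int_mx Z = D%:R *: (invmx embedding_mx *m (invmx embedding_mx)^T).
  have -> : invmx embedding_mx *m (invmx embedding_mx)^T = map_mx ratr (invmx Tq).
    have SSu : embedding_mx^T *m embedding_mx \in unitmx.
      by rewrite unitmx_mul unitmx_tr S1.
    rewrite map_invmx TqE; apply: (can_inj (mulKmx SSu)); rewrite mulmxV //.
    rewrite -mulmxA [embedding_mx *m _]mulmxA mulmxV // mul1mx.
    by rewrite -trmx_mul mulVmx // trmx1.
  apply/matrixP => i j; rewrite !mxE -ratr_int -zP rmorphM /=.
  by rewrite ratr_nat.
have D0' : D%:R != 0 :> R[i] by rewrite pnatr_eq0 -lt0n.
(* A bound on all conjugates of the dual basis, scaled by [D]. *)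
pose W := \sum_(j < N) \sum_(i < N) cnorm (D%:R * invmx embedding_mx j i).
have W0 : 0 <= W by apply: sumr_ge0 => j _; apply: sumr_ge0 => i _; exact: cnorm_ge0.
exists (cnorm (D%:R : R[i]) * W ^+ N.-1), N.-1 => m m0 i r.
(* Integer coordinates of [g], the algebraic integer whose conjugates are [D] times the entries of
   [m] times the inverse embedding matrix. *)
pose c l := \sum_j m j * Z j l.
pose g := \sum_l (c l)%:~R * b l.
have gE i' : sigma i' g = D%:R * \sum_j (m j)%:~R * invmx embedding_mx j i'.
  rewrite raddf_sum /= mulr_sumr.
  transitivity ((\row_j (m j)%:~R *m int_mx Z *m embedding_mx^T) 0 i').
    rewrite mxE; apply: eq_bigr => l _; rewrite rmorphM /= rmorph_int !mxE.
    congr (_ * _); rewrite raddf_sum /=; apply: eq_bigr => j _.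
    by rewrite !mxE rmorphM.
  rewrite ZE -scalemxAr -scalemxAl -!mulmxA -trmx_mul mulmxV // trmx1 mulmx1.
  by rewrite !mxE mulr_sumr; apply: eq_bigr => j _; rewrite !mxE mulrCA.
have g0 : g != 0.
  apply/eqP => g0; apply: m0; apply/funext => j.
  have rz : \row_j (m j)%:~R *m invmx embedding_mx = 0 :> 'rV[R[i]]_N.
    apply/rowP => i'; have := gE i'; rewrite g0 rmorph0 => /esym/eqP.
    rewrite mulf_eq0 (negPf D0') /= => /eqP E; rewrite !mxE -[RHS]E.
    by apply: eq_bigr => k _; rewrite mxE.
  have := congr1 (mulmx^~ embedding_mx) rz; rewrite /= mulmxKV // mul0mx.
  by move/rowP/(_ j); rewrite !mxE => /eqP; rewrite intr_eq0 => /eqP.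
have sg0 i' : sigma i' g != 0 by rewrite fmorph_eq0.
have r0 : r != 0 by have := sg0 i; rewrite gE mulf_eq0 negb_or => /andP[].
split=> //.
pose z0 := \det (\sum_l c l *: B l).
have nE : \prod_i sigma i g = z0%:~R by exact: norm_int.
have z00 : z0 != 0.
  by rewrite -(intr_eq0 R[i]) -nE; apply/prodf_neq0 => i' _.
(* The norm [z0] of [g] is [D * r] times the other conjugates, so inverting [r] costs only those
   conjugates. *)
have rE : r^-1 = D%:R * (\prod_(i' | i' != i) sigma i' g) * (z0%:~R)^-1.
  have -> : z0%:~R = D%:R * r * \prod_(i' | i' != i) sigma i' g.
    by rewrite -nE (bigD1 i) //=; congr (_ * _); exact: gE.
  have : \prod_(i' | i' != i) sigma i' g != 0 by apply/prodf_neq0 => i' _.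
  by move: (\prod_(_ | _) _) => P P0; field; rewrite D0' P0 r0.
(* A nonzero integer has absolute value at least 1. *)
have zn : cnorm (z0%:~R : R[i])^-1 <= 1.
  have -> : (z0%:~R : R[i])^-1 = (z0%:~R^-1 : R)%:C%C.
    by rewrite fmorphV /= rmorph_int.
  rewrite cnorm_real normfV invf_le1 ?normr_gt0 ?intr_eq0 // -intr_norm ler1z.
  by rewrite -gtz0_ge1 normr_gt0.
rewrite rE; apply: le_trans (cnormM _ _) _.
rewrite -[leRHS]mulr1; apply: ler_pM; rewrite ?cnorm_ge0 //.
apply: le_trans (cnormM _ _) _; rewrite -mulrA; apply: ler_wpM2l; first exact: cnorm_ge0.
have J1 (P : pred 'I_N) : 1 <= \prod_(j | P j) @jap R (m j).
  apply: (big_ind (fun x => 1 <= x)) => [//|x y x1 y1|j _]; last exact: jap_ge1.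
  exact: mulr_ege1.
(* There are [N.-1] other conjugates, each linear in [m]; this is the origin of the exponent
   [N.-1]. *)
apply: (@le_trans _ _ (\prod_(i' < N | i' != i) (W * \prod_j jap (m j)))); last first.
  rewrite prodr_const (_ : #|_| = N.-1) ?exprMn -?prodrXl //.
  by rewrite -[in RHS](card_ord N) cardC1.
apply: le_trans (cnorm_prod _ _ _) _; apply: ler_prod => i' _.
rewrite cnorm_ge0 /= gE mulr_sumr; apply: le_trans (cnorm_sum _ _ _) _.
rewrite /W mulr_suml; apply: ler_sum => j _.
rewrite mulrCA; apply: le_trans (cnormM _ _) _; rewrite mulrC; apply: ler_pM; rewrite ?cnorm_ge0 //.
  by rewrite (bigD1 i') //= lerDl; apply: sumr_ge0 => k _; exact: cnorm_ge0.
apply: (@le_trans _ _ (jap (m j))).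
  have -> : (m j)%:~R = ((m j)%:~R : R)%:C%C by rewrite rmorph_int.
  rewrite cnorm_real /jap -real_normK ?num_real // expr2.
  by have := normr_ge0 ((m j)%:~R : R); nra.
rewrite (bigD1 j) //= ler_peMr //; first by rewrite ltW // jap_gt0.
Qed.

End NumberFieldBasis.

Section ModeAlgebra.
Context {R : realType} {V : normedModType R} {n : nat} (b : 'I_n -> V).
Implicit Types (f g : V -> R[i]) (x : V) (m : 'I_n -> int).

Lemma modeD m f g x : smooth f -> smooth g ->
  mode b m (fun x => f x + g x) x = mode b m f x + mode b m g x.
Proof. by move=> sf sg; apply: mode_seqD; exact: smooth_ccontinuous. Qed.

Lemma modeM m (c : V -> R[i]) f x : smooth f ->
  (forall j x (t : R), c (x + t *: b j) = c x) ->
  mode b m (fun x => c x * f x) x = c x * mode b m f x.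
Proof. by move=> sf cb; apply: mode_seqM => //; exact: smooth_ccontinuous. Qed.

End ModeAlgebra.

(** * Inverting a constant-coefficient derivation on a torus *)

Section SmallDivisors.
Context {R : realType} {V : normedModType R} {n : nat} (b : 'I_n -> V).
Variable W : 'I_n -> R[i].
Implicit Types (f g : V -> R[i]) (x v : V) (m : 'I_n -> int).

Definition cderive f x : R[i] := \sum_j W j * deriveC f x (b j).

Definition divisor_at m : R[i] := \sum_j W j * freq (m j).

Variables (C : R) (p : nat).
Hypothesis divisor_bound : forall m, m <> (fun=> 0) ->
  divisor_at m != 0 /\ cnorm (divisor_at m)^-1 <= C * \prod_j (@jap R (m j)) ^+ p.

Definition mean f := mode b (fun=> 0) f.

(** The value 0 at the zero frequency, where the divisor vanishes, gives primitives of mean zero and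
    makes them unique. *)
Definition inv_divisor m : R[i] :=
  if [forall j, m j == 0] then 0 else (divisor_at m)^-1.

Definition antiderive2 f := multiplier b (fun m => inv_divisor m * inv_divisor m) f.

(* Applying [cderive] to a second antiderivative, instead of using the multiplier
   [inv_divisor] at once, makes the equivariance below follow from uniqueness. *)
Definition antiderive f := cderive (antiderive2 f).

Definition flat f := forall j x, deriveC f x (b j) = 0.

Lemma smooth_cderive f : smooth f -> smooth (cderive f).
Proof.
by move=> sf; apply: smooth_sum => j _; apply: smoothZ; exact: smooth_deriveC.
Qed.

Lemma periodic_cderive f : smooth f -> periodic b f -> periodic b (cderive f).
Proof.
move=> sf pf j x; apply: eq_bigr => k _; congr (_ * _).
exact: (periodic_deriveC (b k) sf pf).
Qed.

Lemma mode_cderive m f x : smooth f -> periodic b f ->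
  mode b m (cderive f) x = divisor_at m * mode b m f x.
Proof.
move=> sf pf; have cf' j : ccontinuous (fun x => deriveC f x (b j)).
  by apply: smooth_ccontinuous; exact: smooth_deriveC.
rewrite /mode mode_seq_sum => [|j].
  rewrite mulr_suml; apply: eq_bigr => j _.
  rewrite mode_seqZ // -[mode_seq _ _ _ _ _]/(mode b m _ x) -deriveC_mode //.
  by rewrite deriveC_mode_freq // mulrA.
by apply: ccontinuousM => //; exact: ccontinuous_cst.
Qed.

Lemma inv_divisor_bound m : cnorm (inv_divisor m * inv_divisor m) <=
  C ^+ 2 * \prod_j (@jap R (m j)) ^+ (p * 2).
Proof.
have P0 : 0 <= \prod_(j < n) @jap R (m j) ^+ (p * 2).
  by apply: prodr_ge0 => j _; rewrite exprn_ge0 // ltW // jap_gt0.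
rewrite /inv_divisor; case: ifPn => [_|/forallP m0].
  by rewrite mul0r cnorm0 mulr_ge0 // sqr_ge0.
have [|_ h] := @divisor_bound m; first by move=> E; apply: m0 => j; rewrite E.
apply: le_trans (cnormM _ _) _.
apply: le_trans (ler_pM _ _ h h) _; rewrite ?cnorm_ge0 // mulrACA -expr2.
apply: ler_wpM2l; first exact: sqr_ge0.
by rewrite -big_split /=; under eq_bigr do rewrite -exprD addnn -muln2.
Qed.

Lemma smooth_antiderive2 f : smooth f -> periodic b f -> smooth (antiderive2 f).
Proof. by move=> sf pf; exact: (smooth_multiplier inv_divisor_bound sf pf). Qed.

Lemma periodic_antiderive2 f : smooth f -> periodic b f -> periodic b (antiderive2 f).
Proof. by move=> sf pf; exact: periodic_multiplier. Qed.

Lemma mode_antiderive2 m f x : smooth f -> periodic b f ->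
  mode b m (antiderive2 f) x = inv_divisor m * inv_divisor m * mode b m f x.
Proof. by move=> sf pf; exact: (mode_multiplier inv_divisor_bound). Qed.

Lemma smooth_antiderive f : smooth f -> periodic b f -> smooth (antiderive f).
Proof. by move=> sf pf; apply: smooth_cderive; exact: smooth_antiderive2. Qed.

Lemma periodic_antiderive f : smooth f -> periodic b f -> periodic b (antiderive f).
Proof.
by move=> sf pf; apply: periodic_cderive; [exact: smooth_antiderive2
  | exact: periodic_antiderive2].
Qed.

Lemma divisor_inv m : divisor_at m * inv_divisor m = (~~ [forall j, m j == 0])%:R.
Proof.
rewrite /inv_divisor; case: ifPn => [_|m0]; first by rewrite mulr0.
have [|h _] := @divisor_bound m; last by rewrite divff.
by move=> E; apply: (negP m0); apply/forallP => j; rewrite E.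
Qed.

Lemma mode_antiderive m f x : smooth f -> periodic b f ->
  mode b m (antiderive f) x = inv_divisor m * mode b m f x.
Proof.
move=> sf pf; rewrite mode_cderive; [|exact: smooth_antiderive2|exact: periodic_antiderive2].
rewrite mode_antiderive2 // !mulrA divisor_inv /inv_divisor.
by case: ifP => _; rewrite ?mul0r // mul1r.
Qed.

Lemma antiderive_unique f g : smooth f -> periodic b f -> smooth g ->
  (forall m x, mode b m g x = inv_divisor m * mode b m f x) -> g = antiderive f.
Proof.
move=> sf pf sg gf; apply: (@mode_inj _ _ _ b).
- exact: smooth_ccontinuous.
- exact/smooth_ccontinuous/smooth_antiderive.
- by move=> m x; rewrite mode_antiderive.
Qed.

Lemma smooth_mean f : smooth f -> smooth (mean f).
Proof. exact: smooth_mode. Qed.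

Lemma flat_mean f : smooth f -> periodic b f -> flat (mean f).
Proof. by move=> sf pf j x; rewrite deriveC_mode_freq // freq0 mul0r. Qed.

Lemma deriveC_mean f x v : smooth f ->
  deriveC (mean f) x v = mean (fun x => deriveC f x v) x.
Proof. exact: deriveC_mode. Qed.

Lemma mean_antiderive f : smooth f -> periodic b f ->
  f = (fun x => mean f x + cderive (antiderive f) x).
Proof.
move=> sf pf; have sa := smooth_antiderive sf pf; have pa := periodic_antiderive sf pf.
have cm := smooth_ccontinuous (smooth_mean sf).
have cd := smooth_ccontinuous (smooth_cderive sa).
apply: (@mode_inj _ _ _ b).
- exact: smooth_ccontinuous.
- exact: ccontinuousD.
move=> m x; rewrite /mode mode_seqD // -!/(mode b m _ x) mode_cderive // mode_antiderive //.
rewrite mulrA divisor_inv mode_mode //.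
case: ifPn => [/forallP m0|_]; last by rewrite add0r mul1r.
rewrite mul0r addr0 /mode; congr (_ x); apply: eq_mode_seq => j _.
exact/eqP.
Qed.

Lemma flat_shift f : smooth f -> flat f -> forall j x (t : R), f (x + t *: b j) = f x.
Proof.
move=> sf ff j x t; apply: deriveC_line_cst => r.
apply: is_deriveC_eq; first exact: smooth_is_deriveC.
by rewrite deriveC_dirZ // ff mulr0.
Qed.

Lemma flat_periodic f : smooth f -> flat f -> periodic b f.
Proof. by move=> sf ff j x; rewrite -[b j]scale1r flat_shift. Qed.

Lemma flat_cderive f x : flat f -> cderive f x = 0.
Proof. by move=> ff; apply: big1 => j _; rewrite ff mulr0. Qed.

Lemma flat_mode m f x : smooth f -> flat f -> ~~ [forall j, m j == 0] -> mode b m f x = 0.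
Proof.
move=> sf ff; rewrite negb_forall => /existsP[j mj].
have := deriveC_mode_freq m j x sf (flat_periodic sf ff).
rewrite deriveC_mode // (_ : (fun x => deriveC f x (b j)) = fun=> 0).
  rewrite /mode mode_seq0 => /esym/eqP; rewrite mulf_eq0 => /orP[/eqP|/eqP //].
  by rewrite -freq0 => /freq_inj E; rewrite E eqxx in mj.
by apply/funext => y; exact: ff.
Qed.

Lemma flat_of_mode f : smooth f -> periodic b f ->
  (forall m x, ~~ [forall j, m j == 0] -> mode b m f x = 0) -> flat f.
Proof.
move=> sf pf H; suff -> : f = mean f by exact: flat_mean.
apply: (@mode_inj _ _ _ b); rewrite ?/mean; try exact/smooth_ccontinuous/smooth_mode;
  first exact: smooth_ccontinuous.
move=> m x; rewrite mode_mode //; case: ifPn => [/forallP m0|]; last exact: H.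
by rewrite /mode; congr (_ x); apply: eq_mode_seq => j _; exact/eqP.
Qed.

Lemma mean_flat f x : smooth f -> flat f -> mean f x = f x.
Proof.
move=> sf ff; rewrite /mean /mode mode_seq_id // => j y _.
by rewrite ff freq0 mul0r.
Qed.

(** At a nonzero frequency the mode of [f] is multiplied by the square of a nonzero divisor and
    becomes 0. This is the uniqueness behind equivariance. *)
Lemma flat_cderive2 f : smooth f -> periodic b f -> flat (cderive (cderive f)) -> flat f.
Proof.
move=> sf pf ff; have sf1 := smooth_cderive sf; have pf1 := periodic_cderive sf pf.
apply: flat_of_mode => // m x m0.
have := flat_mode x (smooth_cderive sf1) ff m0.
rewrite !mode_cderive // => /eqP; rewrite !mulf_eq0.
have := divisor_inv m; rewrite m0; case: eqP => [->|_ _ /=].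
  by rewrite mul0r => /esym/eqP; rewrite oner_eq0.
by move/eqP.
Qed.

Lemma meanD f g x : smooth f -> smooth g ->
  mean (fun x => f x + g x) x = mean f x + mean g x.
Proof. by move=> sf sg; apply: mode_seqD; exact: smooth_ccontinuous. Qed.

Lemma meanM c f x : smooth f -> smooth c -> flat c ->
  mean (fun x => c x * f x) x = c x * mean f x.
Proof.
move=> sf sc fc; apply: mode_seqM; first exact: smooth_ccontinuous.
exact: flat_shift.
Qed.

Lemma antideriveD f g x : smooth f -> periodic b f -> smooth g -> periodic b g ->
  antiderive (fun x => f x + g x) x = antiderive f x + antiderive g x.
Proof.
move=> sf pf sg pg; have sa := smooth_antiderive sf pf; have sb := smooth_antiderive sg pg.
suff E : (fun x => antiderive f x + antiderive g x) = antiderive (fun x => f x + g x) by rewrite -E.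
apply: antiderive_unique; [exact: smoothD|exact: periodicD|exact: smoothD|move=> m y].
apply: (etrans (modeD b m y sa sb)).
apply: (etrans (congr2 +%R (mode_antiderive m y sf pf) (mode_antiderive m y sg pg))).
by rewrite -mulrDr -modeD.
Qed.

Lemma antideriveM c f x : smooth f -> periodic b f -> smooth c -> flat c ->
  antiderive (fun x => c x * f x) x = c x * antiderive f x.
Proof.
move=> sf pf sc fc; have sa := smooth_antiderive sf pf.
have fs := flat_shift sc fc.
suff E : (fun x => c x * antiderive f x) = antiderive (fun x => c x * f x) by rewrite -E.
apply: antiderive_unique; [exact: smoothM| |exact: smoothM|move=> m y].
  by move=> j y; rewrite pf -{1}[b j]scale1r fs.
apply: (etrans (modeM m y sa fs)).
apply: (etrans (congr1 (fun z => c y * z) (mode_antiderive m y sf pf))).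
by rewrite mulrCA -modeM.
Qed.

Lemma deriveC_antiderive f x v : smooth f -> periodic b f ->
  deriveC (antiderive f) x v = antiderive (fun x => deriveC f x v) x.
Proof.
move=> sf pf; have sa := smooth_antiderive sf pf; have sf' := smooth_deriveC v sf.
suff E : (fun x => deriveC (antiderive f) x v) = antiderive (fun x => deriveC f x v) by rewrite -E.
apply: antiderive_unique => //; first exact: periodic_deriveC.
  exact: smooth_deriveC.
move=> m y; rewrite -!deriveC_mode //.
rewrite (_ : mode b m (antiderive f) = fun x => inv_divisor m * mode b m f x).
  by rewrite deriveCZ //; exact: smooth_mode.
by apply/funext => z; exact: mode_antiderive.
Qed.

Lemma antiderive2_shift f c : smooth f -> (forall x, f (x + c) = f x) ->
  forall x, antiderive2 f (x + c) = antiderive2 f x.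
Proof.
move=> sf fc x; rewrite /antiderive2 /multiplier /csum.
suff E i : multiplier_term b (fun m => inv_divisor m * inv_divisor m) f i (x + c) =
    multiplier_term b (fun m => inv_divisor m * inv_divisor m) f i x.
  by congr (limn _ +i* limn _)%C; apply/funext => N; apply: eq_bigr => i _; rewrite E.
rewrite /multiplier_term; case: pickle_inv => //= m; congr (_ * _).
rewrite /mode (@mode_seq_shift _ _ _ _ _ _ _ c 1) ?mul1r //.
  exact: smooth_ccontinuous.
by move=> y; rewrite mul1r.
Qed.

Section Equivariance.
Variables (T : V -> V) (rho kappa : R[i]) (f : V -> R[i]) (c : 'I_n -> V).
Hypothesis rho0 : rho != 0.
Hypothesis smoothT : forall g, smooth g -> smooth (g \o T).
Hypothesis cderiveT : forall g x, smooth g -> cderive (g \o T) x = rho * cderive g (T x).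
Hypothesis flatT : forall g, smooth g -> flat g -> flat (g \o T).
Hypothesis shiftT : forall j x, T (x + b j) = T x + c j.
Hypothesis fc : forall j x, f (x + c j) = f x.
Hypotheses (sf : smooth f) (pf : periodic b f).
Hypothesis fT : forall x, f (T x) = kappa * f x.

Lemma cderiveD g h x : smooth g -> smooth h ->
  cderive (fun x => g x + h x) x = cderive g x + cderive h x.
Proof.
move=> sg sh; rewrite /cderive -big_split /=; apply: eq_bigr => j _.
by rewrite deriveCD // mulrDr.
Qed.

Lemma cderiveZ a g x : smooth g -> cderive (fun x => a * g x) x = a * cderive g x.
Proof.
move=> sg; rewrite /cderive mulr_sumr; apply: eq_bigr => j _.
by rewrite deriveCZ // mulrCA.
Qed.

Lemma flatD g h : smooth g -> smooth h -> flat g -> flat h -> flat (fun x => g x + h x).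
Proof. by move=> sg sh fg fh j x; rewrite deriveCD // fg fh addr0. Qed.

Lemma flatZ a g : smooth g -> flat g -> flat (fun x => a * g x).
Proof. by move=> sg fg j x; rewrite deriveCZ // fg mulr0. Qed.

(** [T] will be a left translation, [rho] its effect on the derivation and [kappa] the factor of
    automorphy of [f]. The defect [w] of the second antiderivative is shown to be flat; its first
    derivative then gives the law for [antiderive f] and its second the law for [mean f]. *)
Lemma equivariant_antiderive :
  (forall x, antiderive f (T x) = kappa * rho * antiderive f x) /\
  (forall x, mean f (T x) = kappa * mean f x).
Proof.
have sm := smooth_mean sf; have fm := flat_mean sf pf.
have sA := smooth_antiderive2 sf pf; have pA := periodic_antiderive2 sf pf.
have sAT := smoothT sA.
(* [T] turns the shift by [b j] into the shift by [c j], under which [f], hence [antiderive2 f], is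
   invariant. *)
have pAT : periodic b (antiderive2 f \o T).
  by move=> j x; rewrite /= shiftT antiderive2_shift.
(* Two derivations of [antiderive2 f \o T] produce [rho ^+ 2]; the factor [rho ^- 2] compensates
   this. *)
pose w x := rho ^- 2 * (antiderive2 f \o T) x + - kappa * antiderive2 f x.
have s1 := smoothZ (rho ^- 2) sAT; have s2 := smoothZ (- kappa) sA.
have sw : smooth w by exact: smoothD.
have pw : periodic b w by apply: periodicD; exact: periodicZ.
have dw : cderive w =
    fun x => rho ^- 2 * (rho * antiderive f (T x)) + - kappa * antiderive f x.
  apply/funext => x; apply: (etrans (cderiveD x s1 s2)); apply: (congr2 +%R).
    apply: (etrans (cderiveZ _ x sAT)); apply: (congr1 (fun z => _ * z)).
    exact: (cderiveT x sA).
  exact: (cderiveZ _ x sA).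
have sa := smooth_antiderive sf pf; have saT := smoothT sa.
have E : f = (fun x => mean f x + cderive (antiderive f) x) by exact: mean_antiderive.
have fE x : f x = mean f x + cderive (antiderive f) x by rewrite {1}E.
(* Second derivatives of antiderivatives are [f] minus its mean; the terms in [f] cancel by [fT],
   and only means remain, which are flat. *)
have d2w : cderive (cderive w) = fun x => kappa * mean f x + -1 * (mean f \o T) x.
  apply/funext => x; rewrite dw.
  have srT : smooth (fun x => rho * (antiderive f \o T) x) by exact: smoothZ.
  have srrT : smooth (fun x => rho ^- 2 * (rho * (antiderive f \o T) x)) by exact: smoothZ.
  have ska : smooth (fun x => - kappa * antiderive f x) by exact: smoothZ.
  have -> : cderive (fun x => rho ^- 2 * (rho * antiderive f (T x)) +
      - kappa * antiderive f x) x =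
    rho ^- 2 * (rho * (rho * cderive (antiderive f) (T x))) +
      - kappa * cderive (antiderive f) x.
    apply: (etrans (cderiveD x srrT ska)); apply: (congr2 +%R).
      apply: (etrans (cderiveZ _ x srT)); apply: (congr1 (fun z => _ * z)).
      apply: (etrans (cderiveZ _ x saT)); apply: (congr1 (fun z => _ * z)).
      exact: (cderiveT x sa).
    exact: (cderiveZ _ x sa).
  have := fT x; rewrite !fE /= mulrDr => H.
  have -> : rho ^- 2 * (rho * (rho * cderive (antiderive f) (T x))) =
      cderive (antiderive f) (T x).
    by rewrite [rho * (rho * _)]mulrA -expr2 mulKf // expf_neq0.
  have key (A B A' B' k : R[i]) : A + B = k * A' + k * B' ->
      B + - k * B' = k * A' + -1 * A.
    move=> h; have -> : A = k * A' + k * B' - B by rewrite -h addrK.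
    by ring.
  exact: (key _ _ _ _ _ H).
have fw : flat w.
  apply: flat_cderive2 => //; rewrite d2w; apply: flatD.
  - exact: smoothZ.
  - by apply: smoothZ; exact: smoothT.
  - exact: flatZ.
  - by apply: flatZ; [exact: smoothT | exact: flatT].
have H1 x : antiderive f (T x) = kappa * rho * antiderive f x.
  have /(congr1 (fun h => h x)) := dw; rewrite flat_cderive // => /esym/eqP.
  rewrite mulNr subr_eq0 => /eqP H.
  by rewrite [kappa * rho]mulrC -mulrA -H; field.
split=> // x.
have /(congr1 (fun h => h x)) := d2w; rewrite flat_cderive.
  by rewrite mulN1r => /esym/eqP; rewrite subr_eq0 => /eqP ->.
move=> j y; rewrite (_ : cderive w = fun=> 0) ?deriveC_cst //.
by apply/funext => z; exact: flat_cderive.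
Qed.

End Equivariance.

End SmallDivisors.

(** * Averages and primitives along a vector with a factor of automorphy *)

Section TranslationOperators.
Context {R : realType} {V : normedModType R}.
Implicit Types (O : (V -> R[i]) -> V -> R[i]) (f g : V -> R[i]) (x v l : V).

(** Stated abstractly so that averages along several vectors can be composed; [top_shift] says that
    factors of automorphy survive. *)
Record translation_op O : Prop := TranslationOp {
  top_smooth : forall f, smooth f -> smooth (O f);
  top_deriveC : forall f x v, smooth f ->
    deriveC (O f) x v = O (fun x => deriveC f x v) x;
  top_add : forall f g x, smooth f -> smooth g ->
    O (fun x => f x + g x) x = O f x + O g x;
  top_scale : forall c f x, smooth f -> O (fun x => c * f x) x = c * O f x;
  top_shift : forall f c k, smooth f -> (forall x, f (x + c) = k * f x) ->
    forall x, O f (x + c) = k * O f x }.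

Lemma top_zero O x : translation_op O -> O (fun=> 0) x = 0.
Proof.
move=> tO; apply: (etrans _ (mul0r (O (fun=> 0) x))).
apply: (etrans _ (top_scale tO 0 x (smooth_cst 0))).
by congr (O _ x); apply/funext => y; rewrite mul0r.
Qed.

Lemma translation_op_avg w l : ccontinuous w -> translation_op (avg w l).
Proof.
move=> cw; split=> [f|f x v|f g x sf sg|c f x sf|f c k sf].
- exact: smooth_avg.
- exact: deriveC_avg.
- by apply: avgD => //; exact: smooth_ccontinuous.
- by apply: avgZ => //; exact: smooth_ccontinuous.
- by move=> fc x; apply: avg_shift => //; exact: smooth_ccontinuous.
Qed.

Lemma translation_op_zero : translation_op (fun _ _ => 0).
Proof.
split=> [f _|f x v _|f g x _ _|c f x _|f c k _ _ x].
- exact: smooth_cst.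
- exact: deriveC_cst.
- by rewrite addr0.
- by rewrite mulr0.
- by rewrite mulr0.
Qed.

Lemma translation_op_scale O a : translation_op O -> translation_op (fun f x => a * O f x).
Proof.
move=> tO; split=> [f sf|f x v sf|f g x sf sg|c f x sf|f c k sf fc x].
- by apply: smoothZ; exact: (top_smooth tO).
- by rewrite deriveCZ ?(top_deriveC tO) //; exact: (top_smooth tO).
- by rewrite (top_add tO) // mulrDr.
- by rewrite (top_scale tO) // mulrCA.
- by rewrite (top_shift tO sf fc) mulrCA.
Qed.

Definition one_weight (t : R) : R[i] := 1.
Definition id_weight (t : R) : R[i] := t%:C%C.

Lemma ccontinuous_one_weight : ccontinuous one_weight.
Proof. exact: ccontinuous_cst. Qed.

Lemma is_deriveC_id_weight (t : R) : is_deriveC t (1 : R) id_weight (one_weight t).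
Proof. by split; [exact: is_derive_id | exact: is_derive_cst]. Qed.

Lemma ccontinuous_id_weight : ccontinuous id_weight.
Proof. exact: (is_deriveC_ccontinuous is_deriveC_id_weight). Qed.

Definition harmonic (k : R[i]) l f : V -> R[i] :=
  if k == 1 then avg one_weight l f else fun=> 0.

(** The derivative along [l] of the plain average is [f (x + l) - f x], which equals
    [(k - 1) * f x]; dividing settles [k != 1]. For [k = 1] the weight [t] gives [f x] minus its
    average instead. *)
Definition primitive (k : R[i]) l f : V -> R[i] :=
  if k == 1 then avg id_weight l f else fun x => (k - 1)^-1 * avg one_weight l f x.

Lemma translation_op_harmonic k l : translation_op (harmonic k l).
Proof.
rewrite /harmonic; case: eqP => _; last exact: translation_op_zero.
exact/translation_op_avg/ccontinuous_one_weight.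
Qed.

Lemma translation_op_primitive k l : translation_op (primitive k l).
Proof.
rewrite /primitive; case: eqP => _.
  exact/translation_op_avg/ccontinuous_id_weight.
exact/translation_op_scale/translation_op_avg/ccontinuous_one_weight.
Qed.

Lemma deriveC_avg_one l f x : smooth f ->
  deriveC (avg one_weight l f) x l = f (x + l) - f x.
Proof.
move=> sf; rewrite (@avg_parts _ _ _ (fun=> 0)) //.
- rewrite /one_weight !mul1r [avg _ _ _ _](_ : _ = 0) ?subr0 //.
  by rewrite /avg -[RHS]cint01_cst; apply: eq_cint01 => t _; rewrite mul0r.
- exact: ccontinuous_one_weight.
- exact: ccontinuous_cst.
- by move=> t; exact: is_deriveC_cst.
Qed.

Lemma harmonic_primitive k l f x : smooth f -> (forall x, f (x + l) = k * f x) ->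
  f x = harmonic k l f x + deriveC (primitive k l f) x l.
Proof.
move=> sf fl; rewrite /harmonic /primitive; case: eqP => [k1|/eqP k1].
  rewrite (@avg_parts _ _ _ one_weight) //.
  - by rewrite /id_weight mul0r subr0 mul1r fl k1 mul1r addrC subrK.
  - exact: ccontinuous_id_weight.
  - exact: ccontinuous_one_weight.
  - exact: is_deriveC_id_weight.
rewrite add0r deriveCZ; last exact/smooth_avg/sf/ccontinuous_one_weight.
rewrite deriveC_avg_one // fl -{3}[f x]mul1r -mulrBl mulKf // subr_eq0 //.
Qed.

Lemma deriveC_harmonic k l f x : smooth f -> (forall x, f (x + l) = k * f x) ->
  deriveC (harmonic k l f) x l = 0.
Proof.
move=> sf fl; rewrite /harmonic; case: eqP => [k1|_]; last exact: deriveC_cst.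
by rewrite deriveC_avg_one // fl k1 mul1r subrr.
Qed.

Lemma harmonic_cst l c : harmonic 1 l (fun=> c) = fun=> c.
Proof.
apply/funext => x; rewrite /harmonic eqxx /avg -[RHS]cint01_cst.
by apply: eq_cint01 => t _; rewrite /one_weight mul1r.
Qed.

End TranslationOperators.

Section AffineMaps.
Context {R : realType} {V : normedModType R}.
Variables (T L : V -> V).
Hypothesis affineT : forall x v (h : R), T (x + h *: v) = T x + h *: L v.
Hypothesis continuousT : continuous T.

Lemma is_deriveC_affine (f : V -> R[i]) x v d : is_deriveC (T x) (L v) f d ->
  is_deriveC x v (f \o T) d.
Proof.
have E (h : V -> R) : (fun k : R => h (T (x + k *: v))) = (fun k => h (T x + k *: L v)).
  by apply/funext => k; rewrite affineT.
move=> df; apply: is_deriveC_at0 => /=.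
under eq_fun do rewrite affineT.
apply: (@is_deriveC_line _ _ f (T x) (L v) 0).
by rewrite scale0r addr0.
Qed.

Lemma smooth_affine (f : V -> R[i]) : smooth f -> smooth (f \o T).
Proof.
move=> sf; apply: (@smooth_coind _ _ (fun g => exists2 f, smooth f & g = f \o T));
  last by exists f.
move=> _ [g sg ->]; split.
  by apply: ccontinuous_comp => //; exact: smooth_ccontinuous.
move=> v; exists ((fun y => deriveC g y (L v)) \o T).
  by exists (fun y => deriveC g y (L v)) => //; exact: smooth_deriveC.
by move=> x; apply: is_deriveC_affine; exact: smooth_is_deriveC.
Qed.

Lemma deriveC_affine (f : V -> R[i]) x v : smooth f ->
  deriveC (f \o T) x v = deriveC f (T x) (L v).
Proof. by move=> sf; apply/is_deriveC_val/is_deriveC_affine/smooth_is_deriveC. Qed.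

Lemma derive_affine x v : 'D_v T x = L v.
Proof.
apply: cvg_lim => //.
apply: (@cvg_trans _ ((fun=> L v) @ (0 : R)^')); last exact: cvg_cst.
apply: near_eq_cvg; near=> h.
have h0 : h != 0 by near: h; exact: nbhs_dnbhs_neq.
by rewrite /= [h *: v + x]addrC affineT addrC addKr scalerA mulVf // scale1r.
Unshelve. all: end_near. Qed.

End AffineMaps.

(** * The left-invariant frame and the exterior algebra *)

Section ComplexExponential.
Context {R : realType}.
Implicit Types z w : R[i].

Lemma cexpD z w : cexp (z + w) = cexp z * cexp w.
Proof.
rewrite /cexp; apply: complex_ext; rewrite !reimE /= expRD.
  by rewrite cosD; ring.
by rewrite sinD; ring.
Qed.

Lemma cexp0 : cexp 0 = 1 :> R[i].
Proof. by rewrite /cexp /= expR0 cos0 sin0 mul1r mulr0. Qed.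

Lemma cexpN z : cexp z * cexp (- z) = 1.
Proof. by rewrite -cexpD subrr cexp0. Qed.

Lemma cexp_neq0 z : cexp z != 0.
Proof. by apply/eqP => z0; have /eqP := cexpN z; rewrite z0 mul0r eq_sym oner_eq0. Qed.

Lemma cexp_conj z : cexp z^* = (cexp z)^*.
Proof. by rewrite /cexp; apply: complex_ext; rewrite !reimE /= ?cosN ?sinN ?mulrN. Qed.

End ComplexExponential.

Section Cons.
Context {T : Type}.

Definition ccons {k} (z : T) (c : 'I_k -> T) : 'I_k.+1 -> T :=
  fun i => if unlift ord0 i is Some j then c j else z.

Lemma ccons0 k z (c : 'I_k -> T) : ccons z c ord0 = z.
Proof. by rewrite /ccons unlift_none. Qed.

Lemma cconsS k z (c : 'I_k -> T) j : ccons z c (lift ord0 j) = c j.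
Proof. by rewrite /ccons liftK. Qed.

Lemma ccons_eta k (d : 'I_k.+1 -> T) : ccons (d ord0) (fun i => d (lift ord0 i)) = d.
Proof. by apply/funext => i; rewrite /ccons; case: unliftP => [j|] ->. Qed.

Lemma ccons_lift k z (c : 'I_k.+1 -> T) (b : 'I_k.+1) :
  (fun i => ccons z c (lift (lift ord0 b) i)) = ccons z (fun i => c (lift b i)).
Proof.
apply/funext => i; case: (unliftP ord0 i) => [j|] ->.
  rewrite cconsS (_ : lift (lift ord0 b) (lift ord0 j) = lift ord0 (lift b j)) ?cconsS //.
  by apply: val_inj; rewrite /= /bump; lia.
by rewrite ccons0 (_ : lift (lift ord0 b) ord0 = ord0) ?ccons0 //; apply: val_inj.
Qed.

Lemma ccons_comp_lift k z (c : 'I_k -> T) : (fun i => ccons z c (lift ord0 i)) = c.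
Proof. by apply/funext => i; rewrite cconsS. Qed.

End Cons.

Lemma big_ccons (A : nmodType) (T : finType) k (G : ('I_k.+1 -> T) -> A) :
  \sum_(d : {ffun 'I_k.+1 -> T}) G d =
  \sum_(z : T) \sum_(c : {ffun 'I_k -> T}) G (ccons z c).
Proof.
rewrite pair_big /=.
pose h (u : T * {ffun 'I_k -> T}) : {ffun 'I_k.+1 -> T} := [ffun i => ccons u.1 u.2 i].
pose h' (d : {ffun 'I_k.+1 -> T}) := (d ord0, [ffun i => d (lift ord0 i)]).
rewrite (reindex h) /=.
  by apply: eq_bigr => -[z c] _; congr G; apply/funext => i; rewrite ffunE.
exists h' => [[z c]|d] _.
  by rewrite /h' ffunE ccons0; congr pair; apply/ffunP => i; rewrite !ffunE cconsS.
apply/ffunP => i; rewrite ffunE /=.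
rewrite -[in RHS](ccons_eta d); congr (ccons _ _ i).
by apply/funext => j; rewrite ffunE.
Qed.

Section Frames.
Context {R : realType} {s t : nat}.
Variable psi : 'I_t -> {linear 'rV[R]_s -> Rcomplex R}.
Local Notation V := (@OTgroup R s t).
Local Notation n := (s + t)%N.

Definition idx : finType := (bool * 'I_(s + t))%type.

(* [(true, j)] stands for [W1_gen j], a form of type (1, 0), and [(false, j)] for
   [W2_gen j], of type (0, 1). *)
Definition gen (c : idx) : @oneform R s t :=
  if c.1 then W1_gen psi c.2 else W2_gen psi c.2.

Definition chr (c : idx) : V -> R[i] :=
  if c.1 then char1 psi c.2 else char2 psi c.2.

Definition tangent (j : 'I_n) (e : bool) : V :=
  match fintype.split j with
  | inl i => if e then (0, delta_mx 0 i, (0, 0)) else (delta_mx 0 i, 0, (0, 0))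
  | inr k => if e then (0, 0, (0, delta_mx 0 k)) else (0, 0, (delta_mx 0 k, 0))
  end.

Definition coordinate (j : 'I_n) (e : bool) (v : V) : R :=
  match fintype.split j with
  | inl i => if e then yc v 0 i else xc v 0 i
  | inr k => if e then v.2.2 0 k else v.2.1 0 k
  end.

(* The coefficients, in the complexified basis [tangent], of the frame dual to [gen]. *)
Definition dual_coef (c : idx) (e : bool) (g : V) : R[i] :=
  match fintype.split c.2 with
  | inl i =>
    if c.1 then if e then (0 +i* - 2^-1)%C else (expR (- xc g 0 i) / 2)%:C%C
    else if e then (0 +i* (expR (xc g 0 i) / 2))%C else (2^-1)%:C%C
  | inr k =>
    if e then (0 +i* (if c.1 then - 2^-1 else 2^-1))%C else (2^-1)%:C%C
  end.

Lemma split_lshift (i : 'I_s) : fintype.split (lshift t i) = inl i.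
Proof. exact: (@unsplitK s t (inl i)). Qed.

Lemma split_rshift (k : 'I_t) : fintype.split (rshift s k) = inr k.
Proof. exact: (@unsplitK s t (inr k)). Qed.

Lemma ord_split (j : 'I_n) :
  (exists i, j = lshift t i) \/ (exists k, j = rshift s k).
Proof.
by rewrite -(splitK j); case: (fintype.split j) => i; [left | right]; exists i.
Qed.

Lemma gen_x1 i g v :
  gen (true, lshift t i) g v = ((expR (xc g 0 i) * xc v 0 i) +i* yc v 0 i)%C.
Proof.
rewrite /gen /= /W1_gen /char1 /theta split_lshift; apply: complex_ext; rewrite reimE /=.
  by rewrite mul0r subr0.
by rewrite mul0r addr0 mulrA expRxMexpNx_1 mul1r.
Qed.

Lemma gen_x2 i g v :
  gen (false, lshift t i) g v = (xc v 0 i +i* - (expR (- xc g 0 i) * yc v 0 i))%C.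
Proof.
by rewrite /gen /= /W2_gen /char2 /theta_bar /theta split_lshift mul1r.
Qed.

Lemma gen_z1 k g v : gen (true, rshift s k) g v = zc v k.
Proof.
by rewrite /gen /= /W1_gen /char1 /theta split_rshift mulrA cexpN mul1r.
Qed.

Lemma gen_z2 k g v : gen (false, rshift s k) g v = (zc v k)^*.
Proof.
rewrite /gen /= /W2_gen /char2 /theta_bar /theta split_rshift rmorphM /= mulrA.
by rewrite cexp_conj -rmorphM /= cexpN rmorph1 mul1r.
Qed.

Definition genE := (gen_x1, gen_x2, gen_z1, gen_z2).

Lemma chr_neq0 c g : chr c g != 0.
Proof.
case: c => [[] j]; rewrite /chr /= /char1 /char2; have [[i ->]|[k ->]] := ord_split j;
  rewrite ?split_lshift ?split_rshift ?cexp_neq0 ?oner_eq0 //.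
by rewrite eq_complex /= eqxx andbT gt_eqF // expR_gt0.
Qed.

Lemma tangent_lshift i e : tangent (lshift t i) e =
  if e then (0, delta_mx 0 i, (0, 0)) else (delta_mx 0 i, 0, (0, 0)).
Proof. by rewrite /tangent split_lshift. Qed.

Lemma tangent_rshift k e : tangent (rshift s k) e =
  if e then (0, 0, (0, delta_mx 0 k)) else (0, 0, (delta_mx 0 k, 0)).
Proof. by rewrite /tangent split_rshift. Qed.

Lemma gen_dual c d g :
  \sum_(e : bool) dual_coef d e g * gen c g (tangent d.2 e) = (c == d)%:R.
Proof.
rewrite big_bool /=; case: c d => [a j] [a' j'] /=; rewrite xpair_eqE.
have [[i ->]|[k ->]] := ord_split j; have [[i' ->]|[k' ->]] := ord_split j';
  rewrite ?eq_lshift ?eq_rshift ?eq_lrshift ?eq_rlshift ?andbF /dual_coef /=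
    ?split_lshift ?split_rshift ?tangent_lshift ?tangent_rshift.
- have [<-|ii'] := eqVneq i i'.
    have Ex := expRxMexpNx_1 (xc g 0 i).
    case: a a' => -[]; rewrite !genE /=; apply: complex_ext;
      rewrite !reimE /= !mxE /= eqxx /=; move: Ex;
      move: (expR (xc g 0 i)) (expR (- xc g 0 i)) => u v uv; lra.
  case: a a' => -[]; rewrite !genE /=; apply: complex_ext;
    rewrite !reimE /= !mxE /= (negPf ii') /=; lra.
- case: a a' => -[]; rewrite !genE /=; apply: complex_ext;
    rewrite !reimE /= !mxE /=; lra.
- case: a a' => -[]; rewrite !genE /=; apply: complex_ext;
    rewrite !reimE /= !mxE /=; lra.
- have [<-|kk'] := eqVneq k k'.
    case: a a' => -[]; rewrite !genE /=; apply: complex_ext;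
      rewrite !reimE /= !mxE /= eqxx /=; lra.
  case: a a' => -[]; rewrite !genE /=; apply: complex_ext;
    rewrite !reimE /= !mxE /= (negPf kk') /=; lra.
Qed.

Lemma gen_coordinate j e g v :
  \sum_(a : bool) dual_coef (a, j) e g * gen (a, j) g v = (coordinate j e v)%:C%C.
Proof.
rewrite big_bool /= /dual_coef /coordinate /=.
have [[i ->]|[k ->]] := ord_split j; rewrite ?split_lshift ?split_rshift !genE /=.
  have Ex := expRxMexpNx_1 (xc g 0 i).
  case: e; apply: complex_ext; rewrite !reimE /=; move: Ex;
    move: (expR (xc g 0 i)) (expR (- xc g 0 i)) => u w uw.
  - transitivity (2^-1 * yc v 0 i + 2^-1 * (u * w) * yc v 0 i); first by ring.
    by rewrite uw; lra.
  - by ring.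
  - transitivity (2^-1 * xc v 0 i + 2^-1 * (u * w) * xc v 0 i); first by ring.
    by rewrite uw; lra.
  - by ring.
by case: e; apply: complex_ext; rewrite !reimE /=; lra.
Qed.

Lemma tangent_decomposition (v : V) :
  v = \sum_j \sum_(e : bool) coordinate j e v *: tangent j e.
Proof.
(* Each of the four blocks of [V] is a linear projection [P], and a single computation of [P] on the
   sum serves all four. *)
have H m (P : V -> 'rV[R]_m) : (forall u w, P (u + w) = P u + P w) ->
    (forall a u, P (a *: u) = a *: P u) ->
    P (\sum_j \sum_(e : bool) coordinate j e v *: tangent j e) =
    \sum_i (yc v 0 i *: P (0, delta_mx 0 i, (0, 0)) +
             xc v 0 i *: P (delta_mx 0 i, 0, (0, 0))) +
    \sum_k (v.2.2 0 k *: P (0, 0, (0, delta_mx 0 k)) +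
             v.2.1 0 k *: P (0, 0, (delta_mx 0 k, 0))).
  move=> PD PZ; have P0 : P 0 = 0 by rewrite -(scale0r 0) PZ scale0r.
  rewrite (big_morph P PD P0) big_split_ord /=; congr (_ + _); apply: eq_bigr => i _;
    by rewrite big_bool /= PD !PZ /coordinate ?split_lshift ?split_rshift
      ?tangent_lshift ?tangent_rshift.
have Z m k (a b : 'rV[R]_m) (F : 'I_k -> R) (G : 'I_k -> R) :
    \sum_i (F i *: (0 : 'rV[R]_m) + G i *: 0) = 0.
  by apply: big1 => i _; rewrite !scaler0 addr0.
move: (\sum_j _) H => w H.
have Hx := H _ (@xc R s t) (fun _ _ => erefl) (fun _ _ => erefl).
have Hy := H _ (@yc R s t) (fun _ _ => erefl) (fun _ _ => erefl).
have Hr := H _ (fun v : V => v.2.1) (fun _ _ => erefl) (fun _ _ => erefl).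
have Hi := H _ (fun v : V => v.2.2) (fun _ _ => erefl) (fun _ _ => erefl).
rewrite /xc /yc /= in Hx Hy Hr Hi.
case: w v H Hx Hy Hr Hi => [[wx wy] [wr wi]] [[vx vy] [vr vi]] _ /= -> -> -> ->.
congr (_, _, (_, _)); rewrite ?Z ?addr0 ?add0r // [LHS]row_sum_delta;
  by apply: eq_bigr => i _; rewrite scaler0 ?add0r ?addr0.
Qed.

Definition dual_deriv (c : idx) (f : V -> R[i]) (g : V) : R[i] :=
  \sum_(e : bool) dual_coef c e g * deriveC f g (tangent c.2 e).

Lemma deriveC_gen f g v : smooth f ->
  deriveC f g v = \sum_c dual_deriv c f g * gen c g v.
Proof.
move=> sf; rewrite {1}(tangent_decomposition v).
rewrite (big_morph (deriveC f g) (fun u w => deriveC_dirD g u w sf) (deriveC_dir0 g sf)).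
rewrite [RHS](eq_bigr (fun c : idx => dual_deriv (c.1, c.2) f g * gen (c.1, c.2) g v));
  last by case.
rewrite -(pair_bigA _ (fun a j => dual_deriv (a, j) f g * gen (a, j) g v)) /=.
rewrite exchange_big /=; apply: eq_bigr => j _.
rewrite deriveC_dir_sum //; under [RHS]eq_bigr do rewrite mulr_suml.
rewrite exchange_big /=; apply: eq_bigr => e _.
rewrite -(gen_coordinate j e g v) mulr_suml; apply: eq_bigr => a _.
by rewrite mulrAC.
Qed.

End Frames.

(** * Coefficients of forms in the frame *)

Section ExteriorAlgebra.
Context {R : realType} {s t : nat}.
Variable psi : 'I_t -> {linear 'rV[R]_s -> Rcomplex R}.
Local Notation V := (@OTgroup R s t).
Local Notation oneform := (@oneform R s t).
Local Notation form := (@Defs.form R s t).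
Local Notation gen := (gen psi).
Local Notation idx := (@idx s t).

Lemma wedge_perm k (th : 'I_k -> oneform) (sg : 'S_k) g v :
  wedge (fun i => th (sg i)) g v = (-1) ^+ sg * wedge th g v.
Proof.
rewrite /wedge -det_perm -det_mulmx -row_permE; congr (\det _).
by apply/matrixP => i j; rewrite !mxE.
Qed.

Lemma wedge_scale k (e : 'I_k -> V -> R[i]) (th : 'I_k -> oneform) g v :
  wedge (fun i g v => e i g * th i g v) g v = (\prod_i e i g) * wedge th g v.
Proof.
rewrite /wedge; have -> : \prod_i e i g = \det (diag_mx (\row_i e i g)).
  by rewrite det_diag; apply: eq_bigr => i _; rewrite mxE.
rewrite -det_mulmx; congr (\det _); apply/matrixP => i j.
by rewrite mul_diag_mx !mxE.
Qed.

Lemma wedge_ccons k (mu : oneform) (th : 'I_k -> oneform) g v :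
  wedge (ccons mu th) g v =
  \sum_(j < k.+1) (-1) ^+ j * mu g (v j) * wedge th g (fun i => v (lift j i)).
Proof.
rewrite /wedge (expand_det_row _ ord0); apply: eq_bigr => j _.
rewrite !mxE ccons0 /cofactor /= add0n mulrCA mulrA; congr (_ * _ * \det _).
by apply/matrixP => a b; rewrite !mxE cconsS.
Qed.

(** The value of [om] on vectors of the dual frame. These are complex combinations of real tangent
    vectors while forms take real arguments, so the multilinear expansion is part of the
    definition. *)
Definition coef {k} (d : 'I_k -> idx) (om : form k) (g : V) : R[i] :=
  \sum_(e : {ffun 'I_k -> bool}) (\prod_j dual_coef (d j) (e j) g) *
    om g (fun j => tangent (d j).2 (e j)).

Definition combination {k} (F : ('I_k -> idx) -> V -> R[i]) : form k :=
  fun g v => \sum_(c : {ffun 'I_k -> idx}) F c g * wedge (fun i => gen (c i)) g v.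

(** The generalized Kronecker delta. *)
Definition delta_det {k} (c d : 'I_k -> idx) : R[i] :=
  \det (\matrix_(i, j) (c i == d j)%:R).

Lemma coef_wedge k (c d : 'I_k -> idx) g :
  coef d (wedge (fun i => gen (c i))) g = delta_det c d.
Proof.
rewrite /coef /delta_det -det_tr /determinant.
transitivity (\sum_(sg : 'S_k) \sum_(e : {ffun 'I_k -> bool}) (-1) ^+ sg *
    \prod_j (dual_coef (d j) (e j) g * gen (c (sg j)) g (tangent (d j).2 (e j)))).
  rewrite exchange_big /=; apply: eq_bigr => e _.
  rewrite /wedge -det_tr /determinant mulr_sumr; apply: eq_bigr => sg _.
  rewrite mulrCA -big_split /=; congr (_ * _); apply: eq_bigr => j _.
  by rewrite !mxE.
apply: eq_bigr => sg _; rewrite -mulr_sumr; congr (_ * _).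
rewrite -(bigA_distr_bigA (fun j (e : bool) =>
   dual_coef (d j) e g * gen (c (sg j)) g (tangent (d j).2 e))).
by apply: eq_bigr => j _; rewrite gen_dual !mxE.
Qed.

Lemma coef_combination k (F : ('I_k -> idx) -> V -> R[i]) (d : 'I_k -> idx) g :
  coef d (combination F) g = \sum_(c : {ffun 'I_k -> idx}) F c g * delta_det c d.
Proof.
rewrite /coef /combination; under eq_bigr do rewrite mulr_sumr.
rewrite exchange_big /=; apply: eq_bigr => c _.
rewrite -(coef_wedge c d g) /coef mulr_sumr; apply: eq_bigr => e _.
by rewrite mulrCA.
Qed.

Lemma coef_add k (d : 'I_k -> idx) (om om' : form k) g :
  coef d (om + om') g = coef d om g + coef d om' g.
Proof. by rewrite /coef -big_split; apply: eq_bigr => e _; exact: mulrDr. Qed.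

Lemma coef_scale k (d : 'I_k -> idx) a (om : form k) g :
  coef d (a *: om) g = a * coef d om g.
Proof. by rewrite /coef mulr_sumr; apply: eq_bigr => e _; rewrite mulrCA. Qed.

Lemma coef_sub k (d : 'I_k -> idx) (om om' : form k) g :
  coef d (om - om') g = coef d om g - coef d om' g.
Proof. by rewrite -scaleN1r coef_add coef_scale mulN1r. Qed.

Lemma coef_zero k (d : 'I_k -> idx) g : coef d (0 : form k) g = 0.
Proof. by rewrite -(scale0r 0) coef_scale mul0r. Qed.

Lemma delta_detE k (c d : 'I_k -> idx) :
  delta_det c d = \sum_(sg : 'S_k) (-1) ^+ sg * [forall i, c i == d (sg i)]%:R.
Proof.
rewrite /delta_det /determinant; apply: eq_bigr => sg _; congr (_ * _).
case: forallP => [H|/forallP]; first by apply: big1 => i _; rewrite mxE H.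
by rewrite negb_forall => /existsP[i ni]; rewrite (bigD1 i) //= mxE (negPf ni) mul0r.
Qed.

Definition type_count {k} (c : 'I_k -> idx) : nat := (\sum_(i < k) (c i).1)%N.

Lemma type_count_perm k (c : 'I_k -> idx) (sg : 'S_k) :
  type_count (fun i => c (sg i)) = type_count c.
Proof. by rewrite /type_count [RHS](reindex_inj (@perm_inj _ sg)). Qed.

Lemma type_count_ccons k z (c : 'I_k -> idx) :
  type_count (ccons z c) = (z.1 + type_count c)%N.
Proof.
rewrite /type_count big_ord_recl ccons0; congr (_ + _)%N.
by apply: eq_bigr => i _; rewrite cconsS.
Qed.

Lemma delta_det_type k (c d : 'I_k -> idx) :
  type_count c <> type_count d -> delta_det c d = 0.
Proof.
move=> cd; rewrite delta_detE; apply: big1 => sg _.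
case: forallP => [H|_]; last by rewrite mulr0.
case: cd; rewrite -(type_count_perm d sg); apply: eq_bigr => i _.
by rewrite (eqP (H i)).
Qed.

Lemma delta_det_perm k (c d : 'I_k -> idx) (sg : 'S_k) :
  delta_det c (fun i => d (sg i)) = (-1) ^+ sg * delta_det c d.
Proof.
rewrite /delta_det; have -> : (-1) ^+ sg = \det (perm_mx sg^-1) :> R[i].
  by rewrite det_perm odd_permV.
rewrite mulrC -det_mulmx -col_permE; congr (\det _).
by apply/matrixP => i j; rewrite !mxE.
Qed.

Definition alternating {k} (F : ('I_k -> idx) -> V -> R[i]) : Prop :=
  forall (sg : 'S_k) c g, F (fun i => c (sg i)) g = (-1) ^+ sg * F c g.

(** A [form] is a bare function of tangent vectors; being spanned makes it alternating, multilinear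
    and determined by its coefficients. *)
Definition spanned {k} (om : form k) : Prop := exists F, om = combination F.

Lemma alternating_coef k (om : form k) : spanned om -> alternating (fun d => coef d om).
Proof.
move=> [F ->] sg d g; rewrite !coef_combination mulr_sumr; apply: eq_bigr => c _.
by rewrite delta_det_perm mulrCA.
Qed.

Lemma sum_forall_perm k (c : 'I_k -> idx) (sg : 'S_k) (G : ('I_k -> idx) -> R[i]) :
  \sum_(d : {ffun 'I_k -> idx}) [forall i, c i == d (sg i)]%:R * G d =
  G (fun i => c ((sg^-1)%g i)).
Proof.
rewrite (bigD1 [ffun i => c ((sg^-1)%g i)]) //= big1 ?addr0 => [|d].
  have -> : [forall i, c i == [ffun i => c ((sg^-1)%g i)] (sg i)].
    by apply/forallP => i; rewrite ffunE permK.
  by rewrite mul1r; congr G; apply/funext => i; rewrite ffunE.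
case: forallP => [H|_ _]; last by rewrite mul0r.
case/eqP; apply/ffunP => i; rewrite ffunE.
by have /eqP := H ((sg^-1)%g i); rewrite permKV => ->.
Qed.

Lemma sum_sign_sqr k : \sum_(sg : 'S_k) (-1) ^+ sg * (-1) ^+ sg = k`!%:R :> R[i].
Proof.
under eq_bigr do rewrite -expr2 sqrr_sign.
by rewrite sumr_const -card_Sn.
Qed.

(** Each permutation in the expansion of [delta_det] selects one [d], and contributes [G c] once the
    two signs cancel. *)
Lemma sum_delta_det k (c : 'I_k -> idx) (G : ('I_k -> idx) -> R[i]) :
  (forall (sg : 'S_k) d, G (fun i => d (sg i)) = (-1) ^+ sg * G d) ->
  \sum_(d : {ffun 'I_k -> idx}) delta_det c d * G d = k`!%:R * G c.
Proof.
move=> GA; under eq_bigr do rewrite delta_detE mulr_suml.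
rewrite exchange_big /= -sum_sign_sqr mulr_suml; apply: eq_bigr => sg _.
under eq_bigr do rewrite -mulrA.
by rewrite -mulr_sumr sum_forall_perm GA odd_permV mulrA.
Qed.

Lemma delta_det_sym k (c d : 'I_k -> idx) : delta_det c d = delta_det d c.
Proof.
rewrite /delta_det -det_tr; congr (\det _); apply/matrixP => i j.
by rewrite !mxE eq_sym.
Qed.

Lemma fact_neq0 k : k`!%:R != 0 :> R[i].
Proof. by rewrite pnatr_eq0 -lt0n fact_gt0. Qed.

Lemma coef_alternating k (F : ('I_k -> idx) -> V -> R[i]) d g : alternating F ->
  coef d (k`!%:R^-1 *: combination F) g = F d g.
Proof.
move=> FA; rewrite coef_scale coef_combination.
under eq_bigr do rewrite mulrC delta_det_sym.
rewrite (sum_delta_det _ (G := fun c => F c g)) ?mulKf ?fact_neq0 //.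
Qed.

Lemma spanned_coef k (om : form k) : spanned om ->
  om = k`!%:R^-1 *: combination (fun c => coef c om).
Proof.
move=> [F ->]; apply/funext => g; apply/funext => v.
rewrite [RHS](_ : _ = k`!%:R^-1 * combination (fun c => coef c (combination F)) g v) //.
rewrite {2}/combination; under eq_bigr do rewrite coef_combination mulr_suml.
rewrite exchange_big /= mulr_sumr; apply: eq_bigr => c _.
under eq_bigr do rewrite -mulrA.
rewrite -mulr_sumr (sum_delta_det _ (G := fun d => wedge (fun i => gen (d i)) g v)).
  by rewrite mulrCA mulKf // fact_neq0.
by move=> sg d; rewrite (wedge_perm (fun i => gen (d i))).
Qed.

Lemma spanned_eq k (om om' : form k) : spanned om -> spanned om' ->
  (forall d g, coef d om g = coef d om' g) -> om = om'.
Proof.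
move=> s1 s2 H; rewrite (spanned_coef s1) (spanned_coef s2); congr (_ *: combination _).
by apply/funext => d; apply/funext => g.
Qed.

Lemma spanned_combination k (F : ('I_k -> idx) -> V -> R[i]) : spanned (combination F).
Proof. by exists F. Qed.

Lemma combination_lin k a (F G : ('I_k -> idx) -> V -> R[i]) :
  a *: combination F + combination G = combination (fun c g => a * F c g + G c g).
Proof.
apply/funext => g; apply/funext => v.
rewrite [LHS](_ : _ = a * combination F g v + combination G g v) //.
rewrite /combination mulr_sumr -big_split /=; apply: eq_bigr => c _.
by rewrite mulrDl mulrA.
Qed.

Lemma spanned_lin k a (om om' : form k) : spanned om -> spanned om' ->
  spanned (a *: om + om').
Proof. by move=> [F ->] [G ->]; rewrite combination_lin; eexists. Qed.

Lemma combination0 k : combination (fun (_ : 'I_k -> idx) _ => 0) = 0.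
Proof.
by apply/funext => g; apply/funext => v; apply: big1 => c _; rewrite mul0r.
Qed.

Lemma spanned0 k : spanned (0 : form k).
Proof. by rewrite -combination0; exact: spanned_combination. Qed.

Definition standard_type (p : nat) {k} (c : 'I_k -> idx) : bool :=
  [forall i, (c i).1 == (i < p)%N].

Lemma type_count_standard p k (c : 'I_k -> idx) : (p <= k)%N ->
  standard_type p c -> type_count c = p.
Proof.
move=> pk /forallP cp; rewrite /type_count.
under eq_bigr do rewrite (eqP (cp _)).
rewrite -(big_mkord xpredT (fun i => (i < p)%N : nat)) (@big_cat_nat _ _ _ p) //=.
rewrite big_nat (eq_bigr (fun=> 1%N)) => [|i /andP[_ ->] //].
rewrite -big_nat sum_nat_const_nat subn0 muln1 big_nat big1 ?addn0 // => i /andP[pi _].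
by rewrite ltnNge pi.
Qed.

Lemma theta_gen p k (a : 'I_k -> 'I_(s + t)) g v :
  wedge (fun i : 'I_k => if (i < p)%N then theta psi (a i) else theta_bar psi (a i)) g v =
  (\prod_(i < k) (chr psi ((i < p)%N, a i) g)^-1) *
    wedge (fun i : 'I_k => gen ((i < p)%N, a i)) g v.
Proof.
rewrite -(@wedge_scale k (fun i g => (chr psi ((i < p)%N, a i) g)^-1)).
congr (wedge _ g v); apply/funext => i; apply/funext => h; apply/funext => w.
have := chr_neq0 psi ((i < p)%N, a i) h; rewrite /gen /chr /=.
by case: ifP => _ c0; rewrite /W1_gen /W2_gen mulKf.
Qed.

Lemma bidegree_combination p k (om : form k) : bidegree psi p om ->
  exists2 F, om = combination F & forall c, ~~ standard_type p c -> forall g, F c g = 0.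
Proof.
move=> [f hf].
pose F (c : 'I_k -> idx) g := if standard_type p c then
  f [ffun i => (c i).2] g * \prod_(i < k) (chr psi (c i) g)^-1 else 0.
exists F; last by move=> c /negPf cp g; rewrite /F cp.
apply/funext => g; apply/funext => v; rewrite hf /combination /F.
pose h (a : {ffun 'I_k -> 'I_(s + t)}) : {ffun 'I_k -> idx} :=
  [ffun i : 'I_k => ((i < p)%N, a i)].
rewrite [RHS](bigID (fun c : {ffun 'I_k -> idx} => standard_type p c)) /=.
rewrite [X in _ = _ + X]big1 ?addr0 => [|c /negPf ->]; last by rewrite mul0r.
rewrite (reindex_onto h (fun c => [ffun i => (c i).2])) /=; last first.
  move=> c /forallP cp; apply/ffunP => i; rewrite !ffunE.
  by move: (cp i); case: (c i) => [x y] /= /eqP ->.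
apply: eq_big => [a|a _].
  have -> : [ffun i => (h a i).2] = a by apply/ffunP => i; rewrite !ffunE.
  rewrite eqxx andbT; apply/esym/forallP => i; rewrite ffunE; exact: eqxx.
have -> : standard_type p (h a) by apply/forallP => i; rewrite ffunE eqxx.
have -> : [ffun i => (h a i).2] = a by apply/ffunP => i; rewrite !ffunE.
rewrite theta_gen mulrA; congr (_ * _ * _).
  by apply: eq_bigr => i _; rewrite ffunE.
by congr (wedge _ g v); apply/funext => i; rewrite ffunE.
Qed.

Lemma bidegree_spanned p k (om : form k) : bidegree psi p om -> spanned om.
Proof. by move=> /bidegree_combination[F -> _]; exact: spanned_combination. Qed.

Lemma bidegree_coef p k (om : form k) d g : (p <= k)%N -> bidegree psi p om ->
  type_count d <> p -> coef d om g = 0.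
Proof.
move=> pk /bidegree_combination[F -> F0] dp; rewrite coef_combination.
apply: big1 => c _; have [cp|cp] := boolP (standard_type p c); last by rewrite F0 ?mul0r.
rewrite delta_det_type ?mulr0 // (type_count_standard pk cp).
by move=> E; apply: dp.
Qed.

(** Two boolean tuples with equally many entries [true] are permutations of each other. *)
Lemma perm_standard_type p k (c : 'I_k -> idx) : type_count c = p ->
  exists sg : 'S_k, standard_type p (fun i => c (sg i)).
Proof.
move=> cp; pose t1 := [tuple (c i).1 | i < k]; pose t2 := [tuple (i < p)%N | i < k].
have cnt (f : 'I_k -> bool) : count_mem true [seq f i | i <- enum 'I_k] = (\sum_i f i)%N.
  rewrite count_map -sum1_count big_mkcond /= big_enum /=.
  by apply: eq_bigr => i _; case: (f i).
have pk : (p <= k)%N.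
  rewrite -cp /type_count -[leqRHS]card_ord -sum1_card; apply: leq_sum => i _.
  exact: leq_b1.
have ct : count_mem true t2 = count_mem true t1.
  rewrite !cnt -/(type_count c) cp.
  pose c' (i : 'I_k) : idx := ((i < p)%N, (c i).2).
  rewrite -[RHS](@type_count_standard p k c' pk) //.
  by apply/forallP => i; rewrite /c' eqxx.
have : perm_eq t2 t1.
  apply/allP => b _; apply/eqP; case: b; first exact: ct.
  have E (u : k.-tuple bool) : count_mem false u = (k - count_mem true u)%N.
    rewrite -[X in (X - _)%N](size_tuple u) -(count_predC (pred1 true)) addKn.
    by apply: eq_count => -[].
  by rewrite !E ct.
move/tuple_permP => [sg E]; exists sg; apply/forallP => i.
have := congr1 (fun u => nth true u i) E.
by rewrite -!tnth_nth !tnth_mktuple => ->.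
Qed.

Lemma bidegree_mulf p k (f : V -> R[i]) (om : form k) : bidegree psi p om ->
  bidegree psi p (fun g v => f g * om g v).
Proof.
move=> [h hh]; exists (fun a g => f g * h a g) => g v.
by rewrite hh mulr_sumr; apply: eq_bigr => a _; rewrite mulrA.
Qed.

Lemma bidegree_sum p k (I : Type) (r : seq I) (F : I -> form k) :
  (forall i, bidegree psi p (F i)) -> bidegree psi p (fun g v => \sum_(i <- r) F i g v).
Proof.
move=> bF; elim: r => [|i r IH].
  rewrite (_ : (fun g v => _) = 0); first exact: bidegree0.
  by apply/funext => g; apply/funext => v; rewrite big_nil.
have := bidegree_lin 1 (bF i) IH; rewrite scale1r; congr bidegree.
by apply/funext => g; apply/funext => v; rewrite big_cons.
Qed.

(** [bidegree] expects the (1, 0)-factors first; sorting costs a sign, and passing from [gen] to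
    [theta] costs the characters. *)
Lemma bidegree_wedge_gen p k (c : 'I_k -> idx) : type_count c = p ->
  bidegree psi p (wedge (fun i => gen (c i))).
Proof.
move=> /perm_standard_type[sg /forallP csg].
pose a : {ffun 'I_k -> 'I_(s + t)} := [ffun i => (c (sg i)).2].
exists (fun a' g => if a' == a then
  (-1) ^+ sg * \prod_(i < k) chr psi ((i < p)%N, a i) g else 0) => g v.
rewrite [RHS](bigD1 a) //= eqxx [X in _ + X]big1 ?addr0 => [|a' a'a]; last by rewrite (negbTE a'a) mul0r.
rewrite theta_gen mulrA -[X in X * wedge _ _ _]mulrA -big_split /=.
rewrite big1 ?mulr1 => [|i _]; last by rewrite divff // chr_neq0.
rewrite (_ : (fun i : 'I_k => gen ((i < p)%N, a i)) = fun i => gen (c (sg i))).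
  by rewrite (wedge_perm (fun i => gen (c i))) mulrA -expr2 sqrr_sign mul1r.
apply/funext => i; congr gen; rewrite ffunE.
by have := csg i; case: (c (sg i)) => x y /= /eqP ->.
Qed.

Lemma combination_bidegree p k (F : ('I_k -> idx) -> V -> R[i]) :
  (forall c, type_count c <> p -> forall g, F c g = 0) ->
  bidegree psi p (combination F).
Proof.
move=> F0; apply: bidegree_sum => c.
have [cp|/eqP cp] := eqVneq (type_count c) p.
  by apply: bidegree_mulf; exact: bidegree_wedge_gen.
rewrite (_ : (fun g v => _) = 0); first exact: bidegree0.
by apply/funext => g; apply/funext => v; rewrite F0 // mul0r.
Qed.

End ExteriorAlgebra.

Section WedgeDerivative.
Context {R : realType} {s t : nat}.
Local Notation V := (@OTgroup R s t).
Local Notation oneform := (@oneform R s t).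
Local Notation form := (@Defs.form R s t).

Lemma deriveC_prod k (F : 'I_k -> V -> R[i]) g v : (forall i, smooth (F i)) ->
  deriveC (fun g => \prod_i F i g) g v =
  \sum_l \prod_i (if i == l then deriveC (F l) g v else F i g).
Proof.
elim: k F => [|k IH] F sF.
  by rewrite big_ord0; under eq_fun do rewrite big_ord0; rewrite deriveC_cst.
under eq_fun do rewrite big_ord_recl.
rewrite deriveCM //; last by apply: smooth_prod => i _; exact: sF.
rewrite IH // big_ord_recl; congr (_ + _).
  by rewrite big_ord_recl eqxx; congr (_ * _); apply: eq_bigr => i _.
by rewrite mulr_sumr; apply: eq_bigr => l _; rewrite big_ord_recl /=; congr (_ * _).
Qed.

Lemma wedgeE k (th : 'I_k -> oneform) g v :
  wedge th g v = \sum_(sg : 'S_k) (-1) ^+ sg * \prod_i th i g (v (sg i)).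
Proof.
rewrite /wedge /determinant; apply: eq_bigr => sg _; congr (_ * _).
by apply: eq_bigr => i _; rewrite mxE.
Qed.

Variables (k : nat) (th : 'I_k -> oneform).
Hypothesis smooth_th : forall l w, smooth (fun g => th l g w).

Lemma smooth_wedge : smooth_form (wedge th).
Proof.
move=> v; under eq_fun do rewrite wedgeE.
apply: smooth_sum => sg _; apply: smoothZ; apply: smooth_prod => i _.
exact: smooth_th.
Qed.

Lemma deriveC_wedge g (v : 'I_k -> V) u :
  deriveC (fun g => wedge th g v) g u =
  \sum_l wedge (fun i g w => if i == l then deriveC (fun g => th l g w) g u
                             else th i g w) g v.
Proof.
under eq_fun do rewrite wedgeE.
rewrite deriveC_sum => [|sg _]; last first.
  by apply: smoothZ; apply: smooth_prod => i _; exact: smooth_th.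
under [RHS]eq_bigr do rewrite wedgeE.
rewrite exchange_big /=; apply: eq_bigr => sg _.
rewrite deriveCZ; last by apply: smooth_prod => i _; exact: smooth_th.
rewrite -mulr_sumr deriveC_prod => [|i]; last exact: smooth_th.
congr (_ * _); apply: eq_bigr => l _; apply: eq_bigr => i _.
by case: eqP => // ->.
Qed.

Lemma wedge_row_lin l (A B : V -> R[i]) a b g (v : 'I_k -> V) :
  wedge (fun i g w => if i == l then a * A w + b * B w else th i g w) g v =
  a * wedge (fun i g w => if i == l then A w else th i g w) g v +
  b * wedge (fun i g w => if i == l then B w else th i g w) g v.
Proof.
rewrite /wedge; apply: (@determinant_multilinear _ _ _ _ _ l).
- by apply/rowP => j; rewrite !mxE eqxx.
- by apply/matrixP => i j; rewrite !mxE [lift _ _ == _]eq_sym (negPf (neq_lift _ _)).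
- by apply/matrixP => i j; rewrite !mxE [lift _ _ == _]eq_sym (negPf (neq_lift _ _)).
Qed.

Lemma wedge_repeat (nu : V -> R[i]) l g (v : 'I_k.+1 -> V) :
  wedge (ccons (fun _ => nu) (fun i g w => if i == l then nu w else th i g w)) g v = 0.
Proof.
rewrite /wedge; apply: (@determinant_alternate _ _ _ ord0 (lift ord0 l)) => // j.
by rewrite !mxE ccons0 cconsS eqxx.
Qed.

(* Only the part of the derivative of [th l] that is antisymmetric in the two
   tangent vectors contributes, and the sum over [r] is symmetric. *)
Lemma ext_d_wedge (f : V -> R[i]) g (mu : 'I_k -> V -> R[i])
    (a : 'I_k -> bool -> R[i]) (nu : 'I_k -> bool -> V -> R[i]) v : smooth f ->
  (forall l u w, deriveC (fun g => th l g w) g u =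
     mu l u * th l g w + (a l true * nu l true u * nu l true w +
                          a l false * nu l false u * nu l false w)) ->
  ext_d (fun g v => f g * wedge th g v) g v =
  wedge (ccons (fun g u => deriveC f g u) th) g v +
  f g * \sum_l wedge (ccons (fun _ => mu l) th) g v.
Proof.
move=> sf dth; rewrite /ext_d.
rewrite (eq_bigr (fun j : 'I_k.+1 =>
    (-1) ^+ j * (deriveC f g (v j) * wedge th g (fun i => v (lift j i))) +
    (-1) ^+ j * (f g * deriveC (fun g => wedge th g (fun i => v (lift j i))) g (v j))));
  last by move=> j _; rewrite deriveCM ?mulrDr //; exact: smooth_wedge.
rewrite big_split /= wedge_ccons; congr (_ + _).
  by apply: eq_bigr => j _; rewrite mulrA.
under eq_bigr do rewrite deriveC_wedge mulrCA mulr_sumr.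
rewrite -mulr_sumr exchange_big /=; congr (_ * _); apply: eq_bigr => l _.
have H j : wedge (fun i g w => if i == l then deriveC (fun g => th l g w) g (v j)
      else th i g w) g (fun i => v (lift j i)) =
    mu l (v j) * wedge th g (fun i => v (lift j i)) +
    (a l true * nu l true (v j) * wedge (fun i g w => if i == l then nu l true w
       else th i g w) g (fun i => v (lift j i)) +
     a l false * nu l false (v j) * wedge (fun i g w => if i == l then nu l false w
       else th i g w) g (fun i => v (lift j i))).
  rewrite -wedge_row_lin.
  have -> : wedge th g (fun i => v (lift j i)) =
      wedge (fun i h w => if i == l then th l g w else th i h w) g (fun i => v (lift j i)).
    rewrite /wedge; congr (\det _); apply/matrixP => i j'; rewrite !mxE.
    by case: eqP => // ->.
  rewrite -[X in _ = _ + X]mul1r -wedge_row_lin /wedge; congr (\det _).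
  apply/matrixP => i j'; rewrite !mxE; case: eqP => // _.
  by rewrite dth mul1r.
under eq_bigr do rewrite H !mulrDr.
rewrite big_split /= wedge_ccons [X in _ + X](_ : _ = 0) ?addr0.
  by apply: eq_bigr => j _; rewrite mulrA.
rewrite big_split /=.
have Z r : \sum_(j < k.+1) (-1) ^+ j * (a l r * nu l r (v j) *
    wedge (fun i h w => if i == l then nu l r w else th i h w) g
      (fun i => v (lift j i))) = 0.
  transitivity (a l r * wedge (ccons (fun _ => nu l r)
      (fun i g w => if i == l then nu l r w else th i g w)) g v).
    rewrite wedge_ccons mulr_sumr; apply: eq_bigr => j _.
    by rewrite !mulrA [(-1) ^+ j * a l r]mulrC.
  by rewrite wedge_repeat mulr0.
by rewrite !Z addr0.
Qed.

End WedgeDerivative.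

Section LinearExponential.
Context {R : realType} {V : normedModType R}.
Variable l : V -> R[i].
Hypothesis l_line : forall x v (h : R), l (x + h *: v) = l x + h%:C%C * l v.
Hypothesis l_cont : ccontinuous l.

Lemma is_deriveC_cexp_lin x v : is_deriveC x v (fun x => cexp (l x)) (l v * cexp (l x)).
Proof.
apply: is_deriveC_at0; under eq_fun do rewrite l_line.
move: (l x) (l v) => z w.
have dl (a b : R) : is_derive (0 : R) (1 : R) (fun h : R => a + h * b) b.
  by apply: is_derive_eq; rewrite /GRing.scale /=; ring.
have dR := dl (complex.Re z) (complex.Re w); have dI := dl (complex.Im z) (complex.Im w).
have E h : complex.Re (z + h%:C%C * w) = complex.Re z + h * complex.Re w.
  by rewrite !reimE /=; ring.
have E' h : complex.Im (z + h%:C%C * w) = complex.Im z + h * complex.Im w.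
  by rewrite !reimE /=; ring.
rewrite /cexp; split; rewrite !reimE /=; under eq_fun do rewrite E E'.
  apply: (is_derive_eq (is_deriveM (is_derive1_comp (is_derive_expR _) dR)
    (is_derive1_comp (is_derive_cos _) dI))).
  by rewrite /GRing.scale /= !mul0r !addr0; ring.
apply: (is_derive_eq (is_deriveM (is_derive1_comp (is_derive_expR _) dR)
  (is_derive1_comp (is_derive_sin _) dI))).
by rewrite /GRing.scale /= !mul0r !addr0; ring.
Qed.

Lemma ccontinuous_cexp (f : V -> R[i]) : ccontinuous f -> ccontinuous (fun x => cexp (f x)).
Proof.
move=> [a b]; have cE x : {for x, continuous (fun x => expR (complex.Re (f x)))}.
  by apply: (@continuous_comp _ _ _ (fun x => complex.Re (f x)) expR);
    [exact: a | exact: continuous_expR].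
have cC x : {for x, continuous (fun x => cos (complex.Im (f x)))}.
  by apply: (@continuous_comp _ _ _ (fun x => complex.Im (f x)) cos);
    [exact: b | exact: continuous_cos].
have cS x : {for x, continuous (fun x => sin (complex.Im (f x)))}.
  by apply: (@continuous_comp _ _ _ (fun x => complex.Im (f x)) sin);
    [exact: b | exact: continuous_sin].
by split=> x; apply: cvgM; [exact: cE | exact: cC | exact: cE | exact: cS].
Qed.

Lemma smooth_cexp_lin : smooth (fun x => cexp (l x)).
Proof.
apply/smooth_algebra_smooth/(@SmoothExp _ _ _ l); first exact: ccontinuous_cexp.
exact: is_deriveC_cexp_lin.
Qed.

Lemma deriveC_cexp_lin x v : deriveC (fun x => cexp (l x)) x v = l v * cexp (l x).
Proof. exact/is_deriveC_val/is_deriveC_cexp_lin. Qed.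

End LinearExponential.

(** * The operator dbar on coefficients *)

Section Dbar.
Context {R : realType} {s t : nat}.
Variable psi : 'I_t -> {linear 'rV[R]_s -> Rcomplex R}.
Local Notation V := (@OTgroup R s t).
Local Notation form := (@Defs.form R s t).
Local Notation gen := (gen psi).
Local Notation idx := (@idx s t).
Implicit Types (f : V -> R[i]) (g : V).

Lemma cexp_real (a : R) : cexp a%:C%C = (expR a)%:C%C.
Proof. by rewrite /cexp /= cos0 sin0 mulr1 mulr0. Qed.

Lemma continuous_xc : continuous (@xc R s t).
Proof.
move=> g; apply: (@continuous_comp _ _ _ fst fst); first exact: cvg_fst.
exact: cvg_fst.
Qed.

Lemma continuous_xc_coord (i : 'I_s) : continuous (fun g : V => xc g 0 i).
Proof.
move=> g; apply: (@continuous_comp _ _ _ (@xc R s t) (fun x : 'rV[R]_s => x 0 i)).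
  exact: continuous_xc.
exact: coord_continuous.
Qed.

Lemma xc_line_coord (a : R) (i : 'I_s) g (v : V) (h : R) :
  (a * xc (g + h *: v) 0 i)%:C%C =
  (a * xc g 0 i)%:C%C + h%:C%C * (a * xc v 0 i)%:C%C :> R[i].
Proof.
rewrite -rmorphM -rmorphD /=; congr (_%:C%C).
by rewrite /xc /= !mxE; ring.
Qed.

Lemma ccontinuous_xc_coord (a : R) (i : 'I_s) :
  ccontinuous (fun g : V => (a * xc g 0 i)%:C%C : R[i]).
Proof.
split=> g /=; last exact: cvg_cst.
by apply: cvgM; [exact: cvg_cst | exact: continuous_xc_coord].
Qed.

Definition xexp (a : R) (i : 'I_s) (g : V) : R[i] := (expR (a * xc g 0 i))%:C%C.

Lemma smooth_xexp a i : smooth (xexp a i).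
Proof.
rewrite /xexp; under eq_fun do rewrite -cexp_real.
apply: smooth_cexp_lin; [exact: xc_line_coord | exact: ccontinuous_xc_coord].
Qed.

Lemma deriveC_xexp a i g v : deriveC (xexp a i) g v = (a * xc v 0 i)%:C%C * xexp a i g.
Proof.
rewrite /xexp; under eq_fun do rewrite -cexp_real; rewrite -cexp_real.
by apply: deriveC_cexp_lin; [exact: xc_line_coord].
Qed.

Lemma gen_x1E i w : (fun g => gen (true, lshift t i) g w) =
  (fun g => (xc w 0 i)%:C%C * xexp 1 i g + (0 +i* yc w 0 i)%C).
Proof.
apply/funext => g; rewrite gen_x1 /xexp mul1r.
by apply: complex_ext; rewrite !reimE /=; ring.
Qed.

Lemma gen_x2E i w : (fun g => gen (false, lshift t i) g w) =
  (fun g => (0 +i* - yc w 0 i)%C * xexp (-1) i g + (xc w 0 i)%:C%C).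
Proof.
apply/funext => g; rewrite gen_x2 /xexp mulN1r.
by apply: complex_ext; rewrite !reimE /=; ring.
Qed.

Lemma smooth_gen c w : smooth (fun g => gen c g w).
Proof.
case: c => [a j]; have [[i ->]|[k ->]] := ord_split j; case: a.
- rewrite gen_x1E; apply: smoothD; last exact: smooth_cst.
  by apply: smoothZ; exact: smooth_xexp.
- rewrite gen_x2E; apply: smoothD; last exact: smooth_cst.
  by apply: smoothZ; exact: smooth_xexp.
- by under eq_fun do rewrite gen_z1; exact: smooth_cst.
- by under eq_fun do rewrite gen_z2; exact: smooth_cst.
Qed.

Lemma smooth_dual_coef c e : smooth (dual_coef c e : V -> R[i]).
Proof.
case: c => [a j]; rewrite /dual_coef /=; have [[i ->]|[k ->]] := ord_split j.
  rewrite split_lshift; case: a; case: e; try exact: smooth_cst.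
    rewrite (_ : (fun g => _) = fun g => (2^-1)%:C%C * xexp (-1) i g).
      by apply: smoothZ; exact: smooth_xexp.
    by apply/funext => g; rewrite /xexp mulN1r -rmorphM /= mulrC.
  rewrite (_ : (fun g => _) = fun g => (0 +i* 2^-1)%C * xexp 1 i g).
    by apply: smoothZ; exact: smooth_xexp.
  apply/funext => g; rewrite /xexp mul1r; apply: complex_ext; rewrite !reimE /=; ring.
by rewrite split_rshift; case: e; exact: smooth_cst.
Qed.

(** The differential of [gen c] is [torsion c] times the wedge of [gen (true, c.2)] with [gen c]. It
    is nonzero only for bar alpha_i and has type (1, 1), so dbar does not see it. *)
Definition torsion (c : idx) (g : V) : R[i] :=
  match fintype.split c.2 with
  | inl i => if c.1 then 0 else (- 2^-1 * expR (- xc g 0 i))%:C%C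
  | inr k => 0
  end.

Lemma deriveC_gen_form c g : exists (a : bool -> R[i]) (nu : bool -> V -> R[i]),
  forall u w, deriveC (fun g => gen c g w) g u =
    torsion c g * gen (true, c.2) g u * gen c g w +
    (a true * nu true u * nu true w + a false * nu false u * nu false w).
Proof.
case: c => [b j]; have [[i ->]|[k ->]] := ord_split j; last first.
  exists (fun=> 0), (fun _ _ => 0) => u w; rewrite /torsion /= split_rshift.
  by case: b; [under eq_fun do rewrite gen_z1 | under eq_fun do rewrite gen_z2];
    rewrite deriveC_cst !mul0r !addr0.
rewrite /torsion /= split_lshift; case: b.
  exists (fun b => if b then xexp 1 i g else 0), (fun _ u => (xc u 0 i)%:C%C) => u w.
  have sx := smoothZ (xc w 0 i)%:C%C (@smooth_xexp 1 i).
  rewrite gen_x1E deriveCD //; last exact: smooth_cst.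
  rewrite deriveCZ; last exact: smooth_xexp.
  by rewrite deriveC_xexp deriveC_cst mul1r; ring.
(* The symmetric remainder is half the square of alpha_i plus e^(-2 x_i) times the square of
   dy_i. *)
exists (fun b => if b then (2^-1)%:C%C else (expR (- xc g 0 i) * expR (- xc g 0 i))%:C%C),
  (fun b u => if b then (xc u 0 i +i* (expR (- xc g 0 i) * yc u 0 i))%C
              else (yc u 0 i)%:C%C) => u w.
have sx := smoothZ (0 +i* - yc w 0 i)%C (@smooth_xexp (-1) i).
rewrite gen_x2E deriveCD //; last exact: smooth_cst.
rewrite deriveCZ; last exact: smooth_xexp.
rewrite deriveC_xexp deriveC_cst addr0 gen_x1 gen_x2 /xexp [-1 * xc g 0 i]mulN1r.
have := expRxMexpNx_1 (xc g 0 i).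
move: (expR (xc g 0 i)) (expR (- xc g 0 i)) => F E FE.
have F2 z : E * (F * z) = z by rewrite mulrA [E * F]mulrC FE mul1r.
apply: complex_ext; rewrite !reimE /= ?reimE /=.
  transitivity (- 2^-1 * (E * (F * xc u 0 i)) * xc w 0 i + 2^-1 * xc u 0 i * xc w 0 i);
    first by rewrite F2; ring.
  by field.
transitivity (2^-1 * E * (E * (F * xc u 0 i)) * yc w 0 i + 2^-1 * E * xc u 0 i * yc w 0 i);
  first by rewrite F2; field.
by field.
Qed.

Lemma dual_derivD c f f' g : smooth f -> smooth f' ->
  dual_deriv c (fun g => f g + f' g) g = dual_deriv c f g + dual_deriv c f' g.
Proof.
move=> sf sf'; rewrite /dual_deriv -big_split; apply: eq_bigr => e _.
by rewrite deriveCD // mulrDr.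
Qed.

Lemma dual_derivZ c a f g : smooth f ->
  dual_deriv c (fun g => a * f g) g = a * dual_deriv c f g.
Proof.
move=> sf; rewrite /dual_deriv mulr_sumr; apply: eq_bigr => e _.
by rewrite deriveCZ // mulrCA.
Qed.

Lemma dual_deriv_cst c a g : dual_deriv c (fun=> a) g = 0.
Proof. by apply: big1 => e _; rewrite deriveC_cst mulr0. Qed.

Lemma dual_deriv_sum c (I : Type) (r : seq I) (F : I -> V -> R[i]) g :
  (forall i, smooth (F i)) ->
  dual_deriv c (fun g => \sum_(i <- r) F i g) g = \sum_(i <- r) dual_deriv c (F i) g.
Proof.
move=> sF; elim: r => [|i r IH].
  by rewrite big_nil; under eq_fun do rewrite big_nil; exact: dual_deriv_cst.
rewrite big_cons -IH; under eq_fun do rewrite big_cons.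
by rewrite dual_derivD //; exact: smooth_sum.
Qed.

Lemma smooth_dual_deriv c f : smooth f -> smooth (dual_deriv c f).
Proof.
move=> sf; apply: smooth_sum => e _; apply: smoothM; first exact: smooth_dual_coef.
exact: smooth_deriveC.
Qed.

Lemma smooth_coef k (d : 'I_k -> idx) (om : form k) : smooth_form om -> smooth (coef d om).
Proof.
move=> som; apply: smooth_sum => e _; apply: smoothM; last exact: som.
by apply: smooth_prod => j _; exact: smooth_dual_coef.
Qed.

Lemma smooth_wedge_gen k (c : 'I_k -> idx) : smooth_form (wedge (fun i => gen (c i))).
Proof. by apply: smooth_wedge => l w; exact: smooth_gen. Qed.

Lemma smooth_combination k (F : ('I_k -> idx) -> V -> R[i]) : (forall c, smooth (F c)) ->
  smooth_form (combination psi F).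
Proof.
move=> sF v; apply: smooth_sum => c _; apply: smoothM; first exact: sF.
exact: smooth_wedge_gen.
Qed.

(** The new covector is put first without antisymmetrising. The family is not alternating, but it
    represents the right form; [coef_dbar_combination] extracts the alternating sum [dbar_sum]. *)
Definition dbar_coef k (F : ('I_k -> idx) -> V -> R[i]) (d : 'I_k.+1 -> idx) (g : V) :=
  if (d ord0).1 then 0 else dual_deriv (d ord0) (F (fun i => d (lift ord0 i))) g.

Lemma ccons_gen k z (c : 'I_k -> idx) :
  ccons (gen z) (fun i => gen (c i)) = (fun i => gen (ccons z c i)).
Proof. by apply/funext => i; rewrite /ccons; case: unlift. Qed.

Lemma wedge_ccons_lin k (I : Type) (r : seq I) (a : I -> R[i]) (nu : I -> V -> R[i])
    (th : 'I_k -> @oneform R s t) g v :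
  wedge (ccons (fun _ u => \sum_(i <- r) a i * nu i u) th) g v =
  \sum_(i <- r) a i * wedge (ccons (fun _ => nu i) th) g v.
Proof.
rewrite wedge_ccons; under eq_bigr do rewrite [X in X * wedge _ _ _]mulr_sumr mulr_suml.
rewrite exchange_big /=; apply: eq_bigr => i _; rewrite wedge_ccons mulr_sumr.
by apply: eq_bigr => j _; rewrite mulrCA !mulrA.
Qed.

Lemma wedge_ccons_eq k (mu mu' : @oneform R s t) (th : 'I_k -> @oneform R s t) g v :
  (forall u, mu g u = mu' g u) -> wedge (ccons mu th) g v = wedge (ccons mu' th) g v.
Proof. by move=> E; rewrite !wedge_ccons; apply: eq_bigr => j _; rewrite E. Qed.

Lemma ext_d_wedge_gen k (c : 'I_k -> idx) f g v : smooth f ->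
  ext_d (fun g v => f g * wedge (fun i => gen (c i)) g v) g v =
  \sum_z dual_deriv z f g * wedge (fun i => gen (ccons z c i)) g v +
  f g * \sum_l torsion (c l) g *
    wedge (fun i => gen (ccons (true, (c l).2) c i)) g v.
Proof.
move=> sf.
have /choice[a /choice[nu H]] : forall l, exists (a : bool -> R[i]),
    exists (nu : bool -> V -> R[i]), forall u w, deriveC (fun g => gen (c l) g w) g u =
    torsion (c l) g * gen (true, (c l).2) g u * gen (c l) g w +
    (a true * nu true u * nu true w + a false * nu false u * nu false w).
  by move=> l; exact: deriveC_gen_form.
rewrite (@ext_d_wedge _ _ _ _ (fun i => gen (c i)) _ f g
  (fun l u => torsion (c l) g * gen (true, (c l).2) g u) a nu) //; last first.
  by move=> l w; exact: smooth_gen.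
congr (_ + _ * _).
  transitivity (wedge (ccons (fun _ u => \sum_z dual_deriv z f g * gen z g u)
      (fun i => gen (c i))) g v).
    by apply: wedge_ccons_eq => u; exact: deriveC_gen.
  rewrite wedge_ccons_lin; apply: eq_bigr => z _; congr (_ * _).
  rewrite -ccons_gen; exact: wedge_ccons_eq.
apply: eq_bigr => l _.
have := @wedge_ccons_lin k _ [:: true] (fun=> torsion (c l) g)
  (fun=> gen (true, (c l).2) g) (fun i => gen (c i)) g v.
rewrite big_seq1 -ccons_gen.
move=> E; transitivity (torsion (c l) g *
    wedge (ccons (fun _ => gen (true, (c l).2) g) (fun i => gen (c i))) g v).
  by rewrite -E; apply: wedge_ccons_eq => u; rewrite big_seq1.
by congr (_ * _); exact: wedge_ccons_eq.
Qed.

Lemma ext_d_sum k (I : Type) (r : seq I) (F : I -> form k) g v :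
  (forall i, smooth_form (F i)) ->
  ext_d (fun g v => \sum_(i <- r) F i g v) g v = \sum_(i <- r) ext_d (F i) g v.
Proof.
move=> sF; rewrite /ext_d exchange_big /=; apply: eq_bigr => j _.
rewrite -mulr_sumr; congr (_ * _); rewrite deriveC_sum // => i _; exact: sF.
Qed.

(** All other terms of the exterior derivative, namely derivatives along (1, 0)-vectors and torsion,
    carry an additional (1, 0)-covector and are of type [p.+1]. *)
Lemma is_dbar_combination p k (F : ('I_k -> idx) -> V -> R[i]) :
  (forall c, smooth (F c)) -> (forall c, type_count c <> p -> forall g, F c g = 0) ->
  is_dbar psi p (combination psi F) (combination psi (dbar_coef F)).
Proof.
move=> sF F0; split.
  apply: combination_bidegree => d dp g; rewrite /dbar_coef; case: ifP => // d0.
  rewrite (_ : F _ = fun=> 0) ?dual_deriv_cst //; apply/funext => h; apply: F0 => E.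
  by apply: dp; rewrite -[d]ccons_eta type_count_ccons E d0.
pose G (c : {ffun 'I_k -> idx}) : form k.+1 := fun g v =>
  \sum_(z : idx) (if z.1 then dual_deriv z (F c) g else 0) *
    wedge (fun i => gen (ccons z c i)) g v +
  F c g * \sum_l torsion (c l) g * wedge (fun i => gen (ccons (true, (c l).2) c i)) g v.
rewrite (_ : _ - _ = fun g v => \sum_(c : {ffun 'I_k -> idx}) G c g v); last first.
  apply/funext => g; apply/funext => v.
  rewrite [LHS](_ : _ = ext_d (combination psi F) g v -
    combination psi (dbar_coef F) g v) // /combination ext_d_sum; last first.
    move=> c w; apply: smoothM; [exact: sF | exact: smooth_wedge_gen].
  rewrite (@big_ccons _ _ _ (fun d => dbar_coef F d g * wedge (fun i => gen (d i)) g v)).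
  rewrite [X in _ - X]exchange_big /= -sumrB; apply: eq_bigr => c _.
  rewrite ext_d_wedge_gen // addrAC /G; congr (_ + _).
  rewrite -sumrB; apply: eq_bigr => z _; rewrite -mulrBl; congr (_ * _).
  rewrite /dbar_coef ccons0 ccons_comp_lift; case: z.1; first by rewrite subr0.
  by rewrite subrr.
apply: bidegree_sum => c; have [cp|/eqP cp] := eqVneq (type_count c) p; last first.
  rewrite (_ : G c = 0); first exact: bidegree0.
  apply/funext => g; apply/funext => v; rewrite /G F0 // mul0r addr0 big1 // => z _.
  rewrite (_ : F c = fun=> 0) ?dual_deriv_cst; first by case: ifP; rewrite mul0r.
  by apply/funext => h; exact: F0.
have b1 : bidegree psi p.+1 (fun g v =>
    \sum_(z : idx) (if z.1 then dual_deriv z (F c) g else 0) *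
      wedge (fun i => gen (ccons z c i)) g v).
  apply: bidegree_sum => -[z1 z2]; case: z1 => /=.
    apply: bidegree_mulf; apply: bidegree_wedge_gen.
    by rewrite type_count_ccons cp.
  rewrite (_ : (fun g v => _) = 0); first exact: bidegree0.
  by apply/funext => g; apply/funext => v; rewrite mul0r.
have b2 : bidegree psi p.+1 (fun g v => F c g *
    \sum_l torsion (c l) g * wedge (fun i => gen (ccons (true, (c l).2) c i)) g v).
  apply: bidegree_mulf; apply: bidegree_sum => l; apply: bidegree_mulf.
  by apply: bidegree_wedge_gen; rewrite type_count_ccons cp.
by have := bidegree_lin 1 b1 b2; rewrite scale1r.
Qed.

Lemma spannedB k (om om' : form k) : spanned psi om -> spanned psi om' ->
  spanned psi (om - om').
Proof. by move=> h h'; rewrite -scaleN1r addrC; exact: spanned_lin. Qed.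

(** The difference of two candidates is of type [p] and of type [p.+1] at once, so all its
    coefficients vanish. *)
Lemma is_dbar_unique p k (om : form k) eta eta' : (p <= k)%N ->
  is_dbar psi p om eta -> is_dbar psi p om eta' -> eta = eta'.
Proof.
move=> pk [b1 e1] [b2 e2].
apply: (spanned_eq (bidegree_spanned b1) (bidegree_spanned b2)) => d g.
have [dp|/eqP dp] := eqVneq (type_count d) p; last first.
  by rewrite (bidegree_coef _ _ b1) ?(bidegree_coef _ _ b2) // leqW.
have h := bidegree_lin (-1) e1 e2.
have : coef d (-1 *: (ext_d om - eta) + (ext_d om - eta')) g = 0.
  by apply: (bidegree_coef _ _ h) => //; rewrite dp; lia.
rewrite scaleN1r opprB addrA subrK coef_sub => /eqP.
by rewrite subr_eq0 => /eqP.
Qed.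

Lemma delta_det_ccons k z (c : 'I_k -> idx) (d : 'I_k.+1 -> idx) :
  delta_det (R := R) (ccons z c) d =
  \sum_(b < k.+1) (z == d b)%:R * ((-1) ^+ b * delta_det c (fun i => d (lift b i))).
Proof.
rewrite /delta_det (expand_det_row _ ord0); apply: eq_bigr => b _.
rewrite !mxE ccons0 /cofactor /= add0n; congr (_ * (_ * \det _)).
by apply/matrixP => i j; rewrite !mxE cconsS.
Qed.

Definition dbar_sum k (F : ('I_k -> idx) -> V -> R[i]) (d : 'I_k.+1 -> idx) (g : V) : R[i] :=
  \sum_(b < k.+1) if (d b).1 then 0
    else (-1) ^+ b * dual_deriv (d b) (F (fun i => d (lift b i))) g.

Lemma coef_dbar_combination k (F : ('I_k -> idx) -> V -> R[i]) d g :
  (forall c, smooth (F c)) ->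
  coef d (combination psi (dbar_coef F)) g =
  dbar_sum (fun c => coef c (combination psi F)) d g.
Proof.
move=> sF; rewrite coef_combination.
rewrite (@big_ccons _ _ _ (fun e => dbar_coef F e g * delta_det e d)).
under eq_bigr do under eq_bigr do rewrite delta_det_ccons mulr_sumr.
under eq_bigr do rewrite exchange_big /=.
rewrite exchange_big /=; apply: eq_bigr => b _.
rewrite (bigD1 (d b)) //= [X in _ + X]big1 ?addr0 => [|z zd]; last first.
  by apply: big1 => c _; rewrite (negPf zd) mul0r mulr0.
rewrite eqxx /dbar_coef; case: ifP => db.
  by apply: big1 => c _; rewrite ccons0 db mul0r.
rewrite (_ : coef _ _ = fun g => \sum_(c : {ffun 'I_k -> idx})
    delta_det c (fun i => d (lift b i)) * F c g); last first.
  apply/funext => h; rewrite coef_combination; apply: eq_bigr => c _.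
  by rewrite mulrC.
rewrite dual_deriv_sum => [|c]; last exact: smoothZ.
rewrite mulr_sumr; apply: eq_bigr => c _.
by rewrite ccons0 db ccons_comp_lift mul1r dual_derivZ // mulrC mulrA.
Qed.

Lemma combination_coef k (om : form k) : spanned psi om ->
  om = combination psi (fun c g => k`!%:R^-1 * coef c om g).
Proof.
move=> /spanned_coef {1}->; apply/funext => g; apply/funext => v.
rewrite [LHS](_ : _ = k`!%:R^-1 * combination psi (fun c => coef c om) g v) //.
by rewrite /combination mulr_sumr; apply: eq_bigr => c _; rewrite mulrA.
Qed.

Lemma is_dbar_coef p k (om : form k) : (p <= k)%N -> bidegree psi p om ->
  smooth_form om ->
  is_dbar psi p om (combination psi (dbar_coef (fun c g => k`!%:R^-1 * coef c om g))).
Proof.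
move=> pk bom som; rewrite {1}(combination_coef (bidegree_spanned bom)).
apply: is_dbar_combination => [c|c cp g].
  by apply: smoothZ; exact: smooth_coef.
by rewrite (bidegree_coef _ pk bom) // mulr0.
Qed.

Lemma coef_dbar p k (om : form k) eta d g : (p <= k)%N -> bidegree psi p om ->
  smooth_form om -> is_dbar psi p om eta ->
  coef d eta g = dbar_sum (fun c => coef c om) d g.
Proof.
move=> pk bom som deta; rewrite (is_dbar_unique pk deta (is_dbar_coef pk bom som)).
rewrite coef_dbar_combination => [|c]; last by apply: smoothZ; exact: smooth_coef.
by rewrite -(combination_coef (bidegree_spanned bom)).
Qed.

End Dbar.

(** * Factors of automorphy *)

Section LeftTranslations.
Context {R : realType} {s t : nat}.
Variable psi : 'I_t -> {linear 'rV[R]_s -> Rcomplex R}.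
Local Notation V := (@OTgroup R s t).
Local Notation form := (@Defs.form R s t).
Local Notation gen := (gen psi).
Local Notation chr := (chr psi).
Local Notation idx := (@idx s t).
Local Notation mul := (OTmul psi).

Lemma continuous_coordinate j e : continuous (coordinate j e : V -> R).
Proof.
have cx : continuous (@xc R s t) := continuous_xc.
have cy : continuous (@yc R s t).
  move=> g; apply: (@continuous_comp _ _ _ fst snd); first exact: cvg_fst.
  exact: cvg_snd.
have cr : continuous (fun g : V => g.2.1).
  move=> g; apply: (@continuous_comp _ _ _ snd fst); first exact: cvg_snd.
  exact: cvg_fst.
have ci : continuous (fun g : V => g.2.2).
  move=> g; apply: (@continuous_comp _ _ _ snd snd); first exact: cvg_snd.
  exact: cvg_snd.
rewrite /coordinate => g; case: (fintype.split j) => i; case: e.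
- apply: (@continuous_comp _ _ _ (@yc R s t) (fun x : 'rV[R]_s => x 0 i));
    [exact: cy | exact: coord_continuous].
- apply: (@continuous_comp _ _ _ (@xc R s t) (fun x : 'rV[R]_s => x 0 i));
    [exact: cx | exact: coord_continuous].
- apply: (@continuous_comp _ _ _ (fun g : V => g.2.2) (fun x : 'rV[R]_t => x 0 i));
    [exact: ci | exact: coord_continuous].
- apply: (@continuous_comp _ _ _ (fun g : V => g.2.1) (fun x : 'rV[R]_t => x 0 i));
    [exact: cr | exact: coord_continuous].
Qed.

Lemma linear_ccontinuous (l : V -> R[i]) :
  (forall x v (h : R), l (x + h *: v) = l x + h%:C%C * l v) -> ccontinuous l.
Proof.
move=> ll; have l0 : l 0 = 0.
  have l1 := ll 0 0 1; rewrite scale1r addr0 mul1r in l1.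
  by apply: (addrI (l 0)); rewrite addr0 -l1.
have E g : l g = \sum_j \sum_(e : bool) (coordinate j e g)%:C%C * l (tangent j e).
  have lD u v : l (u + v) = l u + l v by rewrite -[v]scale1r ll scale1r mul1r.
  have lZ a v : l (a *: v) = a%:C%C * l v by rewrite -[a *: v]add0r ll l0 add0r.
  rewrite {1}(tangent_decomposition g) (big_morph l lD l0); apply: eq_bigr => j _.
  by rewrite (big_morph l lD l0); apply: eq_bigr => e _; rewrite lZ.
rewrite (_ : l = fun g => \sum_j \sum_(e : bool) (coordinate j e g)%:C%C * l (tangent j e));
  last exact/funext.
apply: ccontinuous_sum => j _; apply: ccontinuous_sum => e _.
apply: ccontinuousM; last exact: ccontinuous_cst.
split=> g /=; [exact: continuous_coordinate | exact: cvg_cst].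
Qed.

Lemma continuous_sumv (I : Type) (r : seq I) (F : I -> V -> V) :
  (forall i, continuous (F i)) -> continuous (fun g => \sum_(i <- r) F i g).
Proof.
move=> cF; elim: r => [|i r IH] g.
  by under eq_fun do rewrite big_nil; exact: cvg_cst.
under eq_fun do rewrite big_cons.
by apply: cvgD; [exact: cF | exact: IH].
Qed.

(** Finite dimension enters through [tangent_decomposition]: [T] is a finite sum of coordinates
    times fixed vectors. *)
Lemma affine_continuous (T L : V -> V) :
  (forall x v (h : R), T (x + h *: v) = T x + h *: L v) -> continuous T.
Proof.
move=> TL; have LD u v : L (u + v) = L u + L v.
  apply: (addrI (T 0)); rewrite -[L (u + v)]scale1r -TL scale1r add0r.
  by rewrite -[v]scale1r TL -[u]add0r -{1}[u]scale1r TL add0r !scale1r addrA.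
have L0 : L 0 = 0 by apply: (addrI (L 0)); rewrite -LD !addr0.
have LZ a v : L (a *: v) = a *: L v.
  apply: (addrI (T 0)); rewrite -TL -[a *: v]scale1r TL scale1r; congr (_ + _).
  by rewrite scale1r.
have E : T = fun g => T 0 + \sum_j \sum_(e : bool) coordinate j e g *: L (tangent j e).
  apply/funext => g; rewrite -[g in LHS]add0r -[g in LHS]scale1r TL scale1r; congr (_ + _).
  rewrite {1}(tangent_decomposition g) (big_morph L LD L0); apply: eq_bigr => j _.
  by rewrite (big_morph L LD L0); apply: eq_bigr => e _; rewrite LZ.
rewrite E => g; apply: cvgD; first exact: cvg_cst.
apply: continuous_sumv => j; apply: continuous_sumv => e {}g.
by apply: cvgZ; [exact: continuous_coordinate | exact: cvg_cst].
Qed.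

Lemma zc_OTpoint (x y : 'rV[R]_s) (z : 'I_t -> R[i]) k : zc (OTpoint x y z) k = z k.
Proof. by rewrite /zc /= !mxE; case: (z k). Qed.

Definition translation_diff (gam v : V) : V :=
  OTpoint (xc v) (\row_i (expR (xc gam 0 i) * yc v 0 i))
    (fun k => cexp (psi k (xc gam)) * zc v k).

Lemma OTmul_affine gam x v (h : R) :
  mul gam (x + h *: v) = mul gam x + h *: translation_diff gam v.
Proof.
case: gam x v => [[g1 g2] [g3 g4]] [[x1 x2] [x3 x4]] [[v1 v2] [v3 v4]].
rewrite /OTmul /translation_diff /OTpoint /xc /yc /zc /=.
congr (_, _, (_, _)); apply/rowP => i; rewrite !mxE /= ?reimE /=; ring.
Qed.

Lemma continuous_OTmul gam : continuous (mul gam).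
Proof. exact: (affine_continuous (OTmul_affine gam)). Qed.

Lemma smooth_OTmul gam f : smooth f -> smooth (fun g => f (mul gam g)).
Proof. exact: (smooth_affine (OTmul_affine gam) (@continuous_OTmul gam)). Qed.

Lemma deriveC_OTmul gam f g v : smooth f ->
  deriveC (fun g => f (mul gam g)) g v = deriveC f (mul gam g) (translation_diff gam v).
Proof. exact: (deriveC_affine (OTmul_affine gam)). Qed.

Lemma derive_OTmul gam g v : 'D_v (mul gam) g = translation_diff gam v.
Proof. exact: (derive_affine (OTmul_affine gam)). Qed.

(** [theta] is left-invariant, and only the character in front of it changes under translation. *)
Lemma gen_OTmul c gam g v :
  gen c (mul gam g) (translation_diff gam v) = chr c gam * gen c g v.
Proof.
case: c => [a j]; have [[i ->]|[k ->]] := ord_split j; case: a;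
  rewrite !genE /chr /char1 /char2 /= ?split_lshift ?split_rshift /=.
- rewrite /OTmul /translation_diff /OTpoint /xc /yc /= !mxE expRD.
  by apply: complex_ext; rewrite !reimE /=; ring.
- rewrite /OTmul /translation_diff /OTpoint /xc /yc /= !mxE mul1r opprD expRD.
  have := expRxMexpNx_1 (gam.1.1 0 i).
  move: (expR _) (expR (- _)) => a b ab; congr (_ +i* - _)%C.
  by rewrite mulrACA [b * a]mulrC ab mul1r.
- by rewrite zc_OTpoint.
- by rewrite zc_OTpoint rmorphM cexp_conj.
Qed.

Lemma dual_deriv_OTmul z gam f g : smooth f ->
  dual_deriv z (fun g => f (mul gam g)) g = chr z gam * dual_deriv z f (mul gam g).
Proof.
move=> sf; rewrite {1}/dual_deriv; under eq_bigr do rewrite deriveC_OTmul // (deriveC_gen psi) //.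
under eq_bigr do under eq_bigr do rewrite gen_OTmul.
under eq_bigr do rewrite mulr_sumr.
rewrite exchange_big /=; transitivity (\sum_c chr c gam * dual_deriv c f (mul gam g) * (c == z)%:R).
  apply: eq_bigr => c _; rewrite -(gen_dual psi c z g) mulr_sumr.
  by apply: eq_bigr => e _; ring.
rewrite (bigD1 z isT) big1 => [|c cz]; last by rewrite (negbTE cz) mulr0.
by rewrite /= addr0 [z == z]eqxx mulr1.
Qed.

(* The elements of A_(G,N), without smoothness, so that inverses are at hand. *)
Record abelian_char (al : V -> R[i]) : Prop := AbelianChar {
  ac_neq0 : forall g, al g != 0;
  ac_mul : forall g h, al (mul g h) = al g * al h;
  ac_nil : forall g, xc g = 0 -> al g = 1 }.

Lemma char_of_G_abelian al : char_of_G psi al -> abelian_char al.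
Proof. by case=> *; split. Qed.

Lemma abelian_charM al be : abelian_char al -> abelian_char be ->
  abelian_char (fun g => al g * be g).
Proof.
move=> [a1 a2 a3] [b1 b2 b3]; split=> [g|g h|g g0]; first by rewrite mulf_neq0.
  by rewrite a2 b2 mulrACA.
by rewrite a3 // b3 // mulr1.
Qed.

Lemma abelian_charV al : abelian_char al -> abelian_char (fun g => (al g)^-1).
Proof.
move=> [a1 a2 a3]; split=> [g|g h|g g0]; first by rewrite invr_eq0.
  by rewrite a2 invfM.
by rewrite a3 // invr1.
Qed.

Lemma abelian_char1 : abelian_char (fun=> 1).
Proof. by split=> [g|g h|g _]; rewrite ?oner_neq0 ?mulr1. Qed.

Lemma abelian_char_prod (I : Type) (r : seq I) (al : I -> V -> R[i]) :
  (forall i, abelian_char (al i)) -> abelian_char (fun g => \prod_(i <- r) al i g).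
Proof.
move=> H; elim: r => [|i r IH].
  by under eq_fun do rewrite big_nil; exact: abelian_char1.
by under eq_fun do rewrite big_cons; exact: abelian_charM.
Qed.

Lemma psi_line k (x v : V) (h : R) :
  psi k (xc (x + h *: v)) = psi k (xc x) + h%:C%C * psi k (xc v) :> R[i].
Proof.
have -> : xc (x + h *: v) = xc x + h *: xc v by [].
rewrite linearD linearZ; congr (_ + _).
by apply: complex_ext; rewrite !reimE /= ?mul0r ?subr0 ?addr0; case: (psi k _).
Qed.

Lemma char_of_G_chr c : char_of_G psi (chr c).
Proof.
split=> [|g|g h|g g0]; last 3 first.
- exact: chr_neq0.
- case: c => [[] j]; rewrite /chr /char1 /char2 /=; have [[i ->]|[k ->]] := ord_split j;
    rewrite ?split_lshift ?split_rshift /OTmul /OTpoint /xc /= ?mulr1 //.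
  + by rewrite !mxE expRD rmorphM.
  + by rewrite linearD cexpD.
  + by rewrite linearD -cexpD -rmorphD.
- case: c => [[] j]; rewrite /chr /char1 /char2 /=; have [[i ->]|[k ->]] := ord_split j;
    rewrite ?split_lshift ?split_rshift ?g0 ?mxE ?expR0 ?linear0 ?cexp0 //.
  by rewrite rmorph0 cexp0.
have sz k : smooth (fun g : V => cexp (psi k (xc g) : R[i])).
  apply: smooth_cexp_lin; first exact: psi_line.
  by apply: linear_ccontinuous; exact: psi_line.
case: c => [[] j]; rewrite /chr /char1 /char2 /=; have [[i ->]|[k ->]] := ord_split j;
  rewrite ?split_lshift ?split_rshift //.
- have := @smooth_xexp R s t 1 i; rewrite /xexp; congr smooth.
  by apply/funext => g; rewrite mul1r.
- exact: smooth_cst.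
- have L (x v : V) (h : R) : (psi k (xc (x + h *: v)) : R[i])^* =
      (psi k (xc x) : R[i])^* + h%:C%C * (psi k (xc v) : R[i])^*.
    by rewrite psi_line rmorphD rmorphM; congr (_ + _ * _); apply: complex_ext; rewrite !reimE /= ?oppr0.
  by apply: smooth_cexp_lin; last apply: linear_ccontinuous.
Qed.

(* The factor of automorphy of the coefficient of [wedge (gen \o c)] in a form with
   values in the line bundle of [al]. *)
Definition multiplicator (al : V -> R[i]) k (c : 'I_k -> idx) (g : V) : R[i] :=
  al g * (\prod_i chr (c i) g)^-1.

Lemma abelian_char_multiplicator al k (c : 'I_k -> idx) : abelian_char al ->
  abelian_char (multiplicator al c).
Proof.
move=> ha; apply: abelian_charM => //; apply: abelian_charV.
by apply: abelian_char_prod => i; apply: char_of_G_abelian; exact: char_of_G_chr.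
Qed.

Lemma multiplicator_ccons al k z (c : 'I_k -> idx) g :
  multiplicator al (ccons z c) g * chr z g = multiplicator al c g.
Proof.
rewrite /multiplicator big_ord_recl ccons0 invfM mulrA mulrAC.
have -> : \prod_(i < k) chr (ccons z c (lift ord0 i)) g = \prod_(i < k) chr (c i) g.
  by apply: eq_bigr => i _; rewrite cconsS.
by rewrite mulfVK ?chr_neq0 // mulrAC.
Qed.

Lemma multiplicator_lift al k (d : 'I_k.+1 -> idx) b g :
  multiplicator al (fun i => d (lift b i)) g = multiplicator al d g * chr (d b) g.
Proof.
rewrite /multiplicator [in RHS](bigD1_ord b) //= invfM -mulrA; congr (_ * _).
by rewrite mulrAC mulVf ?mul1r // chr_neq0.
Qed.

Lemma multiplicator_perm al k (c : 'I_k -> idx) (sg : 'S_k) :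
  multiplicator al (fun i => c (sg i)) = multiplicator al c.
Proof.
apply/funext => g; rewrite /multiplicator; congr (_ * _^-1).
by rewrite [RHS](reindex_inj (@perm_inj _ sg)).
Qed.

Section EquivariantFamilies.
Variables (Gam : set V) (al : V -> R[i]).

(** The coefficient families of (p, k - p)-forms with values in the line bundle of [al]. *)
Record equivariant_family (p k : nat) (F : ('I_k -> idx) -> V -> R[i]) : Prop :=
  EquivariantFamily {
    ef_smooth : forall c, smooth (F c);
    ef_alternating : alternating F;
    ef_type : forall c, type_count c <> p -> forall g, F c g = 0;
    ef_equivariant : forall c gam, Gam gam -> forall g,
      F c (mul gam g) = multiplicator al c gam * F c g }.

Lemma pull_combination k (F : ('I_k -> idx) -> V -> R[i]) gam :
  pull psi gam (combination psi F) =
  combination psi (fun c g => (\prod_i chr (c i) gam) * F c (mul gam g)).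
Proof.
apply/funext => g; apply/funext => v; rewrite /pull /combination.
apply: eq_bigr => c _; rewrite [_ * F c _]mulrC -mulrA; congr (_ * _).
rewrite -(@wedge_scale _ _ _ _ (fun i _ => chr (c i) gam)) /wedge; congr (\det _).
by apply/matrixP => i j; rewrite !mxE derive_OTmul gen_OTmul.
Qed.

Lemma pull_scale k a (om : form k) gam : pull psi gam (a *: om) = a *: pull psi gam om.
Proof. by apply/funext => g; apply/funext. Qed.

Lemma equivariant_family_coef p q (chi : Gam -> R[i]) (om : form (q + p)) :
  abelian_char al -> (forall gam : Gam, chi gam = al (val gam)) ->
  @E_form _ _ _ psi Gam p q chi om -> equivariant_family p (fun c => coef c om).
Proof.
move=> ha chiE [bom som eom]; have sp := bidegree_spanned bom.
split=> [c|||c gam Ggam g].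
- exact: smooth_coef.
- exact: alternating_coef sp.
- move=> c cp g; apply: (bidegree_coef _ _ bom cp); exact: leq_addl.
have := eom (exist _ gam (mem_set Ggam)); rewrite chiE /=.
rewrite {1}(spanned_coef sp) pull_scale pull_combination => E.
have := congr1 (fun om => coef c om g) E; rewrite /= coef_alternating; last first.
  move=> sg d h; rewrite (alternating_coef sp) mulrCA; congr (_ * (_ * _)).
  by rewrite [RHS](reindex_inj (@perm_inj _ sg)).
rewrite coef_scale /multiplicator => {}E.
have P0 : \prod_i chr (c i) gam != 0 by apply/prodf_neq0 => i _; exact: chr_neq0.
by rewrite mulrAC -E mulrC mulrA mulVf // mul1r.
Qed.

Lemma E_form_combination p q (chi : Gam -> R[i]) F :
  (forall gam : Gam, chi gam = al (val gam)) ->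
  @equivariant_family p (q + p) F ->
  @E_form _ _ _ psi Gam p q chi ((q + p)`!%:R^-1 *: combination psi F).
Proof.
move=> chiE [sF aF tF eF]; split.
- rewrite -[_ *: _]addr0; apply: bidegree_lin; last exact: bidegree0.
  exact: combination_bidegree.
- move=> v; apply: smoothZ; exact: (smooth_combination psi sF v).
move=> gam; rewrite pull_scale pull_combination scalerA mulrC -scalerA; congr (_ *: _).
apply/funext => g; apply/funext => v.
rewrite [RHS](_ : _ = chi gam * combination psi F g v) // /combination mulr_sumr.
apply: eq_bigr => c _; rewrite mulrA; congr (_ * _).
rewrite eF ?/multiplicator; last exact: set_mem (valP gam).
have P0 : \prod_i chr (c i) (val gam) != 0 by apply/prodf_neq0 => i _; exact: chr_neq0.
by rewrite chiE mulrA mulrCA mulfV // mulr1.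
Qed.

End EquivariantFamilies.
End LeftTranslations.

(** * Operators along the fibers and the base of the solvmanifold *)

Section FiberOperators.
Context {R : realType} {s t : nat}.
Variable psi : 'I_t -> {linear 'rV[R]_s -> Rcomplex R}.
Local Notation V := (@OTgroup R s t).
Local Notation mul := (OTmul psi).
Implicit Types (f : V -> R[i]) (O : (V -> R[i]) -> V -> R[i]).

Definition nil_invariant f : Prop := forall g h, xc g = xc h -> f g = f h.

Lemma OTmul_nil h g : xc h = 0 -> mul h g = g + h.
Proof.
move=> h0; rewrite /OTmul h0 add0r.
have -> : (fun k => zc h k + cexp (psi k 0) * zc g k) = (fun k => zc g k + zc h k).
  by apply/funext => k; rewrite linear0 cexp0 mul1r addrC.
case: h g h0 => [[h1 h2] [h3 h4]] [[g1 g2] [g3 g4]]; rewrite /xc /= => ->.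
rewrite /OTpoint /yc /zc /=.
congr (_, _, (_, _)); rewrite /= ?addr0 //; apply/rowP => i; rewrite !mxE //.
by rewrite expR0 mul1r addrC.
Qed.

Variable Gam : set V.

Definition nil_periodic f : Prop :=
  forall gam, Gam gam -> xc gam = 0 -> forall g, f (g + gam) = f g.

(* Operators along the fibers of [x], scaling factors of automorphy by [w]. *)
Record fiber_op (w : V -> R[i]) O : Prop := FiberOp {
  fo_smooth : forall f, smooth f -> nil_periodic f -> smooth (O f);
  fo_add : forall f f' g, smooth f -> nil_periodic f -> smooth f' -> nil_periodic f' ->
    O (fun g => f g + f' g) g = O f g + O f' g;
  fo_mul : forall c f g, smooth f -> nil_periodic f -> smooth c -> nil_invariant c ->
    O (fun g => c g * f g) g = c g * O f g;
  fo_deriveC : forall f g v, smooth f -> nil_periodic f ->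
    deriveC (O f) g v = O (fun g => deriveC f g v) g;
  fo_automorphic : forall f gam k, smooth f -> nil_periodic f -> Gam gam ->
    (forall g, f (mul gam g) = k * f g) ->
    forall g, O f (mul gam g) = k * w gam * O f g }.

(** The weight [chr psi z] of [A] is what contraction with the index [z] takes away from the
    [multiplicator], so [A] after contraction preserves the line bundle. *)
Record fiber_homotopy (z : @idx s t) (M A : (V -> R[i]) -> V -> R[i]) : Prop :=
  FiberHomotopy {
    fh_type : z.1 = false;
    fh_mean : fiber_op (fun=> 1) M;
    fh_primitive : fiber_op (chr psi z) A;
    fh_invariant : forall f, smooth f -> nil_periodic f -> nil_invariant (M f);
    fh_mean_id : forall f, smooth f -> nil_invariant f -> M f = f;
    fh_homotopy : forall f, smooth f -> nil_periodic f ->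
      f = (fun g => M f g + dual_deriv z (A f) g) }.

End FiberOperators.

(** * The torus fibers and the lattice of algebraic integers *)

Section NumberFieldLattice.
Context {R : realType} {s t : nat} {K : fieldExtType rat}.
Variable sigma : 'I_(s + (t + t)) -> {rmorphism K -> R[i]}.
Hypothesis sigmaP : is_embedding_list sigma.
Variable U : set K.
Hypothesis UP : admissible sigma U.
Variable psi : 'I_t -> {linear 'rV[R]_s -> Rcomplex R}.
Hypothesis psiP : forall u k, U u -> cexp (psi k (log_vec sigma u)) = sigma_cplx sigma k u.
Local Notation V := (@OTgroup R s t).
Local Notation mul := (OTmul psi).
Local Notation N := (s + (t + t))%N.
Local Notation Gam := (OTlattice sigma U : set V).

Definition nil_vec (a : K) : V :=
  OTpoint 0 (\row_i sigma_real sigma i a) (fun k => sigma_cplx sigma k a).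

Lemma sigma_lshift i a : sigma (lshift (t + t) i) a = (sigma_real sigma i a)%:C%C.
Proof. by case: sigmaP => _ im0 _ _; apply: complex_ext => //=; exact: im0. Qed.

Lemma sigma_conjE k a : sigma_conj sigma k a = (sigma_cplx sigma k a)^*.
Proof. by case: sigmaP => _ _ _ ->; apply: complex_ext; rewrite !reimE ?opprK. Qed.

Lemma admissible1 : U 1.
Proof.
have [_ [u [_ _ ->]] _] := UP; exists [ffun=> 0] => //.
by apply: big1 => i _; rewrite ffunE expr0z.
Qed.

Lemma log_vec1 : log_vec sigma 1 = 0 :> 'rV[R]_s.
Proof. by apply/rowP => i; rewrite !mxE /sigma_real rmorph1 /= ln1. Qed.

Lemma lattice_nil_vec a : ring_of_integers a -> Gam (nil_vec a).
Proof. by move=> ha; exists 1; [exact: admissible1 | exists a; rewrite ?log_vec1]. Qed.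

Lemma exp_log_vec u i : U u -> expR (log_vec sigma u 0 i) = sigma_real sigma i u.
Proof.
move=> Uu; have [Upos _ _] := UP; have [_ _ _ pos] := Upos _ Uu.
by rewrite mxE lnK // posrE.
Qed.

Lemma ring_of_integersM (a b : K) : ring_of_integers a -> ring_of_integers b ->
  ring_of_integers (a * b).
Proof. exact: (@integral_mul _ _ intr). Qed.

Lemma translation_diff_nil_vec u gam a : U u -> xc gam = log_vec sigma u ->
  translation_diff psi gam (nil_vec a) = nil_vec (u * a).
Proof.
move=> Uu xg; rewrite /translation_diff /nil_vec.
congr OTpoint; last first.
  by apply/funext => k; rewrite zc_OTpoint xg psiP // rmorphM.
apply/rowP => i; rewrite !mxE xg exp_log_vec // /yc /= ?mxE.
have := sigma_lshift i (u * a); rewrite rmorphM !sigma_lshift -rmorphM /=.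
by case.
Qed.

(** The complex coordinates y_i, z_k, \bar z_k of N, in which the lattice point of [a] has all the
    conjugates [sigma i a] as coordinates. *)
Definition nil_coord (i : 'I_N) (v : V) : R[i] :=
  match fintype.split i with
  | inl i => (yc v 0 i)%:C%C
  | inr k => match fintype.split k with inl k => zc v k | inr k => (zc v k)^* end
  end.

(* The derivatives dual to [nil_coord]: d/dy_i, d/dz_k and d/d\bar z_k. *)
Definition nil_deriv (i : 'I_N) (f : V -> R[i]) (g : V) : R[i] :=
  match fintype.split i with
  | inl i => deriveC f g (tangent (lshift t i) true)
  | inr k => match fintype.split k with
             | inl k => dual_deriv (true, rshift s k) f g
             | inr k => dual_deriv (false, rshift s k) f g
             end
  end.

Lemma deriveC_nil f g v : smooth f -> xc v = 0 ->
  deriveC f g v = \sum_i nil_coord i v * nil_deriv i f g.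
Proof.
move=> sf xv; rewrite {1}(tangent_decomposition v).
rewrite (big_morph (deriveC f g) (fun u w => deriveC_dirD g u w sf) (deriveC_dir0 g sf)).
rewrite [LHS]big_split_ord [RHS]big_split_ord [X in _ = _ + X]big_split_ord /=.
congr (_ + _).
  apply: eq_bigr => i _; rewrite deriveC_dir_sum // big_bool /=.
  rewrite /nil_coord /nil_deriv /coordinate split_lshift (unsplitK (inl i)).
  by rewrite xv mxE mul0r addr0.
rewrite -big_split /=; apply: eq_bigr => k _; rewrite deriveC_dir_sum // big_bool /=.
rewrite /nil_coord /nil_deriv /coordinate split_rshift !(unsplitK (inr _)).
rewrite !(unsplitK (inl k)) /dual_deriv /dual_coef !big_bool /=.
rewrite split_rshift /zc /=.
move: (deriveC f g _) (deriveC f g _) (v.2.1 0 k) (v.2.2 0 k) => D D' x y.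
apply: complex_ext; rewrite !reimE /=; lra.
Qed.

Lemma nil_coord_vec i a : nil_coord i (nil_vec a) = sigma i a.
Proof.
rewrite /nil_coord -{2}(splitK i); case: (fintype.split i) => j /=.
  by rewrite sigma_lshift /yc /= mxE.
rewrite -{2}(splitK j); case: (fintype.split j) => k /=; rewrite zc_OTpoint //.
by rewrite -sigma_conjE.
Qed.

Variables (b : 'I_N -> K) (B : 'I_N -> 'M[int]_N).
Hypothesis b_span : forall x : K, exists c : 'I_N -> rat, x = \sum_j c j *: b j.
Hypothesis bB : forall i j, b i * b j = \sum_k (B i k j)%:~R * b k.

Let sigma_inj : forall i j, sigma i =1 sigma j -> i = j.
Proof. by case: sigmaP. Qed.

Local Notation S := (embedding_mx sigma b).
Local Notation bV := (fun j => nil_vec (b j)).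

Lemma lattice_basis_vec j : Gam (bV j).
Proof. exact/lattice_nil_vec/(structure_basis_integral b_span bB). Qed.

(** The embedding matrix expresses derivatives along lattice vectors through coordinate derivatives;
    this is its inversion. *)
Lemma nil_derivE i f g : smooth f ->
  nil_deriv i f g = \sum_j invmx S j i * deriveC f g (bV j).
Proof.
move=> sf.
transitivity (\sum_l (S *m invmx S) l i * nil_deriv l f g).
  rewrite mulmxV ?embedding_mx_unit //.
  rewrite (bigD1 i) //= mxE eqxx mul1r big1 ?addr0 // => l /negPf li.
  by rewrite mxE li mul0r.
under [RHS]eq_bigr do rewrite deriveC_nil // mulr_sumr.
rewrite exchange_big /=; apply: eq_bigr => l _; rewrite !mxE mulr_suml.
by apply: eq_bigr => j _; rewrite nil_coord_vec !mxE; ring.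
Qed.

Lemma flat_deriveC f g v : smooth f -> flat bV f -> xc v = 0 -> deriveC f g v = 0.
Proof.
move=> sf ff xv; rewrite deriveC_nil //; apply: big1 => i _.
by rewrite nil_derivE // big1 ?mulr0 // => j _; rewrite ff mulr0.
Qed.

Lemma flat_nil_invariant f : smooth f -> flat bV f -> nil_invariant f.
Proof.
move=> sf ff g h gh; rewrite -[h](subrK g) addrC; apply/esym.
apply: deriveC_line_cst => r; apply: is_deriveC_eq; first exact: smooth_is_deriveC.
apply: flat_deriveC => //; apply/rowP => i.
have -> : xc (h - g) = xc h - xc g by [].
by rewrite gh subrr.
Qed.

Lemma nil_invariant_flat f : nil_invariant f -> flat bV f.
Proof.
move=> inv j g; apply/is_deriveC_val/is_deriveC_at0.
rewrite (_ : (fun r : R => _) = fun=> f g); first exact: is_deriveC_cst.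
apply/funext => r; apply: inv; rewrite /xc /=.
by apply/rowP => i; rewrite !mxE mulr0 addr0.
Qed.

Variable k0 : 'I_t.
Local Notation z0 := ((false, rshift s k0) : @idx s t).
Local Notation W := (fun j => invmx S j (rshift s (rshift t k0))).

(** [W] is the column of the inverse embedding matrix at the [k0]-th conjugate embedding, so the
    divisors are the values covered by [dual_lattice_bound], times 2 pi i. *)
Lemma cderive_conj f g : smooth f -> cderive bV W f g = dual_deriv z0 f g.
Proof.
move=> sf; rewrite /cderive -nil_derivE // /nil_deriv.
by rewrite (unsplitK (inr (rshift t k0))) (unsplitK (inr k0)).
Qed.

Lemma freqE (m : int) : freq m = (0 +i* (2 * pi))%C * m%:~R :> R[i].
Proof.
have -> : m%:~R = (m%:~R : R)%:C%C :> R[i] by rewrite rmorph_int.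
by apply: complex_ext; rewrite /freq !reimE /=; ring.
Qed.

Lemma lattice_divisor_bound : exists (C : R) (p : nat), forall m, m <> (fun=> 0) ->
  divisor_at W m != 0 /\ cnorm (divisor_at W m)^-1 <= C * \prod_j (@jap R (m j)) ^+ p.
Proof.
have [C [p H]] := dual_lattice_bound sigma_inj b_span bB.
pose c : R[i] := (0 +i* (2 * pi))%C.
exists (cnorm c^-1 * C), p => m m0; have [r0 rC] := H m m0 (rshift s (rshift t k0)).
have c0 : c != 0.
  by rewrite eq_complex /= eqxx /= mulf_neq0 // ?gt_eqF // pi_gt0.
have -> : divisor_at W m = c * \sum_j (m j)%:~R * invmx S j (rshift s (rshift t k0)).
  rewrite /divisor_at mulr_sumr; apply: eq_bigr => j _.
  by rewrite freqE -/c; ring.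
split; first by rewrite mulf_neq0.
rewrite invfM; apply: le_trans (cnormM _ _) _.
by rewrite -mulrA; apply: ler_wpM2l => //; exact: cnorm_ge0.
Qed.

Lemma nil_periodic_basis f : nil_periodic Gam f -> periodic bV f.
Proof. by move=> pf j x; apply: pf => //; exact: lattice_basis_vec. Qed.

Section Automorphy.
Variables (f : V -> R[i]) (gam : V) (k : R[i]).
Hypotheses (sf : smooth f) (pf : nil_periodic Gam f) (Ggam : Gam gam).
Hypothesis fgam : forall g, f (mul gam g) = k * f g.

Lemma lattice_automorphic :
  (forall g, antiderive bV W f (mul gam g) = k * chr psi z0 gam * antiderive bV W f g) /\
  (forall g, mean bV f (mul gam g) = k * mean bV f g).
Proof.
have [C [p db]] := lattice_divisor_bound; have pb := nil_periodic_basis pf.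
case: Ggam => u Uu [a ha gamE]; have xg : xc gam = log_vec sigma u by rewrite gamE.
have Uint : ring_of_integers u by have [/(_ _ Uu)[]] := UP.
(* Left translation by [gam] turns the shift by [nil_vec (b j)] into that by [nil_vec (u * b j)].
   The product [u * b j] is integral, so [f] is invariant under this shift whether or not it lies in
   the integer span of the basis. *)
apply: (equivariant_antiderive db (c := fun j => nil_vec (u * b j))) => //.
- exact: chr_neq0.
- by move=> g; exact: smooth_OTmul.
- move=> g x sg; rewrite !cderive_conj //; last exact: smooth_OTmul.
  exact: dual_deriv_OTmul.
- move=> g sg fg; apply: nil_invariant_flat => x y xy.
  apply: (flat_nil_invariant sg fg); rewrite /OTmul /OTpoint /xc /=.
  by congr (_ + _).
- move=> j x; rewrite -[bV j]scale1r OTmul_affine scale1r.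
  by rewrite (translation_diff_nil_vec _ Uu xg).
- move=> j x; apply: pf => //; apply: lattice_nil_vec; apply: ring_of_integersM => //.
  exact: (structure_basis_integral b_span bB).
Qed.

End Automorphy.

Lemma lattice_fiber_homotopy :
  fiber_homotopy psi Gam z0 (mean bV) (antiderive bV W).
Proof.
have [C [p db]] := lattice_divisor_bound.
split=> //.
- split=> [f sf _|f f' g sf _ sf' _|c f g sf _ sc ic|f g v sf _|f gam k sf pf Gg fk g].
  + exact: smooth_mean.
  + exact: meanD.
  + by apply: meanM => //; exact: nil_invariant_flat.
  + exact: deriveC_mean.
  + by rewrite mulr1; have [_ ->] := lattice_automorphic sf pf Gg fk.
- split=> [f sf /nil_periodic_basis pf|f f' g sf /nil_periodic_basis pf sf' /nil_periodic_basis pf'|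
    c f g sf /nil_periodic_basis pf sc ic|f g v sf /nil_periodic_basis pf|f gam k sf pf Gg fk g].
  + exact: (smooth_antiderive db).
  + exact: (antideriveD db).
  + by apply: (antideriveM db) => //; exact: nil_invariant_flat.
  + exact: (deriveC_antiderive db).
  + by have [-> _] := lattice_automorphic sf pf Gg fk.
- move=> f sf /nil_periodic_basis pf; apply: flat_nil_invariant; first exact: smooth_mean.
  exact: flat_mean.
- move=> f sf /nil_invariant_flat ff; apply/funext => g; exact: mean_flat.
- move=> f sf /nil_periodic_basis pf; rewrite {1}(mean_antiderive db sf pf).
  apply/funext => g; congr (_ + _); apply: cderive_conj; exact: (smooth_antiderive db).
Qed.

End NumberFieldLattice.

Section LatticeDirections.
Context {R : realType} {s t : nat} {K : fieldExtType rat}.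
Variable sigma : 'I_(s + (t + t)) -> {rmorphism K -> R[i]}.
Hypothesis sigmaP : is_embedding_list sigma.
Variable U : set K.
Hypothesis UP : admissible sigma U.
Variable psi : 'I_t -> {linear 'rV[R]_s -> Rcomplex R}.
Hypothesis psiP : forall u k, U u -> cexp (psi k (log_vec sigma u)) = sigma_cplx sigma k u.
Local Notation V := (@OTgroup R s t).
Local Notation Gam := (OTlattice sigma U : set V).

Lemma exists_fiber_homotopy : \dim {:K} = (s + (t + t))%N -> (0 < t)%N ->
  exists z M A, fiber_homotopy psi Gam z M A.
Proof.
move=> dimK t0; have [b [B [b_span bB]]] := integral_structure_basis dimK.
do 3 eexists.
exact: (lattice_fiber_homotopy sigmaP UP psiP b_span bB (Ordinal t0)).
Qed.

Lemma exists_lattice_directions :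
  exists (B : 'M[R]_s) (gam : 'I_s -> V), [/\ B \in unitmx, forall r, Gam (gam r)
    & forall r, xc (gam r) = row r B].
Proof.
have [_ _ [B Bu LB]] := UP; exists B.
have H r : exists gam, Gam gam /\ xc gam = row r B.
  have : (log_vec sigma @` U) (row r B).
    rewrite LB; exists (delta_mx 0 r) => //.
    by rewrite rowE; congr (_ *m _); apply/matrixP => i j; rewrite !mxE; case: (_ && _).
  move=> [u Uu uE]; exists (OTpoint (log_vec sigma u) (\row_i sigma_real sigma i 0)
                 (fun k => sigma_cplx sigma k 0)); split; last by rewrite -uE.
  exists u => //; exists 0 => //; rewrite /ring_of_integers /=.
  by exists 'X; [exact: monicX | rewrite map_polyX rootX].
by have [gam gamP] := choice H; exists gam; split=> // r; have [] := gamP r.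
Qed.

End LatticeDirections.

(** * The homotopy on coefficient families *)

Section TranslationComposition.
Context {R : realType} {V : normedModType R}.
Implicit Types (O : (V -> R[i]) -> V -> R[i]).

Lemma translation_op_id : translation_op (fun f : V -> R[i] => f).
Proof. by split. Qed.

Lemma translation_op_comp O O' : translation_op O -> translation_op O' ->
  translation_op (fun f => O (O' f)).
Proof.
move=> tO tO'; split=> [f sf|f x v sf|f g x sf sg|c f x sf|f c k sf fc].
- by apply: (top_smooth tO); exact: (top_smooth tO').
- rewrite (top_deriveC tO); last exact: (top_smooth tO').
  by congr (O _ x); apply/funext => y; exact: (top_deriveC tO').
- rewrite -(top_add tO); [|exact: (top_smooth tO')..].
  by congr (O _ x); apply/funext => y; exact: (top_add tO').
- rewrite -(top_scale tO); last exact: (top_smooth tO').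
  by congr (O _ x); apply/funext => y; exact: (top_scale tO').
- apply: (top_shift tO); first exact: (top_smooth tO').
  exact: (top_shift tO').
Qed.

Definition harmonics n (l : 'I_n -> V) (k : 'I_n -> R[i]) (rs : seq 'I_n) :
    (V -> R[i]) -> V -> R[i] :=
  foldr (fun r O f => harmonic (k r) (l r) (O f)) id rs.

Lemma translation_op_harmonics n (l : 'I_n -> V) k rs : translation_op (harmonics l k rs).
Proof.
elim: rs => [|r rs IH] /=; first exact: translation_op_id.
exact: (translation_op_comp (translation_op_harmonic (k r) (l r)) IH).
Qed.

Lemma deriveC_harmonics n (l : 'I_n -> V) k rs f x r : smooth f ->
  (forall r x, f (x + l r) = k r * f x) -> r \in rs ->
  deriveC (harmonics l k rs f) x (l r) = 0.
Proof.
move=> sf fl; elim: rs x => // r' rs IH x; rewrite in_cons /=.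
have trs := translation_op_harmonics l k rs; have srs := top_smooth trs sf.
have [-> _|_ /= rrs] := eqVneq r r'.
  by apply: deriveC_harmonic => // y; exact: (top_shift trs).
rewrite (top_deriveC (translation_op_harmonic _ _)) //.
rewrite (_ : (fun x => _) = fun=> 0); first exact/top_zero/translation_op_harmonic.
by apply/funext => y; exact: IH.
Qed.

Lemma harmonics_cst n (l : 'I_n -> V) k rs c : (forall r, k r = 1) ->
  harmonics l k rs (fun=> c) = fun=> c.
Proof. by move=> k1; elim: rs => //= r rs ->; rewrite k1 harmonic_cst. Qed.

End TranslationComposition.

(** * The contraction homotopy *)

Section Contraction.
Context {R : realType} {s t : nat}.
Local Notation V := (@OTgroup R s t).
Local Notation idx := (@idx s t).
Implicit Types (f : V -> R[i]) (O : (V -> R[i]) -> V -> R[i]) (P : (V -> R[i]) -> Prop).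

(** Abstracts the two settings of the homotopy: functions periodic along N for the fibers, functions
    invariant under N for the base. *)
Record function_space P : Prop := FunctionSpace {
  fs_zero : P (fun=> 0);
  fs_add : forall f f', P f -> P f' -> P (fun g => f g + f' g);
  fs_scale : forall a f, P f -> P (fun g => a * f g);
  fs_dual_deriv : forall z f, z.1 = false -> P f -> P (dual_deriv z f) }.

Record linear_on P O : Prop := LinearOn {
  lo_add : forall f f' g, P f -> P f' -> O (fun g => f g + f' g) g = O f g + O f' g;
  lo_scale : forall a f g, P f -> O (fun g => a * f g) g = a * O f g }.

Lemma lo_zero P O g : function_space P -> linear_on P O -> O (fun=> 0) g = 0.
Proof.
move=> fP lO; rewrite (_ : (fun=> 0) = fun g : V => 0 * (0 : R[i])).
  rewrite (lo_scale lO 0 (f := fun=> 0)) ?mul0r //; exact: fs_zero.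
by apply/funext => h; rewrite mul0r.
Qed.

Lemma lo_sum P O (I : Type) (r : seq I) (F : I -> V -> R[i]) g :
  function_space P -> linear_on P O -> (forall i, P (F i)) ->
  O (fun g => \sum_(i <- r) F i g) g = \sum_(i <- r) O (F i) g.
Proof.
move=> fP lO PF; have PS r' : P (fun g => \sum_(i <- r') F i g).
  elim: r' => [|i r' IH].
    by under eq_fun do rewrite big_nil; exact: fs_zero.
  by under eq_fun do rewrite big_cons; exact: fs_add.
elim: r => [|i r IH].
  by rewrite big_nil; under eq_fun do rewrite big_nil; exact: (lo_zero _ fP lO).
by rewrite big_cons -IH; under eq_fun do rewrite big_cons; exact: (lo_add lO).
Qed.

Definition dbar_term k (F : ('I_k -> idx) -> V -> R[i]) (d : 'I_k.+1 -> idx) b g : R[i] :=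
  if (d b).1 then 0 else (-1) ^+ b * dual_deriv (d b) (F (fun i => d (lift b i))) g.

Lemma dbar_term_space P k (F : ('I_k -> idx) -> V -> R[i]) d b : function_space P ->
  (forall c, P (F c)) -> P (dbar_term F d b).
Proof.
move=> fP PF; rewrite /dbar_term; case db: (d b).1; first exact: (fs_zero fP).
by apply: (fs_scale fP); exact: (fs_dual_deriv fP).
Qed.

Lemma dbar_sum_op P k (F : ('I_k -> idx) -> V -> R[i]) (O : ('I_k -> idx) -> (V -> R[i]) -> V -> R[i])
    O' (d : 'I_k.+1 -> idx) g : function_space P -> linear_on P O' -> (forall c, P (F c)) ->
  (forall b f h, (d b).1 = false -> P f ->
    dual_deriv (d b) (O (fun i => d (lift b i)) f) h = O' (dual_deriv (d b) f) h) ->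
  dbar_sum (fun c => O c (F c)) d g = O' (dbar_sum F d) g.
Proof.
move=> fP lO PF H; rewrite -[dbar_sum F d]/(fun g => \sum_b dbar_term F d b g).
rewrite (lo_sum _ _ fP lO) => [|b]; last exact: dbar_term_space.
apply: eq_bigr => b _; rewrite /dbar_term; case: ifP => db; first by rewrite (lo_zero _ fP lO).
rewrite H //; apply: (etrans _ (esym (lo_scale lO _ _ _))) => //.
exact: (fs_dual_deriv fP).
Qed.

(** Closedness evaluated with [z] in front: the leading term is the derivative along [z], and the
    others are dbar of the contraction up to sign. *)
Lemma closed_dual_deriv k (F : ('I_k.+1 -> idx) -> V -> R[i]) (d : 'I_k.+1 -> idx) z g :
  dbar_sum F (ccons z d) g = 0 -> z.1 = false ->
  dual_deriv z (F d) g =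
  \sum_b dbar_term (fun c => F (ccons z c)) d b g.
Proof.
rewrite /dbar_sum big_ord_recl ccons0 => + z1; rewrite z1 expr0 mul1r ccons_comp_lift.
move/eqP; rewrite addr_eq0 => /eqP ->; rewrite -sumrN; apply: eq_bigr => b _.
rewrite cconsS /dbar_term; case: ifP => _; first by rewrite oppr0.
by rewrite ccons_lift /= /bump /= add1n exprS mulN1r mulNr opprK.
Qed.

(** Cartan's formula for a closed family and the vector with components [a]. The operator [O c] may
    depend on the index, because factors of automorphy do; the last hypothesis carries each
    derivative through it, turning it into [O']. *)
Lemma contraction P n k (F : ('I_k.+1 -> idx) -> V -> R[i]) (a : 'I_n -> R[i])
    (z : 'I_n -> idx) (O : ('I_k -> idx) -> (V -> R[i]) -> V -> R[i]) O' d g :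
  function_space P -> linear_on P O' -> (forall c, P (F c)) ->
  (forall c f, P f -> smooth (O c f)) ->
  (forall i, (z i).1 = false) ->
  (forall i h, dbar_sum F (ccons (z i) d) h = 0) ->
  (forall b f h, (d b).1 = false -> P f ->
    dual_deriv (d b) (O (fun i => d (lift b i)) f) h = O' (dual_deriv (d b) f) h) ->
  dbar_sum (fun c g => \sum_i a i * O c (F (ccons (z i) c)) g) d g =
  O' (fun g => \sum_i a i * dual_deriv (z i) (F d) g) g.
Proof.
move=> fP lO PF sO z1 closedF H.
transitivity (\sum_i a i * dbar_sum (fun c => O c (F (ccons (z i) c))) d g).
  rewrite /dbar_sum; under [RHS]eq_bigr do rewrite mulr_sumr.
  rewrite exchange_big /=; apply: eq_bigr => b _; case: ifP => db.
    by rewrite big1 // => i _; rewrite mulr0.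
  rewrite dual_deriv_sum => [|i]; last by apply: smoothZ; exact: sO.
  rewrite mulr_sumr; apply: eq_bigr => i _.
  by rewrite dual_derivZ 1?mulrCA //; exact: sO.
rewrite (lo_sum _ _ fP lO) => [|i]; last first.
  by apply: (fs_scale fP); exact: (fs_dual_deriv fP).
apply: eq_bigr => i _.
apply: (etrans _ (esym (lo_scale lO _ _ _))); last exact: (fs_dual_deriv fP).
congr (_ * _); rewrite (dbar_sum_op _ fP lO (F := fun c => F (ccons (z i) c))) //.
congr (O' _ g); apply/funext => h; apply/esym; exact: closed_dual_deriv.
Qed.

End Contraction.

Section HarmonicDecomposition.
Context {R : realType} {s t : nat}.
Variable psi : 'I_t -> {linear 'rV[R]_s -> Rcomplex R}.
Local Notation V := (@OTgroup R s t).
Local Notation idx := (@idx s t).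
Local Notation mul := (OTmul psi).
Implicit Types (f : V -> R[i]) (O : (V -> R[i]) -> V -> R[i]).

Lemma shift_deriveC f c v : smooth f -> (forall x, f (x + c) = f x) ->
  forall x, deriveC f (x + c) v = deriveC f x v.
Proof.
move=> sf fc x.
exact: (@periodic_deriveC _ _ 1 (fun=> c) f v sf (fun _ => fc) ord0 x).
Qed.

Lemma nil_invariant_shift f c : nil_invariant f -> xc c = 0 -> forall x, f (x + c) = f x.
Proof. by move=> inv c0 x; apply: inv; rewrite -[RHS]addr0 -c0. Qed.

Lemma shift_nil_invariant f : (forall c, xc c = 0 -> forall x, f (x + c) = f x) ->
  nil_invariant f.
Proof.
move=> H g h gh; rewrite -[h](subrK g) addrC; apply/esym/H.
have -> : xc (h - g) = xc h - xc g by [].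
by rewrite gh subrr.
Qed.

Lemma nil_invariant_deriveC f v : smooth f -> nil_invariant f ->
  nil_invariant (fun x => deriveC f x v).
Proof.
move=> sf inv; apply: shift_nil_invariant => c c0; apply: shift_deriveC => //.
exact: nil_invariant_shift.
Qed.

Lemma nil_invariant_deriveC0 f v g : nil_invariant f -> xc v = 0 -> deriveC f g v = 0.
Proof.
move=> inv v0; apply/is_deriveC_val/is_deriveC_at0.
rewrite (_ : (fun r : R => _) = fun=> f g); first exact: is_deriveC_cst.
apply/funext => r; apply: nil_invariant_shift => //.
have -> : xc (r *: v) = r *: xc v by [].
by rewrite v0 scaler0.
Qed.

Lemma nil_invariant_dual_deriv_z f k g : nil_invariant f ->
  dual_deriv (false, rshift s k) f g = 0.
Proof.
move=> inv; apply: big1 => e _; rewrite nil_invariant_deriveC0 ?mulr0 //.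
by rewrite tangent_rshift; case: e.
Qed.

Lemma nil_invariant_dual_deriv_x f i g : nil_invariant f ->
  dual_deriv (false, lshift t i) f g = (2^-1)%:C%C * deriveC f g (tangent (lshift t i) false).
Proof.
move=> inv; rewrite /dual_deriv big_bool /= nil_invariant_deriveC0 ?mulr0 ?add0r //.
  by rewrite /dual_coef split_lshift.
by rewrite tangent_lshift.
Qed.

Lemma nil_invariant_dual_coef c e : nil_invariant (dual_coef c e : V -> R[i]).
Proof.
move=> g h gh; rewrite /dual_coef.
by case: (fintype.split c.2) => // i; rewrite gh.
Qed.

Definition invariant_space f : Prop := smooth f /\ nil_invariant f.

Lemma invariant_space_function_space : function_space invariant_space.
Proof.
split=> [|f f' [sf pf] [sf' pf']|a f [sf pf]|[a j] f /= -> [sf pf]].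
- by split; [exact: smooth_cst | move=> g h].
- by split; [exact: smoothD | move=> g h gh; rewrite (pf g h gh) (pf' g h gh)].
- by split; [exact: smoothZ | move=> g h gh; rewrite (pf g h gh)].
- split; first exact: smooth_dual_deriv.
  have [[i ->]|[k ->]] := ord_split j.
    move=> g h gh; rewrite !nil_invariant_dual_deriv_x //; congr (_ * _).
    exact: nil_invariant_deriveC.
  by move=> g h gh; rewrite !nil_invariant_dual_deriv_z.
Qed.

Lemma translation_linear_on O : translation_op O -> linear_on invariant_space O.
Proof.
move=> tO; split=> [f f' g [sf _] [sf' _]|a f g [sf _]].
  exact: (top_add tO).
exact: (top_scale tO).
Qed.

Lemma translation_invariant_space O f : translation_op O -> invariant_space f ->
  invariant_space (O f).
Proof.
move=> tO [sf inv]; split; first exact: (top_smooth tO).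
apply: shift_nil_invariant => c c0 x; rewrite -[RHS]mul1r.
apply: (top_shift tO) => // y; rewrite mul1r; exact: nil_invariant_shift.
Qed.

Variable Gam : set V.

Definition automorphic (w : V -> R[i]) f : Prop :=
  forall gam, Gam gam -> forall g, f (mul gam g) = w gam * f g.

Lemma automorphic_nil_periodic w f : abelian_char psi w -> automorphic w f ->
  nil_periodic Gam f.
Proof.
by move=> aw fw gam Gg g0 g; rewrite -(OTmul_nil psi) // fw // (ac_nil aw) // mul1r.
Qed.

Definition base_vec (x : 'rV[R]_s) : V := (x, 0, (0, 0)).

(** Modulo N, left translation is a plain shift, so on invariant functions translation operators
    keep factors of automorphy. *)
Lemma xc_OTmul gam g : xc (mul gam g) = xc (g + base_vec (xc gam)).
Proof. by rewrite [xc (mul gam g)]/(xc gam + xc g) addrC. Qed.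

Lemma translation_automorphic O w f : translation_op O -> invariant_space f ->
  automorphic w f -> automorphic w (O f).
Proof.
move=> tO If fw gam Gg g; have [sO iO] := translation_invariant_space tO If.
have [sf inv] := If.
rewrite (iO _ _ (xc_OTmul gam g)); apply: (top_shift tO) => // y.
by rewrite -(inv _ _ (xc_OTmul gam y)) fw.
Qed.

Definition periodic_space f : Prop := smooth f /\ nil_periodic Gam f.

Lemma nil_periodic_dual_deriv f z : smooth f -> nil_periodic Gam f ->
  nil_periodic Gam (dual_deriv z f).
Proof.
move=> sf pf gam Gg g0 g; apply: eq_bigr => e _; congr (_ * _).
  by apply: nil_invariant_dual_coef; rewrite -[RHS]addr0 -g0.
by apply: shift_deriveC => // x; exact: pf.
Qed.

Lemma periodic_space_function_space : function_space periodic_space.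
Proof.
split=> [|f f' [sf pf] [sf' pf']|a f [sf pf]|z f _ [sf pf]].
- by split; [exact: smooth_cst | move=> gam].
- by split; [exact: smoothD | move=> gam Gg g0 g; rewrite pf ?pf'].
- by split; [exact: smoothZ | move=> gam Gg g0 g; rewrite pf].
- by split; [exact: smooth_dual_deriv | exact: nil_periodic_dual_deriv].
Qed.

Lemma fiber_linear_on w O : fiber_op psi Gam w O -> linear_on periodic_space O.
Proof.
move=> fO; split=> [f f' g [sf pf] [sf' pf']|a f g [sf pf]].
  exact: (fo_add fO).
by apply: (fo_mul fO) => //; exact: smooth_cst.
Qed.

Lemma fiber_op_dual_deriv w O z f g : fiber_op psi Gam w O -> periodic_space f ->
  dual_deriv z (O f) g = O (dual_deriv z f) g.
Proof.
move=> fO [sf pf].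
have pd v : periodic_space (fun g => deriveC f g v).
  split; first exact: smooth_deriveC.
  by move=> gam Gg g0 x; apply: shift_deriveC => // y; exact: pf.
rewrite /dual_deriv.
rewrite (lo_sum _ _ periodic_space_function_space (fiber_linear_on fO)) => [|e].
  apply: eq_bigr => e _; have [sd pd'] := pd (tangent z.2 e).
  rewrite (fo_deriveC fO) //; apply/esym/(fo_mul fO) => //; first exact: smooth_dual_coef.
  exact: nil_invariant_dual_coef.
have [sd pd'] := pd (tangent z.2 e); split.
  by apply: smoothM => //; exact: smooth_dual_coef.
move=> gam Gg g0 x; rewrite pd' //; congr (_ * _).
by apply: nil_invariant_dual_coef; rewrite -[RHS]addr0 -g0.
Qed.

Variable al : V -> R[i].
Hypothesis al_char : abelian_char psi al.
Local Notation mult := (multiplicator psi al).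
Local Notation family p k := (@equivariant_family R s t psi Gam al p k).

Lemma family_automorphic p k F c : family p k F -> automorphic (mult c) (F c).
Proof. by move=> [_ _ _ eF] gam Gg g; exact: eF. Qed.

Lemma family_periodic p k F c : family p k F -> periodic_space (F c).
Proof.
move=> fF; split; first exact: (ef_smooth fF).
apply: (automorphic_nil_periodic (w := mult c)); first exact: abelian_char_multiplicator.
exact: family_automorphic fF.
Qed.

Lemma family_add p k F F' : family p k F -> family p k F' ->
  family p k (fun c g => F c g + F' c g).
Proof.
move=> [s1 a1 t1 e1] [s2 a2 t2 e2]; split=> [c|sg c g|c cp g|c gam Gg g].
- exact: smoothD.
- by rewrite a1 a2 mulrDr.
- by rewrite t1 // t2 // addr0.
- by rewrite e1 // e2 // mulrDr.
Qed.

Lemma alternating_ccons k (F : ('I_k.+1 -> idx) -> V -> R[i]) z : alternating F ->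
  forall (sg : 'S_k) c, F (ccons z (fun i => c (sg i))) =
  (fun g => (-1) ^+ sg * F (ccons z c) g).
Proof.
move=> aF sg c; apply/funext => g.
have := aF (lift_perm ord0 ord0 sg) (ccons z c) g.
rewrite odd_lift_perm /= => <-; congr (F _ g); apply/funext => i.
case: (unliftP ord0 i) => [j|] ->; first by rewrite lift_perm_lift !cconsS.
by rewrite lift_perm_id !ccons0.
Qed.

Section FiberStage.
Variables (z : idx) (M A : (V -> R[i]) -> V -> R[i]).
Hypothesis fh : fiber_homotopy psi Gam z M A.

Lemma family_mean p k F : family p k F -> family p k (fun c => M (F c)).
Proof.
move=> fF; have [sF aF tF eF] := fF; have fM := fh_mean fh.
have lM := fiber_linear_on fM.
split=> [c|sg c g|c cp g|c gam Gg g].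
- by have [sc pc] := family_periodic c fF; exact: (fo_smooth fM).
- rewrite -(lo_scale lM); last exact: family_periodic fF.
  by congr (M _ g); apply/funext => h; exact: aF.
- rewrite (_ : F c = fun=> 0); last by apply/funext => h; exact: tF.
  exact: (lo_zero _ periodic_space_function_space lM).
- have [sc pc] := family_periodic c fF.
  by rewrite (fo_automorphic fM sc pc Gg (eF c gam Gg)) mulr1.
Qed.

Lemma dbar_sum_mean p k F (d : 'I_k.+1 -> idx) g : family p k F ->
  dbar_sum (fun c => M (F c)) d g = M (dbar_sum F d) g.
Proof.
move=> fF; apply: (@dbar_sum_op R s t periodic_space k F (fun=> M) M d g
  periodic_space_function_space (fiber_linear_on (fh_mean fh))) => [c|b f h _ pf]; first exact: family_periodic fF.
exact: (fiber_op_dual_deriv _ _ (fh_mean fh)).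
Qed.

Lemma mean_zero g : M (fun=> 0) g = 0.
Proof. exact: (lo_zero _ periodic_space_function_space (fiber_linear_on (fh_mean fh))). Qed.

(** The primitive is [A] applied to the contraction with [z]. Since [z] is a (0, 1)-index, [p] does
    not change. *)
Lemma fiber_stage p k F : family p k.+1 F -> (forall d g, dbar_sum F d g = 0) ->
  exists2 E, family p k E & forall d g, F d g = M (F d) g + dbar_sum E d g.
Proof.
move=> fF closedF; have [sF aF tF eF] := fF; have fA := fh_primitive fh.
have lA := fiber_linear_on fA; have z1 := fh_type fh.
have pF c : periodic_space (F c) := family_periodic c fF.
exists (fun c => A (F (ccons z c))).
  split=> [c|sg c g|c cp g|c gam Gg g].
  - by have [sc pc] := pF (ccons z c); exact: (fo_smooth fA).
  - by rewrite (alternating_ccons z aF) (lo_scale lA).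
  - rewrite (_ : F _ = fun=> 0); first exact: (lo_zero _ periodic_space_function_space lA).
    by apply/funext => h; apply: tF; rewrite type_count_ccons z1.
  - have [sc pc] := pF (ccons z c).
    by rewrite (fo_automorphic fA sc pc Gg (eF _ gam Gg)) multiplicator_ccons.
move=> d g; have [sd pd] := pF d.
rewrite {1}(fh_homotopy fh sd pd); congr (_ + _).
rewrite (fiber_op_dual_deriv _ _ fA) //.
have := @contraction R s t periodic_space 1 k F (fun=> 1) (fun=> z) (fun=> A) A d g
  periodic_space_function_space lA pF.
under eq_fun do under eq_fun do rewrite big_ord_recl big_ord0 mul1r addr0.
move=> ->.
- congr (A _ g); apply/funext => h.
  by rewrite big_ord_recl big_ord0 mul1r addr0.
- by move=> c f [sf pf]; exact: (fo_smooth fA).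
- by [].
- by move=> _ h; exact: closedF.
- move=> b f h _ pf; exact: (fiber_op_dual_deriv _ _ fA).
Qed.

End FiberStage.
End HarmonicDecomposition.

(** * The base torus and harmonic families *)

Section LatticeStage.
Context {R : realType} {s t : nat}.
Variable psi : 'I_t -> {linear 'rV[R]_s -> Rcomplex R}.
Local Notation V := (@OTgroup R s t).
Local Notation idx := (@idx s t).
Local Notation mul := (OTmul psi).
Implicit Types (f : V -> R[i]).
Variables (Gam : set V) (al : V -> R[i]).
Hypothesis al_char : abelian_char psi al.
Local Notation mult := (multiplicator psi al).
Local Notation family p k := (@equivariant_family R s t psi Gam al p k).
Variables (B : 'M[R]_s) (gam : 'I_s -> V).
Hypotheses (B_unit : B \in unitmx) (Gam_gam : forall r, Gam (gam r)).
Hypothesis xc_gam : forall r, xc (gam r) = row r B.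

Definition lattice_dir (r : 'I_s) : V := base_vec (xc (gam r)).
Local Notation l := lattice_dir.
Local Notation kap c := (fun r => mult c (gam r)).

Lemma deriveC_base_vec f g (x : 'rV[R]_s) : smooth f ->
  deriveC f g (base_vec x) =
  \sum_i (x 0 i)%:C%C * deriveC f g (tangent (lshift t i) false).
Proof.
move=> sf; rewrite {1}(tangent_decomposition (base_vec x)).
rewrite (big_morph (deriveC f g) (fun u w => deriveC_dirD g u w sf) (deriveC_dir0 g sf)).
rewrite big_split_ord /= [X in _ + X]big1 ?addr0 => [|k _]; last first.
  rewrite deriveC_dir_sum // big1 // => e _.
  by rewrite /coordinate split_rshift; case: e; rewrite /= mxE mul0r.
apply: eq_bigr => i _; rewrite deriveC_dir_sum // big_bool /=.
by rewrite /coordinate split_lshift /yc /xc /= mxE mul0r add0r.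
Qed.

Lemma lattice_dir_automorphic k (c : 'I_k -> idx) f r x : nil_invariant f ->
  automorphic psi Gam (mult c) f -> f (x + l r) = kap c r * f x.
Proof.
move=> inv fw; rewrite -(fw _ (Gam_gam r)); apply: inv.
exact/esym/xc_OTmul.
Qed.

(** Dropping an index bar alpha_i leaves the multiplicator unchanged, its character being 1, so the
    same operator acts on both sides. Along bar beta_k both sides vanish by invariance under N. *)
Lemma translation_dual_deriv (T : ('I_s -> R[i]) -> (V -> R[i]) -> V -> R[i])
    k (d : 'I_k.+1 -> idx) b f g :
  (forall kp, translation_op (T kp)) -> (d b).1 = false -> invariant_space f ->
  dual_deriv (d b) (T (kap (fun i => d (lift b i))) f) g = T (kap d) (dual_deriv (d b) f) g.
Proof.
move=> tT db If; have [sf inv] := If.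
have [sO iO] := translation_invariant_space (tT (kap (fun i => d (lift b i)))) If.
case Edb: (d b) => [a j]; have a0 : a = false by rewrite -db Edb.
rewrite a0 {a0} in Edb *; have [[i Ej]|[k' Ej]] := ord_split j; rewrite {}Ej in Edb *.
  rewrite nil_invariant_dual_deriv_x // (top_deriveC (tT _)) //.
  transitivity (T (kap d) (fun h => (2^-1)%:C%C * deriveC f h (tangent (lshift t i) false)) g).
    rewrite (top_scale (tT _)) //; last exact: smooth_deriveC.
    congr (_ * T _ _ g); apply/funext => r; rewrite multiplicator_lift Edb.
    by rewrite /chr /= /char2 split_lshift mulr1.
  congr (T _ _ g); apply/funext => h.
  by rewrite nil_invariant_dual_deriv_x.
rewrite nil_invariant_dual_deriv_z //.
rewrite (_ : dual_deriv _ f = fun=> 0); first by rewrite top_zero.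
by apply/funext => h; rewrite nil_invariant_dual_deriv_z.
Qed.

Lemma family_translation (T : ('I_s -> R[i]) -> (V -> R[i]) -> V -> R[i]) p k F :
  (forall kp, translation_op (T kp)) -> family p k F -> (forall c, nil_invariant (F c)) ->
  family p k (fun c => T (kap c) (F c)) /\ forall c, nil_invariant (T (kap c) (F c)).
Proof.
move=> tT [sF aF tF eF] iF; have If c : invariant_space (F c) by split.
have IT c := translation_invariant_space (tT (kap c)) (If c).
split; last by move=> c; have [] := IT c.
split=> [c|sg c g|c cp g|c gm Gg g].
- by have [] := IT c.
- rewrite multiplicator_perm -(top_scale (tT _)) //.
  by congr (T _ _ g); apply/funext => h; exact: aF.
- rewrite (_ : F c = fun=> 0); first exact: top_zero.
  by apply/funext => h; exact: tF.
- exact: (translation_automorphic (tT (kap c)) (If c) (eF c) Gg).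
Qed.

Lemma dbar_sum_translation (T : ('I_s -> R[i]) -> (V -> R[i]) -> V -> R[i]) p k F
    (d : 'I_k.+1 -> idx) g :
  (forall kp, translation_op (T kp)) -> family p k F -> (forall c, nil_invariant (F c)) ->
  dbar_sum (fun c => T (kap c) (F c)) d g = T (kap d) (dbar_sum F d) g.
Proof.
move=> tT fF iF.
apply: (@dbar_sum_op R s t invariant_space k F (fun c => T (kap c)) (T (kap d)) d g
  invariant_space_function_space (translation_linear_on (tT _))).
  by move=> c; split=> //; exact: (ef_smooth fF).
by move=> b f h db If; exact: translation_dual_deriv.
Qed.

Lemma dbar_sumD p k F F' (d : 'I_k.+1 -> idx) g : family p k F -> family p k F' ->
  dbar_sum (fun c g => F c g + F' c g) d g = dbar_sum F d g + dbar_sum F' d g.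
Proof.
move=> fF fF'; rewrite /dbar_sum -big_split; apply: eq_bigr => b _ /=.
case: (d b).1; first by rewrite addr0.
rewrite (@dual_derivD _ _ _ (d b) _ _ g (ef_smooth fF _) (ef_smooth fF' _)).
exact: mulrDr.
Qed.

Lemma lattice_stage r p k F : family p k.+1 F -> (forall c, nil_invariant (F c)) ->
  (forall d g, dbar_sum F d g = 0) ->
  exists2 E, family p k E &
    forall d g, F d g = harmonic (kap d r) (l r) (F d) g + dbar_sum E d g.
Proof.
move=> fF iF closedF; have [sF aF tF eF] := fF; have If c : invariant_space (F c) by split.
pose z (i : 'I_s) : idx := (false, lshift t i).
pose T (kp : 'I_s -> R[i]) : (V -> R[i]) -> V -> R[i] := primitive (kp r) (l r).
have tT kp : translation_op (T kp) := translation_op_primitive (kp r) (l r).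
(* On invariant functions the (0, 1)-derivative is half of d/dx_i, so the derivative along the
   [r]-th generator has these components. *)
pose a i : R[i] := (2 * row r B 0 i)%:C%C.
have chz i g : chr psi (z i) g = 1 by rewrite /chr /= /char2 split_lshift.
pose E c g := \sum_i a i * T (kap c) (F (ccons (z i) c)) g; exists E.
  rewrite /E; split=> [c|sg c g|c cp g|c gm Gg g].
  - by apply: smooth_sum => i _; apply: smoothZ; exact: (top_smooth (tT _)).
  - rewrite multiplicator_perm mulr_sumr; apply: eq_bigr => i _.
    by rewrite (alternating_ccons (z i) aF) (top_scale (tT _)) // mulrCA.
  - apply: big1 => i _; rewrite (_ : F _ = fun=> 0); first by rewrite top_zero ?mulr0.
    by apply/funext => h; apply: tF; rewrite type_count_ccons.
  - rewrite mulr_sumr; apply: eq_bigr => i _; rewrite mulrCA; congr (_ * _).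
    have := multiplicator_ccons psi al (z i) c gm; rewrite chz mulr1 => <-.
    exact: (translation_automorphic (tT (kap c)) (If _) (eF (ccons (z i) c)) Gg).
move=> d g; have aut : automorphic psi Gam (mult d) (F d) := eF d.
rewrite {1}(@harmonic_primitive _ _ (kap d r) (l r) (F d) g) //; last first.
  by move=> x; exact: lattice_dir_automorphic.
congr (_ + _); rewrite (top_deriveC (translation_op_primitive _ _)) //.
rewrite (@contraction R s t invariant_space s k F a z (fun c => T (kap c)) (T (kap d)) d g
  invariant_space_function_space (translation_linear_on (tT _))) //.
- congr (T _ _ g); apply/funext => h; rewrite /l xc_gam deriveC_base_vec //.
  apply: eq_bigr => i _; rewrite nil_invariant_dual_deriv_x // mulrA; congr (_ * _).
  by rewrite /a -rmorphM /=; congr (_%:C%C); rewrite mulrAC divff ?mul1r // pnatr_eq0.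
- by move=> c f [sf _]; exact: (top_smooth (tT _)).
- by move=> b f h db If'; exact: translation_dual_deriv.
Qed.

(** Each further generator is treated on the harmonic part left by the previous ones, which is again
    a closed invariant family. *)
Lemma harmonics_stage rs p k F : family p k.+1 F -> (forall c, nil_invariant (F c)) ->
  (forall d g, dbar_sum F d g = 0) ->
  exists2 E, family p k E &
    forall d g, F d g = harmonics l (kap d) rs (F d) g + dbar_sum E d g.
Proof.
move=> fF iF closedF; elim: rs => [|r rs [E1 fE1 H1]].
  exists (fun _ _ => 0) => [|d g].
    split=> [c|sg c g|//|c gm _ g]; rewrite ?mulr0 //; exact: smooth_cst.
  rewrite /= [dbar_sum _ _ _]big1 ?addr0 // => b _.
  by case: ifP => // _; rewrite dual_deriv_cst mulr0.
pose T kp := harmonics (V := V) l kp rs.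
have tT kp : translation_op (T kp) := translation_op_harmonics l kp rs.
have [fT iT] := family_translation tT fF iF.
have cT d g : dbar_sum (fun c => T (kap c) (F c)) d g = 0.
  rewrite (dbar_sum_translation _ _ tT fF iF).
  rewrite (_ : dbar_sum F d = fun=> 0); first exact: top_zero.
  by apply/funext => h; exact: closedF.
have [E2 fE2 H2] := lattice_stage r fT iT cT.
exists (fun c g => E2 c g + E1 c g); first exact: family_add.
by move=> d g; rewrite (dbar_sumD _ _ fE2 fE1) addrA -H2 -H1.
Qed.

Lemma invariant_constant k (c : 'I_k -> idx) f : invariant_space f -> automorphic psi Gam (mult c) f ->
  exists a, harmonics l (kap c) (enum 'I_s) f = fun=> a.
Proof.
move=> If aut; have [sf inv] := If.
pose H := harmonics l (kap c) (enum 'I_s) f.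
have tH := translation_op_harmonics l (kap c) (enum 'I_s).
have [sH iH] := translation_invariant_space tH If.
exists (H 0); apply/funext => g; rewrite -[g]add0r; apply: deriveC_line_cst => r.
apply: is_deriveC_eq; first exact: smooth_is_deriveC.
have dl q x : deriveC H x (l q) = 0.
  apply: deriveC_harmonics => //; last by rewrite mem_enum.
  by move=> q' y; exact: lattice_dir_automorphic.
(* Coordinates of [xc g] in the basis of generators: [g] is a combination of the directions [l q]
   plus a vector of N, and all these derivatives vanish. *)
pose y := xc g *m invmx B; set x := 0 + r *: g.
have gE : g = \sum_q y 0 q *: l q + (g - base_vec (xc g)).
  rewrite addrC -addrA -[LHS]addr0; congr (_ + _); apply/esym/eqP.
  rewrite addrC subr_eq0; apply/eqP.
  have -> : xc g = \sum_q y 0 q *: xc (gam q).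
    rewrite -[LHS](mulmxKV B_unit) mulmx_sum_row; apply: eq_bigr => q _.
    by rewrite xc_gam.
  have D : {morph @base_vec R s t : u v / u + v}.
    by move=> u v; rewrite /base_vec; congr (_, _, (_, _)); rewrite /= addr0.
  rewrite (big_morph _ D (erefl : base_vec 0 = 0)); apply: eq_bigr => q _.
  by rewrite /l /base_vec; congr (_, _, (_, _)); rewrite /= scaler0.
rewrite gE deriveC_dirD // deriveC_dir_sum // big1 ?add0r => [|q _]; last first.
  by rewrite dl mulr0.
apply: nil_invariant_deriveC0 => //.
have -> : xc (g - base_vec (xc g)) = xc g - xc g by [].
exact: subrr.
Qed.

Record harmonic_family (p : nat) {k : nat} (h : ('I_k -> idx) -> R[i]) : Prop := HarmonicFamily {
  hf_alternating : forall (sg : 'S_k) c, h (fun i => c (sg i)) = (-1) ^+ sg * h c;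
  hf_type : forall c, type_count c <> p -> h c = 0;
  hf_trivial : forall c gm, Gam gm -> h c != 0 -> mult c gm = 1 }.

Lemma harmonic_family_equivariant p k (h : ('I_k -> idx) -> R[i]) : harmonic_family p h ->
  family p k (fun c _ => h c).
Proof.
move=> [ah th eh]; split=> [c|sg c g|c cp g|c gm Gg g].
- exact: smooth_cst.
- exact: ah.
- exact: th.
- by have [->|h0] := eqVneq (h c) 0; rewrite ?mulr0 // eh // mul1r.
Qed.

Lemma constant_harmonic_family p k (h : ('I_k -> idx) -> R[i]) : family p k (fun c _ => h c) -> harmonic_family p h.
Proof.
move=> [sF aF tF eF]; split=> [sg c|c cp|c gm Gg h0]; [exact: aF c 0 | exact: tF c cp 0|].
by apply: (mulIf h0); rewrite -(eF c gm Gg 0) mul1r.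
Qed.

Variables (z : idx) (M A : (V -> R[i]) -> V -> R[i]).
Hypothesis fh : fiber_homotopy psi Gam z M A.

Local Notation T := (fun kp => harmonics (V := V) l kp (enum 'I_s)).
Let tT kp : translation_op (T kp).
Proof. exact: translation_op_harmonics. Qed.

Lemma family_mean_invariant p k F c : family p k F -> invariant_space (M (F c)).
Proof.
move=> fF; split; first exact: (ef_smooth (family_mean al_char fh fF)).
by have [sf pf] := family_periodic al_char c fF; exact: (fh_invariant fh).
Qed.

Lemma family_harmonic_constant p k F : family p k F ->
  exists h, (forall c, T (kap c) (M (F c)) = fun=> h c) /\ harmonic_family p h.
Proof.
move=> fF; have fM := family_mean al_char fh fF.
have H c : exists a, T (kap c) (M (F c)) = fun=> a.
  apply: invariant_constant; first exact: family_mean_invariant fF.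
  exact: family_automorphic fM.
have [h hE] := choice H; exists h; split=> //; apply: constant_harmonic_family.
have iM c : nil_invariant (M (F c)) by have [] := family_mean_invariant c fF.
have [fT _] := family_translation tT fM iM.
by rewrite (_ : (fun c _ => h c) = fun c => T (kap c) (M (F c))) //; apply/funext => c.
Qed.

Theorem harmonic_decomposition p k (F : ('I_k.+1 -> idx) -> V -> R[i]) : family p k.+1 F -> (forall d g, dbar_sum F d g = 0) ->
  exists h E, [/\ harmonic_family p h, family p k E &
    forall d g, F d g = h d + dbar_sum E d g].
Proof.
move=> fF closedF; have fM := family_mean al_char fh fF.
have iM c : nil_invariant (M (F c)) by have [] := family_mean_invariant c fF.
have cM d g : dbar_sum (fun c => M (F c)) d g = 0.
  rewrite (dbar_sum_mean al_char fh _ _ fF) (_ : dbar_sum F d = fun=> 0).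
    exact: (mean_zero fh).
  by apply/funext => x; exact: closedF.
have [E1 fE1 H1] := fiber_stage al_char fh fF closedF.
have [E2 fE2 H2] := harmonics_stage (enum 'I_s) fM iM cM.
have [h [hE hh]] := family_harmonic_constant fF.
exists h, (fun c g => E2 c g + E1 c g).
split; [exact: hh | exact: family_add | move=> d g].
by rewrite (dbar_sumD _ _ fE2 fE1) addrA H1 H2 hE.
Qed.

(** Taking means and harmonic parts commutes with dbar and turns [E] into constants, which
    derivatives annihilate. It fixes [h d], whose multiplicator is trivial as soon as [h d] is
    nonzero. *)
Theorem exact_harmonic p k (h : ('I_k.+1 -> idx) -> R[i]) (E : ('I_k -> idx) -> V -> R[i]) : harmonic_family p h -> family p k E ->
  (forall d g, h d = dbar_sum E d g) -> forall d, h d = 0.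
Proof.
move=> hh fE hE d; have [//|hd] := eqVneq (h d) 0.
have fM := family_mean al_char fh fE.
have iM c : nil_invariant (M (E c)) by have [] := family_mean_invariant c fE.
have [h' [hE' _]] := family_harmonic_constant fE.
have H : T (kap d) (M (fun=> h d)) 0 = 0.
  rewrite (_ : M (fun=> h d) = dbar_sum (fun c => M (E c)) d); last first.
    apply/funext => g; rewrite (dbar_sum_mean al_char fh _ _ fE); congr (M _ g).
    by apply/funext => g'; exact: hE.
  rewrite -(dbar_sum_translation _ _ tT fM iM) /dbar_sum big1 // => b _.
  by case: ifP => // _; rewrite hE' dual_deriv_cst mulr0.
rewrite (fh_mean_id fh) in H; [|exact: smooth_cst|by []].
rewrite -H harmonics_cst // => r.
exact: (hf_trivial hh).
Qed.

(* Here closedness annihilates every (0, 1)-derivative of [F c], and no exact form has to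
   be subtracted. *)
Theorem holomorphic_harmonic k (F : ('I_k -> idx) -> V -> R[i]) : family k k F -> (forall d g, dbar_sum F d g = 0) ->
  exists2 h, harmonic_family k h & forall d g, F d g = h d.
Proof.
move=> fF closedF; have [sF aF tF eF] := fF.
(* If all indices in [c] are of type (1, 0), closedness with [w] in front has a single term, the
   derivative along [w]. *)
have dF w c g : w.1 = false -> dual_deriv w (F c) g = 0.
  move=> w0; have [ck|ck] := eqVneq (type_count c) k; last first.
    rewrite (_ : F c = fun=> 0); first exact: dual_deriv_cst.
    by apply/funext => x; apply: tF; apply/eqP.
  have := closedF (ccons w c) g; rewrite /dbar_sum big_ord_recl ccons0 w0 expr0 mul1r.
  rewrite ccons_comp_lift big1 ?addr0 // => i _; rewrite cconsS.
  suff -> : (c i).1 by [].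
  apply: contraT => ci; have : (type_count c < k)%N.
    rewrite -[X in (_ < X)%N]card_ord -sum1_card /type_count (bigD1 i) //= [X in (_ < X)%N](bigD1 i) //=.
    by rewrite (negPf ci) add0n add1n ltnS; apply: leq_sum => j _; exact: leq_b1.
  by rewrite ck ltnn.
(* In the fiber homotopy the exact term is [A] applied to the vanishing derivative along [z], so
   [F c] equals its mean. *)
have iF c : nil_invariant (F c).
  have [sc pc] := family_periodic al_char c fF.
  rewrite (_ : F c = M (F c)); first by have [] := family_mean_invariant c fF.
  apply/funext => g; rewrite {1}(fh_homotopy fh sc pc).
  rewrite (fiber_op_dual_deriv _ _ (fh_primitive fh)) //.
  rewrite (_ : dual_deriv z (F c) = fun=> 0).
    rewrite (lo_zero _ (periodic_space_function_space Gam) (fiber_linear_on (fh_primitive fh))).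
    by rewrite addr0.
  by apply/funext => x; apply: dF; exact: (fh_type fh).
have F0 c g : F c g = F c 0.
  rewrite -[g]add0r; apply: deriveC_line_cst => r.
  apply: is_deriveC_eq; first exact: smooth_is_deriveC.
  set x := 0 + r *: g.
  have gE : g = base_vec (xc g) + (g - base_vec (xc g)) by rewrite addrC subrK.
  rewrite gE deriveC_dirD // deriveC_base_vec // big1 ?add0r => [|i _].
    apply: nil_invariant_deriveC0 => //.
    have -> : xc (g - base_vec (xc g)) = xc g - xc g by [].
    exact: subrr.
  have := @dF (false, lshift t i) c x erefl; rewrite nil_invariant_dual_deriv_x //.
  move/eqP; rewrite mulf_eq0 => /orP[|/eqP ->]; last by rewrite mulr0.
  by rewrite eq_complex /= eqxx andbT invr_eq0 pnatr_eq0.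
exists (fun c => F c 0) => //; apply: constant_harmonic_family.
rewrite (_ : (fun c _ => F c 0) = F) //.
by apply/funext => c; apply/funext => g.
Qed.

End LatticeStage.

(** * Dolbeault classes *)

Section MultiIndices.
Context {n p q : nat}.
Local Notation idx := (bool * 'I_n)%type.
Implicit Types (a : incr p n) (b : incr q n).

(** The (1, 0)-indices come first, although the total degree is written [q + p]; hence the cast. *)
Definition multi_index a b (i : 'I_(q + p)) : idx :=
  match fintype.split (cast_ord (addnC q p) i) with
  | inl i => (true, tnth (val a) i)
  | inr j => (false, tnth (val b) j)
  end.

Lemma incr_uniq m (a : incr m n) : uniq (val a).
Proof.
rewrite -(map_inj_uniq val_inj).
exact: (sorted_uniq ltn_trans ltnn (valP a)).
Qed.

Lemma incr_ext m (a a' : incr m n) : val a =i val a' -> a = a'.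
Proof.
move=> E; apply/val_inj/val_inj/(inj_map val_inj).
apply: (irr_sorted_eq ltn_trans ltnn (valP a) (valP a')).
exact: eq_mem_map.
Qed.

Lemma multi_index_mem a b x :
  (exists i, multi_index a b i = x) <-> if x.1 then x.2 \in val a else x.2 \in val b.
Proof.
split=> [[i <-]|].
  by rewrite /multi_index; case: (fintype.split _) => j /=; exact: mem_tnth.
case: x => [[] x] /= /tnthP[j ->].
  exists (cast_ord (esym (addnC q p)) (unsplit (inl j))).
  by rewrite /multi_index cast_ordKV unsplitK.
exists (cast_ord (esym (addnC q p)) (unsplit (inr j))).
by rewrite /multi_index cast_ordKV unsplitK.
Qed.

Lemma multi_index_inj a b : injective (multi_index a b).
Proof.
move=> i j E; apply: (can_inj (cast_ordK (addnC q p))); move: E; rewrite /multi_index.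
move: (cast_ord _ i) (cast_ord _ j) => {}i {}j; rewrite -{2}(splitK i) -{2}(splitK j).
case: (fintype.split i) => i'; case: (fintype.split j) => j' // [] E; congr (unsplit _).
  by congr inl; apply: (tuple_uniqP _ (incr_uniq a)).
by congr inr; apply: (tuple_uniqP _ (incr_uniq b)).
Qed.

Lemma prod_multi_index (C : comRingType) a b (f : idx -> C) :
  \prod_i f (multi_index a b i) =
  (\prod_(i < p) f (true, tnth (val a) i)) * \prod_(j < q) f (false, tnth (val b) j).
Proof.
rewrite (reindex (cast_ord (addnC p q))); last first.
  by apply: onW_bij; exists (cast_ord (addnC q p)) => i; rewrite cast_ord_comp cast_ord_id.
rewrite big_split_ord /=.
by congr (_ * _); apply: eq_bigr => i _;
  rewrite /multi_index cast_ord_comp cast_ord_id ?(unsplitK (inl _)) ?(unsplitK (inr _)).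
Qed.

Lemma sum_multi_index a b (f : idx -> nat) :
  (\sum_i f (multi_index a b i) =
  (\sum_(i < p) f (true, tnth (val a) i)) + \sum_(j < q) f (false, tnth (val b) j))%N.
Proof.
rewrite (reindex (cast_ord (addnC p q))); last first.
  by apply: onW_bij; exists (cast_ord (addnC q p)) => i; rewrite cast_ord_comp cast_ord_id.
rewrite big_split_ord /=.
by congr (_ + _)%N; apply: eq_bigr => i _;
  rewrite /multi_index cast_ord_comp cast_ord_id ?(unsplitK (inl _)) ?(unsplitK (inr _)).
Qed.

Lemma exists_incr m (P : pred 'I_n) : count P (enum 'I_n) = m ->
  exists a : incr m n, forall x, (x \in val a) = P x.
Proof.
move=> cm; have sz : size [seq x <- enum 'I_n | P x] == m by rewrite size_filter cm.
have so : sorted ltn (map val (Tuple sz)).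
  rewrite /= (@sorted_map _ _ val ltn); apply: sorted_filter.
    by move=> x y z; exact: ltn_trans.
  by rewrite -(@sorted_map _ _ val ltn) val_enum_ord iota_ltn_sorted.
exists (exist _ (Tuple sz) so) => x /=.
by rewrite mem_filter mem_enum andbT.
Qed.

(** Collect the values of each type in increasing order. An injective [c] and the sorted multi-index
    then list the same set without repetition, hence differ by a permutation. *)
Lemma injective_multi_index (c : 'I_(q + p) -> idx) : injective c ->
  (\sum_i (c i).1)%N = p ->
  exists a b (sg : 'S_(q + p)), forall i, c i = multi_index a b (sg i).
Proof.
move=> cinj cp.
have cnt e : count (fun x => (e, x) \in codom c) (enum 'I_n) = count (fun x => x.1 == e) (codom c).
  rewrite -!size_filter -(size_map (pair e)); apply/perm_size/uniq_perm.
  - rewrite map_inj_uniq => [|x y [] //]; apply: filter_uniq; exact: enum_uniq.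
  - by apply: filter_uniq; rewrite map_inj_uniq // ; exact: enum_uniq.
  move=> [e' x]; rewrite mem_filter /=; apply/mapP/andP => [[y]|[/eqP -> h]].
    by rewrite mem_filter => /andP[h _] [-> ->].
  by exists x => //; rewrite mem_filter h mem_enum.
have ct : count (fun x : idx => x.1 == true) (codom c) = p.
  rewrite -{2}cp /codom count_map -sum1_count big_mkcond /= big_enum /=.
  by apply: eq_bigr => i _; case: (c i).1.
have cf : count (fun x : idx => x.1 == false) (codom c) = q.
  apply: (@addnI p); rewrite -{1}ct -[RHS]addnC.
  have sc : size (codom c) = (q + p)%N by rewrite size_codom card_ord.
  rewrite -[RHS]sc -(count_predC (fun x : idx => x.1 == true)); congr (_ + _)%N.
  by apply: eq_count => -[[] x].
have [a ha] := exists_incr (etrans (cnt true) ct).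
have [b hb] := exists_incr (etrans (cnt false) cf).
exists a, b.
pose t1 := [tuple c i | i < q + p]; pose t2 := [tuple multi_index a b i | i < q + p].
have u1 : uniq t1 by rewrite map_inj_uniq //; exact: enum_uniq.
have u2 : uniq t2 by rewrite map_inj_uniq; [exact: enum_uniq | exact: multi_index_inj].
have sub : {subset t1 <= t2}.
  move=> x /mapP[i _ ->]; have [|j <-] := proj2 (multi_index_mem a b (c i)).
    by case: (c i) (codom_f c i) => [[] y] /= h; rewrite ?ha ?hb.
  by apply/mapP; exists j; rewrite ?mem_enum.
have [_ t12] := uniq_min_size u1 sub (eq_leq (etrans (size_tuple _) (esym (size_tuple _)))).
have /tuple_permP[sg E] : perm_eq t1 t2 by exact: uniq_perm.
exists sg => i; have := congr1 (fun u => nth (c i) u i) E.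
by rewrite -!tnth_nth !tnth_mktuple.
Qed.

End MultiIndices.

Section DolbeaultClasses.
Context {R : realType} {s t : nat}.
Variable psi : 'I_t -> {linear 'rV[R]_s -> Rcomplex R}.
Local Notation V := (@OTgroup R s t).
Local Notation form := (@Defs.form R s t).
Local Notation idx := (@idx s t).
Variable Gam : set V.
Variables p q : nat.
Local Notation k := (q + p)%N.
Local Notation J := (incr p (s + t) * incr q (s + t))%type.
Local Notation mi j := (multi_index j.1 j.2 : 'I_(q + p) -> idx).
Implicit Types (chi : Gam -> R[i]) (h : ('I_(q + p) -> idx) -> R[i]).

Lemma wedge_formE a b : wedge_form psi a b = wedge (fun i => gen psi (@multi_index (s + t) p q a b i)).
Proof.
rewrite /wedge_form; congr wedge; apply/funext => i; rewrite /multi_index.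
by case: (fintype.split _).
Qed.

Lemma wedge_charE a b g :
  wedge_char psi a b g = \prod_i chr psi (@multi_index (s + t) p q a b i) g.
Proof. by rewrite (prod_multi_index a b (fun c => chr psi c g)). Qed.

Lemma type_count_multi_index (j : J) : type_count (mi j) = p.
Proof.
rewrite /type_count (sum_multi_index j.1 j.2 (fun c => c.1 : nat)) /=.
by rewrite sum_nat_const card_ord muln1 big1 // addn0.
Qed.

Lemma delta_det_neq0 (c d : 'I_k -> idx) : delta_det (R := R) c d != 0 ->
  exists sg : 'S_k, forall i, c i = d (sg i).
Proof.
move=> cd; apply: contrapT => nsg; move: cd; rewrite delta_detE big1 ?eqxx // => sg _.
case: forallP => [H|_]; last by rewrite mulr0.
by case: nsg; exists sg => i; apply/eqP.
Qed.

Lemma delta_det_multi_index (j j' : J) : delta_det (R := R) (mi j) (mi j') = (j == j')%:R.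
Proof.
have [<-|jj'] := eqVneq j j'.
  rewrite /delta_det -[RHS](@det1 R[i] k); congr (\det _); apply/matrixP => i i'.
  by rewrite !mxE (inj_eq (@multi_index_inj _ _ _ _ _)).
apply: contra_neq_eq jj' => /delta_det_neq0[sg E].
have H x : (exists i, mi j i = x) <-> (exists i, mi j' i = x).
  by split=> -[i <-]; [exists (sg i) | exists ((sg^-1)%g i); rewrite E permKV].
case: j j' E H => [a b] [a' b'] _ H; congr pair; apply: incr_ext => x.
- have := H (true, x); rewrite !multi_index_mem /= => -[h1 h2]; exact/idP/idP.
- have := H (false, x); rewrite !multi_index_mem /= => -[h1 h2]; exact/idP/idP.
Qed.

Lemma char_of_G_wedge_char (j : J) : char_of_G psi (wedge_char psi j.1 j.2).
Proof.
have E : wedge_char psi j.1 j.2 = fun g => \prod_i chr psi (mi j i) g.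
  by apply/funext => g; rewrite wedge_charE.
have [] := @abelian_char_prod R s t psi _ (index_enum _) (fun i => chr psi (mi j i)).
  by move=> i; exact/char_of_G_abelian/char_of_G_chr.
rewrite E => h1 h2 h3; split=> //.
by apply: smooth_prod => i _; have [] := char_of_G_chr psi (mi j i).
Qed.

Lemma wedge_line_bundle (j : J) :
  line_bundles psi Gam (fun gam => wedge_char psi j.1 j.2 (val gam)).
Proof. by exists (wedge_char psi j.1 j.2) => //; exact: char_of_G_wedge_char. Qed.

Definition wedge_bundle (j : J) : line_bundles psi Gam :=
  exist (fun chi => chi \in line_bundles psi Gam) _ (mem_set (wedge_line_bundle j)).

Definition harmonic_form h : form k := k`!%:R^-1 *: combination psi (fun c _ => h c).

Lemma spanned_harmonic_form h : spanned psi (harmonic_form h).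
Proof.
rewrite /harmonic_form -[_ *: _]addr0; apply: spanned_lin; first exact: spanned_combination.
exact: spanned0.
Qed.

Lemma coef_harmonic_form h d g : (forall (sg : 'S_k) c, h (fun i => c (sg i)) = (-1) ^+ sg * h c) ->
  coef d (harmonic_form h) g = h d.
Proof. by move=> ah; rewrite /harmonic_form (coef_alternating psi d g) // => sg c _; exact: ah. Qed.

Lemma harmonic_form_lin a h h' :
  harmonic_form (fun c => a * h c + h' c) = a *: harmonic_form h + harmonic_form h'.
Proof.
rewrite /harmonic_form scalerA [a * _]mulrC -scalerA -scalerDr.
by rewrite combination_lin.
Qed.

Lemma harmonic_form_wedge (j : J) :
  harmonic_form (delta_det (mi j)) = wedge_form psi j.1 j.2.
Proof.
have sp : spanned psi (wedge_form psi j.1 j.2).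
  by rewrite wedge_formE; apply: bidegree_spanned; exact: (bidegree_wedge_gen psi erefl).
apply: (spanned_eq (spanned_harmonic_form _) sp) => d g.
rewrite coef_harmonic_form; last by move=> sg c; exact: delta_det_perm.
by rewrite wedge_formE coef_wedge.
Qed.

(** Alternating families vanish on repeated indices and are determined on the others by the sorted
    multi-indices. *)
Lemma harmonic_family_ext al h h' : harmonic_family psi Gam al p h ->
  harmonic_family psi Gam al p h' ->
  (forall j : J, h (mi j) = h' (mi j)) -> h = h'.
Proof.
move=> [ah th _] [ah' th' _] E; apply/funext => c.
have [cp|/eqP cp] := eqVneq (type_count c) p; last by rewrite th // th'.
have alt0 (h0 : ('I_k -> idx) -> R[i]) i i' :
    (forall (sg : 'S_k) c, h0 (fun i => c (sg i)) = (-1) ^+ sg * h0 c) ->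
    i != i' -> c i = c i' -> h0 c = 0.
  move=> ah0 ii' cc; have := ah0 (tperm i i') c; rewrite odd_tperm ii' expr1 mulN1r.
  have -> : (fun j => c (tperm i i' j)) = c.
    by apply/funext => j; case: tpermP => // ->.
  move/eqP; rewrite -addr_eq0 -mulr2n mulrn_eq0 /= => /eqP //.
have [cinj|] := pselect (injective c); last first.
  move=> ninj; have [i [i' [ii' cc]]] : exists i i', i != i' /\ c i = c i'.
    apply: contrapT => H; apply: ninj => i i' cc; apply/eqP/contraT => ii'.
    by case: H; exists i, i'.
  by rewrite (alt0 h i i') // (alt0 h' i i').
have [a [b [sg csg]]] := injective_multi_index cinj cp.
have -> : c = fun i => mi (a, b) (sg i) by apply/funext.
by rewrite ah ah' E.
Qed.

Section Class.
Variables (chi : Gam -> R[i]) (al : V -> R[i]).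
Hypotheses (al_char : abelian_char psi al) (chiE : forall gam : Gam, chi gam = al (val gam)).
Local Notation hfamily := (harmonic_family psi Gam al).

Lemma harmonic_form_closed h : hfamily p h -> harmonic_form h \in @dbar_closed _ _ _ psi Gam p q chi.
Proof.
move=> hh; have fh := harmonic_family_equivariant hh.
have E := @E_form_combination _ _ _ psi Gam al p q chi _ chiE fh.
rewrite unfold_in /=; apply/asboolP; split; first exact: E.
have [bE sE _] := E; have := is_dbar_coef (leq_addl q p) bE sE.
rewrite (_ : combination _ (dbar_coef _) = 0) // -(combination0 psi).
congr combination; apply/funext => d; apply/funext => g.
rewrite /dbar_coef; case: (d ord0).1 => //.
rewrite (_ : (fun g => _) = fun=> k`!%:R^-1 * h (fun i => d (lift ord0 i))).
  exact: dual_deriv_cst.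
apply/funext => x; congr (_ * _); apply: coef_harmonic_form; exact: (hf_alternating hh).
Qed.

(* The coefficients of the component of [x] with values in the line bundle [chi]. *)
Definition class_coef (x : ext_tensor R p q (s + t)) (c : 'I_k -> idx) : R[i] :=
  \sum_(j : J) (if val (wedge_bundle j) == chi then x j else 0) * delta_det (mi j) c.

Lemma class_coef_multi x j :
  class_coef x (mi j) = if val (wedge_bundle j) == chi then x j else 0.
Proof.
rewrite /class_coef (bigD1 j) //= delta_det_multi_index eqxx mulr1 big1 ?addr0 //.
by move=> j' j'j; rewrite delta_det_multi_index (negPf j'j) mulr0.
Qed.

Lemma class_coef_family x : hfamily p (class_coef x).
Proof.
split=> [sg c|c cp|c gm Gg].
- rewrite /class_coef mulr_sumr; apply: eq_bigr => j _.
  by rewrite delta_det_perm mulrCA.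
- apply: big1 => j _; rewrite delta_det_type ?mulr0 // type_count_multi_index.
  by move=> E; apply: cp.
move=> h0; have [j] : exists j : J, (if val (wedge_bundle j) == chi then x j else 0) *
    delta_det (mi j) c != 0.
  apply: contrapT => H; move: h0; rewrite /class_coef big1 ?eqxx // => j _.
  by apply/eqP/contraT => nj; case: H; exists j.
case: ifP => [/eqP chij|_]; last by rewrite mul0r eqxx.
rewrite mulf_eq0 negb_or => /andP[_ /delta_det_neq0[sg E]].
rewrite /multiplicator; have -> : \prod_i chr psi (c i) gm = al gm.
  rewrite (reindex_inj (@perm_inj _ sg)).
  under eq_bigr do rewrite -E.
  rewrite -wedge_charE -[gm]/(val (exist _ gm (mem_set Gg) : Gam)) -chiE -chij.
  by [].
by rewrite divff // (ac_neq0 al_char).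
Qed.

Lemma class_coef_lin a x y c :
  class_coef (a *: x + y) c = a * class_coef x c + class_coef y c.
Proof.
rewrite /class_coef mulr_sumr -big_split; apply: eq_bigr => j _ /=.
by case: ifP => _; rewrite ?ffunE ?mul0r ?mulr0 ?addr0 // mulrDl mulrA.
Qed.

Lemma hfamily_class h : hfamily p h ->
  exists x : ext_tensor R p q (s + t), forall x' : ext_tensor R p q (s + t),
    (forall j, val (wedge_bundle j) = chi -> x' j = x j) -> class_coef x' = h.
Proof.
move=> hh; exists [ffun j => h (mi j)] => x' xx'.
apply: (harmonic_family_ext (class_coef_family x') hh) => j.
rewrite class_coef_multi; case: eqP => [/xx' ->|nchi]; first by rewrite ffunE.
(* A nonzero coefficient forces the multiplicator to be 1 on Gamma, so the bundle of [j] is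
   [chi]. *)
apply/esym/eqP/contraT => h0; case: nchi; apply/funext => gm.
have := hf_trivial hh (set_mem (valP gm)) h0; rewrite /multiplicator -wedge_charE => E.
have w0 : wedge_char psi j.1 j.2 (val gm) != 0 by have [_ ->] := char_of_G_wedge_char j.
by apply: (mulIf (invr_neq0 w0)); rewrite chiE E divff.
Qed.

End Class.
End DolbeaultClasses.

Section Decomposition.
Context {R : realType} {s t : nat}.
Variable psi : 'I_t -> {linear 'rV[R]_s -> Rcomplex R}.
Local Notation V := (@OTgroup R s t).
Local Notation idx := (@idx s t).
Variables (Gam : set V) (p : nat) (chi : Gam -> R[i]) (al : V -> R[i]).
Hypotheses (al_char : abelian_char psi al) (chiE : forall gam : Gam, chi gam = al (val gam)).
Local Notation hfamily := (harmonic_family psi Gam al).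
Variables (B : 'M[R]_s) (gam : 'I_s -> V).
Hypotheses (B_unit : B \in unitmx) (Gam_gam : forall r, Gam (gam r)).
Hypothesis xc_gam : forall r, xc (gam r) = row r B.
Variables (z : idx) (M A : (V -> R[i]) -> V -> R[i]).
Hypothesis fh : fiber_homotopy psi Gam z M A.

Lemma closed_coef q om : om \in @dbar_closed _ _ _ psi Gam p q chi ->
  [/\ equivariant_family psi Gam al p (fun c => coef c om), bidegree psi p om &
    forall d g, dbar_sum (fun c => coef c om) d g = 0].
Proof.
rewrite unfold_in /= => /asboolP[E d0]; have [bom som _] := E; split=> //.
  exact: equivariant_family_coef al_char chiE E.
move=> d g; rewrite -(coef_dbar d g (leq_addl q p) bom som d0); exact: coef_zero.
Qed.

Lemma closed_decomposition q om : om \in @dbar_closed _ _ _ psi Gam p q chi ->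
  exists2 h, hfamily p h & om - harmonic_form psi h \in @dbar_exact _ _ _ psi Gam p q chi.
Proof.
move=> /closed_coef[fF bom closedF]; case: q om fF bom closedF => [|q] om fF bom closedF.
  have [h hh hE] := holomorphic_harmonic al_char fh fF closedF.
  exists h => //; rewrite unfold_in /= subr_eq0; apply/eqP.
  apply: (spanned_eq (bidegree_spanned bom) (@spanned_harmonic_form R s t psi p 0 h)) => d g.
  by rewrite hE (@coef_harmonic_form R s t psi p 0 h d g (hf_alternating hh)).
have [h [E [hh fE hE]]] := harmonic_decomposition al_char B_unit Gam_gam xc_gam fh fF closedF.
exists h => //; rewrite unfold_in /=; apply/asboolP.
have EE := @E_form_combination _ _ _ psi Gam al p q chi _ chiE fE.
have [bE sE _] := EE.
exists ((q + p)`!%:R^-1 *: combination psi E) => //.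
have dE := is_dbar_coef (leq_addl q p) bE sE.
rewrite (_ : om - _ = combination psi (dbar_coef (fun c g => (q + p)`!%:R^-1 *
  coef c ((q + p)`!%:R^-1 *: combination psi E) g))) //.
apply: spanned_eq.
- by apply: spannedB; [exact: bidegree_spanned bom | exact: (@spanned_harmonic_form R s t psi p q.+1 h)].
- exact: spanned_combination.
move=> d g; rewrite (coef_dbar d g (leq_addl q p) bE sE dE) coef_sub hE.
rewrite (@coef_harmonic_form R s t psi p q.+1 h d g (hf_alternating hh)).
rewrite addrC addKr; congr (dbar_sum _ d g); apply/funext => c; apply/funext => x.
by rewrite coef_alternating //; exact: (ef_alternating fE).
Qed.

Lemma exact_harmonic_form q (h : ('I_(q + p) -> idx) -> R[i]) : hfamily p h ->
  harmonic_form psi h \in @dbar_exact _ _ _ psi Gam p q chi -> forall d, h d = 0.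
Proof.
case: q h => [|q] h hh; rewrite unfold_in /=.
  move=> /eqP E d; rewrite -(coef_harmonic_form psi d 0 (hf_alternating hh)) E.
  exact: coef_zero.
move=> /asboolP[eta E dE]; have [bE sE _] := E.
have fE := equivariant_family_coef al_char chiE E.
apply: (exact_harmonic al_char B_unit Gam_gam xc_gam fh hh fE) => d g.
rewrite -(@coef_harmonic_form R s t psi p q.+1 h d g (hf_alternating hh)).
exact: (coef_dbar d g (leq_addl q p) bE sE dE).
Qed.

End Decomposition.

(** * Graded bases and dimensions *)

Section Dimension.
Context {F : fieldType}.

Lemma edim_basis (R : realType) (V : lmodType F) (I : finType) (e : I -> V) :
  (forall c : I -> F, \sum_i c i *: e i = 0 -> forall i, c i = 0) ->
  (forall v, exists c : I -> F, v = \sum_i c i *: e i) ->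
  edim R V = (#|I|%:R)%:E.
Proof.
move=> indep span; apply/eqP; rewrite eq_le; apply/andP; split.
  apply: ge_ereal_sup => _ [n [v vi] <-]; rewrite lee_fin ler_nat.
  have [c cE] := choice (fun i => span (v i)).
  (* Coordinates of the independent vectors form a row-free matrix, whose rank cannot exceed its
     number of columns. *)
  pose C : 'M[F]_(n, #|I|) := \matrix_(i, j) c i (enum_val j).
  suff /eqP <- : row_free C by exact: rank_leq_col.
  apply: inj_row_free => u uC; apply/rowP => i; rewrite mxE.
  apply: (vi (fun i => u 0 i)).
  under eq_bigr do rewrite cE scaler_sumr.
  rewrite exchange_big big1 // => j _ /=.
  under eq_bigr do rewrite scalerA.
  rewrite -scaler_suml; have := congr1 (fun w : 'rV_#|I| => w 0 (enum_rank j)) uC.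
  rewrite !mxE; under eq_bigr do rewrite mxE enum_rankK.
  by move=> ->; rewrite scale0r.
apply: ereal_sup_ubound; exists #|I| => //; exists (fun i => e (enum_val i)) => c c0 i.
rewrite -(enum_valK i); apply: (indep (fun j => c (enum_rank j))).
rewrite (reindex (@enum_val I predT)); last by apply: onW_bij; exact: enum_val_bij.
by rewrite -[RHS]c0; apply: eq_bigr => j _; rewrite enum_valK.
Qed.

Lemma esum_fiber_card (R : realType) (E : choiceType) (J : finType) (beta : J -> E) :
  (\esum_(chi in [set: E]) (#|[pred j | beta j == chi]|%:R : R)%:E = (#|J|%:R)%:E)%E.
Proof.
transitivity (\esum_(chi in [set: E]) \sum_(j : J) ((beta j == chi)%:R : R)%:E)%E.
  apply: eq_esum => chi _; rewrite sumEFin; congr (_%:E).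
  by rewrite -sum1_card natr_sum big_mkcond; apply: eq_bigr => j _; rewrite inE; case: eqP.
rewrite esum_sum => [|chi j _ _]; last by rewrite lee_fin ler0n.
transitivity (\sum_(j : J) (1 : R)%:E)%E; last first.
  by rewrite sumEFin -[X in (_ = (X%:R)%:E)%E]sum1_card natr_sum.
apply: eq_bigr => j _.
rewrite -[RHS](_ : \esum_(chi in [set beta j]) (1 : R)%:E = _)%E; last first.
  by rewrite esum_set1 // lee_fin ler01.
rewrite [RHS]esum_mkcond; apply: eq_esum => chi _.
have [->|nj] := eqVneq (beta j) chi; first by rewrite mem_set.
by rewrite memNset //= => E1; rewrite E1 eqxx in nj.
Qed.

Section GradedBasis.
Context {E : choiceType} (H : E -> lmodType F) {J : finType} (beta : J -> E).
Variables (T : lmodType F) (coord : T -> J -> F) (vec : (J -> F) -> T).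
Hypothesis coord_linear : forall a x y j, coord (a *: x + y) j = a * coord x j + coord y j.
Hypothesis vecK : forall c j, coord (vec c) j = c j.
Hypothesis coordK : forall x, vec (coord x) = x.
Variable phi : forall chi, {linear T -> H chi}.
Hypothesis phi_inj : forall chi x, phi chi x = 0 -> forall j, beta j = chi -> coord x j = 0.
Hypothesis phi_surj : forall chi y, exists x, phi chi x = y.
Hypothesis phi_local : forall chi x x',
  (forall j, beta j = chi -> coord x j = coord x' j) -> phi chi x = phi chi x'.

Lemma coord_ext x y : (forall j, coord x j = coord y j) -> x = y.
Proof. by move=> xy; rewrite -(coordK x) -(coordK y); congr vec; apply/funext. Qed.

Lemma coord0 j : coord 0 j = 0.
Proof.
have := coord_linear 1 0 0 j; rewrite scaler0 addr0 mul1r => /eqP.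
by rewrite -subr_eq subrr eq_sym => /eqP.
Qed.

Lemma coordB x y j : coord (x - y) j = coord x j - coord y j.
Proof. by rewrite addrC -scaleN1r coord_linear mulN1r addrC. Qed.

Lemma coord_sum (I : Type) (r : seq I) (c : I -> F) (x : I -> T) j :
  coord (\sum_(i <- r) c i *: x i) j = \sum_(i <- r) c i * coord (x i) j.
Proof.
elim: r => [|i r IH]; first by rewrite !big_nil coord0.
by rewrite !big_cons coord_linear IH.
Qed.

(** Outside the finite image of [beta] no coordinate is relevant, so locality makes the component
    equal to that of 0. *)
Lemma graded_finsupp (x : T) : ((fun chi => phi chi x) : dprod H) \in @finsupp F E H.
Proof.
rewrite unfold_in /=; apply/asboolP.
have fr : finite_set (range beta) by apply: finite_image; exact: finite_finset.
apply: sub_finite_set fr.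
move=> chi; apply: contra_neqP => nchi.
rewrite -[RHS](linear0 (phi chi)); apply: phi_local => j jchi.
by case: nchi; exists j.
Qed.

Definition graded_map (x : T) : dsum H := Subspace (graded_finsupp x).

Lemma graded_map_linear : linear graded_map.
Proof.
move=> a x y; apply: val_inj; apply: functional_extensionality_dep => chi.
by rewrite [LHS]/= linearP.
Qed.

HB.instance Definition _ :=
  GRing.isLinear.Build F T (dsum H) *:%R graded_map graded_map_linear.

Lemma graded_map_bijective : bijective graded_map.
Proof.
have inj : injective graded_map.
  move=> x y xy; apply: coord_ext => j; apply/eqP; rewrite -subr_eq0 -coordB.
  apply/eqP/(@phi_inj (beta j)) => //; rewrite linearB; apply/eqP; rewrite subr_eq0; apply/eqP.
  exact: (congr1 (fun u : dsum H => subspace_val u (beta j)) xy).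
have surj (y : dsum H) : exists x, graded_map x = y.
  have ex chi : exists x, phi chi x = subspace_val y chi by exact: phi_surj.
  have [x xE] := choice ex.
  (* Glue the preimages: the coordinate [j] is taken from the preimage chosen for its own grade
     [beta j]. *)
  exists (vec (fun j => coord (x (beta j)) j)); apply: val_inj.
  apply: functional_extensionality_dep => chi /=; rewrite -[RHS]xE.
  by apply: phi_local => j <-; rewrite vecK.
have [g gE] := choice surj; exists g => [x|]; last exact: gE.
by apply: inj; rewrite gE.
Qed.

Lemma edim_graded (R : realType) :
  edim R T = (\esum_(chi in [set: E]) edim R (H chi))%E.
Proof.
pose e j0 := vec (fun j => (j == j0)%:R).
have delta (I : finType) (f : I -> J) (c : I -> F) (finj : injective f) i :
    coord (\sum_i c i *: e (f i)) (f i) = c i.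
  rewrite coord_sum (bigD1 i) //= vecK eqxx mulr1 big1 ?addr0 // => i' i'i.
  by rewrite vecK (inj_eq finj) eq_sym (negPf i'i) mulr0.
rewrite (@edim_basis R T J e); first last.
- move=> x; exists (coord x); apply: coord_ext => j; apply/esym.
  exact: (delta J id (coord x)).
- move=> c c0 i; rewrite -[LHS](delta J id c (fun _ _ => id) i) c0; exact: coord0.
rewrite -(esum_fiber_card R beta); apply: eq_esum => chi _; apply/esym.
pose I : finType := {j : J | beta j == chi}.
rewrite (@edim_basis R (H chi) I (fun i => phi chi (e (val i)))).
- by rewrite card_sig.
- move=> c c0 i; rewrite -[LHS](delta I val c val_inj i).
  apply: (@phi_inj chi); last exact/eqP/(valP i).
  by rewrite linear_sum -[RHS]c0; apply: eq_bigr => i' _; rewrite linearZ.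
- move=> y; have [x <-] := phi_surj y; exists (fun i => coord x (val i)).
  transitivity (phi chi (\sum_(i : I) coord x (val i) *: e (val i))).
    apply: phi_local => j /eqP jchi; apply/esym.
    exact: (delta I val (fun i => coord x (val i)) val_inj (exist _ j jchi)).
  by rewrite linear_sum; apply: eq_bigr => i' _; rewrite linearZ.
Qed.

End GradedBasis.

Lemma quot_class_eq (V : lmodType F) (B : submodClosed V) (u v : V) :
  quot_class B u = quot_class B v <-> u - v \in B.
Proof.
have -> : (u - v \in B) = (u - v \in divisor B) by [].
rewrite Quotient.idealrBE; by split=> [E|/eqP //]; apply/eqP; exact: E.
Qed.

Lemma quot_class_eq0 (V : lmodType F) (B : submodClosed V) (u : V) :
  quot_class B u = 0 <-> u \in B.
Proof.
have -> : 0 = quot_class B 0 by rewrite /quot_class raddf0.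
by rewrite quot_class_eq subr0.
Qed.

Lemma quot_class_surj (V : lmodType F) (B : submodClosed V) (y : quotient B) :
  exists u, y = quot_class B u.
Proof. by elim/quotW: y => u; exists u. Qed.

Lemma quot_class_linear (V : lmodType F) (B : submodClosed V) : linear (quot_class B).
Proof.
move=> a u v; rewrite -[a *: quot_class B u]quot_classZ.
by rewrite /quot_class raddfD.
Qed.

End Dimension.

Section ClassMap.
Context {R : realType} {s t : nat}.
Variable psi : 'I_t -> {linear 'rV[R]_s -> Rcomplex R}.
Local Notation V := (@OTgroup R s t).
Local Notation idx := (@idx s t).
Variables (Gam : set V) (p q : nat).
Local Notation E := (line_bundles psi Gam).
Local Notation J := (incr p (s + t) * incr q (s + t))%type.

Lemma line_bundle_char (chi : E) : exists al,
  abelian_char psi al /\ forall gam : Gam, val chi gam = al (val gam).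
Proof.
by have [al ha alE] := set_mem (valP chi); exists al; split=> //; exact: char_of_G_abelian.
Qed.

Lemma class_form_closed (chi : E) (x : ext_tensor R p q (s + t)) :
  harmonic_form psi (class_coef psi (val chi) x) \in @dbar_closed _ _ _ psi Gam p q (val chi).
Proof.
have [al [ha chiE]] := line_bundle_char chi.
by apply: (harmonic_form_closed chiE); exact: class_coef_family.
Qed.

Definition class_cocycle chi x : cocycles psi p q (val chi) := Subspace (class_form_closed chi x).

Definition class_map chi (x : ext_tensor R p q (s + t)) : dolbeault_of psi Gam p q chi :=
  quot_class _ (class_cocycle chi x).

Lemma class_map_linear chi : linear (class_map chi).
Proof.
move=> a x y; rewrite /class_map -quot_class_linear; congr quot_class.
apply: val_inj; rewrite [LHS]/= linearP /= -harmonic_form_lin; congr harmonic_form.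
by apply/funext => c; exact: class_coef_lin.
Qed.

HB.instance Definition _ chi := GRing.isLinear.Build R[i] (ext_tensor R p q (s + t))
  (dolbeault_of psi Gam p q chi) *:%R (class_map chi) (class_map_linear chi).

Lemma class_coef_local (chi : E) (x x' : ext_tensor R p q (s + t)) :
  (forall j, wedge_bundle psi Gam j = chi -> x j = x' j) ->
  class_coef psi (val chi) x = class_coef psi (val chi) x'.
Proof.
move=> xx'; apply/funext => c; apply: eq_bigr => j _; congr (_ * _).
by case: eqP => // /val_inj /xx'.
Qed.

Lemma class_map_local (chi : E) (x x' : ext_tensor R p q (s + t)) :
  (forall j, wedge_bundle psi Gam j = chi -> x j = x' j) -> class_map chi x = class_map chi x'.
Proof.
move=> /class_coef_local E; congr quot_class; apply: val_inj => /=.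
by congr harmonic_form.
Qed.

Variables (B : 'M[R]_s) (gam : 'I_s -> V).
Hypotheses (B_unit : B \in unitmx) (Gam_gam : forall r, Gam (gam r)).
Hypothesis xc_gam : forall r, xc (gam r) = row r B.
Variables (z : idx) (M A : (V -> R[i]) -> V -> R[i]).
Hypothesis fh : fiber_homotopy psi Gam z M A.

(** A harmonic form that is exact vanishes, and its coefficient at the multi-index [j] is [x j] when
    the bundle of [j] is [chi]. *)
Lemma class_map_inj (chi : E) x : class_map chi x = 0 ->
  forall j, wedge_bundle psi Gam j = chi -> x j = 0.
Proof.
have [al [ha chiE]] := line_bundle_char chi.
move=> /quot_class_eq0; rewrite unfold_in /= => ex j jchi.
have := exact_harmonic_form ha chiE B_unit Gam_gam xc_gam fh
  (class_coef_family ha chiE x) ex (multi_index j.1 j.2).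
by rewrite class_coef_multi jchi eqxx.
Qed.

Lemma class_map_surj (chi : E) y : exists x, class_map chi x = y.
Proof.
have [al [ha chiE]] := line_bundle_char chi.
have [w yE] := quot_class_surj y.
have [h hh ex] := closed_decomposition ha chiE B_unit Gam_gam xc_gam fh (valP w).
have [x xh] := hfamily_class ha chiE hh.
exists x; rewrite yE; by apply/esym/quot_class_eq; rewrite unfold_in /= xh.
Qed.

Lemma class_map_basis (a : incr p (s + t)) (b : incr q (s + t)) :
  let chi := wedge_bundle psi Gam (a, b) in
  subspace_val (class_cocycle chi (ext_basis R a b)) = wedge_form psi a b.
Proof.
move=> chi /=; rewrite -(harmonic_form_wedge psi (a, b)); congr harmonic_form.
apply/funext => c; rewrite /class_coef (bigD1 (a, b)) //= eqxx ffunE eqxx mul1r.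
rewrite big1 ?addr0 // => j jab; rewrite ffunE (negPf jab).
by case: ifP; rewrite mul0r.
Qed.

Lemma class_map_basis0 (a : incr p (s + t)) (b : incr q (s + t)) (chi : E) :
  chi <> wedge_bundle psi Gam (a, b) -> class_map chi (ext_basis R a b) = 0.
Proof.
have f0 := class_map_linear chi (-1) 0 0; rewrite scaler0 addr0 scaleN1r addNr in f0.
move=> nchi; rewrite -[RHS]f0; apply: class_map_local => j jchi.
rewrite !ffunE; case: eqP => // jE; case: nchi; by rewrite -jE.
Qed.

Theorem dolbeault_isomorphism : let H := dolbeault_of psi Gam p q in
  (exists Phi : {linear ext_tensor R p q (s + t) -> dsum H},
     bijective Phi /\ forall x chi, subspace_val (Phi x) chi = class_map chi x) /\
  edim R (ext_tensor R p q (s + t)) = (\esum_(chi in [set: E]) edim R (H chi))%E.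
Proof.
move=> H.
pose coord (x : ext_tensor R p q (s + t)) (j : J) : R[i] := x j.
pose vec (c : J -> R[i]) : ext_tensor R p q (s + t) := [ffun j => c j].
have cl a x y j : coord (a *: x + y) j = a * coord x j + coord y j by rewrite /coord !ffunE.
have vK c j : coord (vec c) j = c j by rewrite /coord ffunE.
have cK x : vec (coord x) = x by apply/ffunP => j; rewrite ffunE.
have inj : forall chi x, class_map chi x = 0 ->
    forall j, wedge_bundle psi Gam j = chi -> coord x j = 0 := class_map_inj.
split; last first.
  exact: (edim_graded cl vK cK (phi := fun chi => class_map chi) inj class_map_surj class_map_local).
pose f := graded_map (H := H) (phi := fun chi => class_map chi) (beta := @wedge_bundle R s t psi Gam p q)
  (coord := coord) class_map_local.
exists f; split; last by [].
exact: (graded_map_bijective cl vK cK inj class_map_surj class_map_local).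
Qed.

End ClassMap.

Theorem theorem4p1 (R : realType) (s t : nat) (s_gt0 : (0 < s)%N) (t_gt0 : (0 < t)%N)
  (K : fieldExtType rat) (dimK : \dim {:K} = (s + (t + t))%N)
  (sigma : 'I_(s + (t + t)) -> {rmorphism K -> R[i]})
  (sigmaP : is_embedding_list sigma)
  (U : set K) (UP : admissible sigma U)
  (psi : 'I_t -> {linear 'rV[R]_s -> Rcomplex R})
  (psiP : forall u k, U u -> cexp (psi k (log_vec sigma u)) = sigma_cplx sigma k u)
  (p q : nat) :
  let Gam := OTlattice sigma U in
  let Echi := line_bundles psi Gam in
  let H := dolbeault_of psi Gam p q in
  (exists Phi : {linear ext_tensor R p q (s + t) -> dsum H},
     bijective Phi /\
     forall (a : incr p (s + t)) (b : incr q (s + t)),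
       exists (chi : Echi) (w : cocycles psi p q (val chi)),
         [/\ forall gam : Gam, val chi gam = wedge_char psi a b (val gam),
             subspace_val w = wedge_form psi a b,
             subspace_val (Phi (ext_basis R a b)) chi = quot_class _ w
           & forall chi' : Echi, chi' <> chi ->
               subspace_val (Phi (ext_basis R a b)) chi' = 0])
  /\ edim R (ext_tensor R p q (s + t)) = \esum_(chi in [set: Echi]) edim R (H chi).
Proof.
move=> Gam Echi H.
have [z [M [A fh]]] := exists_fiber_homotopy sigmaP UP psiP dimK t_gt0.
have [B [gam [B_unit Gam_gam xc_gam]]] := exists_lattice_directions UP.
have [[Phi [Phi_bij PhiE]] dimE] :=
  @dolbeault_isomorphism R s t psi Gam p q B gam B_unit Gam_gam xc_gam z M A fh.
split; last exact: dimE.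
exists Phi; split=> // a b.
pose chi := wedge_bundle psi Gam (a, b).
exists chi, (class_cocycle chi (ext_basis R a b)); split.
- by [].
- exact: class_map_basis.
- exact: PhiE.
- by move=> chi' nchi; rewrite PhiE; exact: class_map_basis0.
Qed.
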